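(* Let $\mathcal T_H$ be a shape regular conforming triangulation of $\Omega$. There exists a constant $C_0>0$, depending only on the shape regularity of $\mathcal T_H$, such that the following holds for every $f\in L^2(\Omega)$ and every conforming refinement $\mathcal T_h$ of $\mathcal T_H$ obtained by newest vertex bisection. Let $\boldsymbol\sigma=\mathcal L^{-1}f$, $\boldsymbol\sigma_h=\mathcal L_h^{-1}f_h$ and $\boldsymbol\sigma_H=\mathcal L_H^{-1}f_H$. Then $$(\boldsymbol\sigma-\boldsymbol\sigma_h,\boldsymbol\sigma_h-\boldsymbol\sigma_H)\le \sqrt{C_0}\,\|\boldsymbol\sigma-\boldsymbol\sigma_h\|\,\mathrm{osc}(f_h,\mathcal T_H).$$ Thus for any $\delta>0$, $$(1-\delta)\|\boldsymbol\sigma-\boldsymbol\sigma_h\|^2\le\|\boldsymbol\sigma-\boldsymbol\sigma_H\|^2-\|\boldsymbol\sigma_h-\boldsymbol\sigma_H\|^2+\frac{C_0}{\delta}\,\mathrm{osc}^2(f_h,\mathcal T_H),$$ and in particular, when $\mathrm{osc}(f_h,\mathcal T_H)=0$, $$\|\boldsymbol\sigma-\boldsymbol\sigma_h\|^2=\|\boldsymbol\sigma-\boldsymbol\sigma_H\|^2-\|\boldsymbol\sigma_h-\boldsymbol\sigma_H\|^2 .$$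
   Context: $\Omega\subset\mathbb R^2$ is a polygonal, simply connected bounded domain; $\|\cdot\|$ and $(\cdot,\cdot)$ are the $L^2(\Omega)$ (or $L^2(\Omega)^2$) norm and inner product. $\boldsymbol\Sigma=\boldsymbol H(\mathrm{div};\Omega)$, $U=L^2(\Omega)$. Continuous problem: for $f\in L^2(\Omega)$, $(\boldsymbol\sigma,u)=\mathcal L^{-1}f$ denotes the unique pair in $\boldsymbol\Sigma\times U$ with $(\boldsymbol\sigma,\boldsymbol\tau)-(\mathrm{div}\,\boldsymbol\tau,u)=0$ for all $\boldsymbol\tau\in\boldsymbol\Sigma$ and $(\mathrm{div}\,\boldsymbol\sigma,v)=(f,v)$ for all $v\in U$. One also writes $\boldsymbol\sigma=\mathcal L^{-1}f$ when only the first component is of interest. Discrete spaces: for a conforming triangulation $\mathcal T_H$, $(\boldsymbol\Sigma_H,U_H)$ is either the Raviart–Thomas pair of a fixed order $p\ge0$: $\boldsymbol\Sigma_H=\{\boldsymbol\tau\in\boldsymbol H(\mathrm{div};\Omega):\boldsymbol\tau|_T\in \mathcal P_p(T)^2+\boldsymbol x\,\mathcal P_p(T)\ \forall T\in\mathcal T_H\}$, $U_H=\{v\in L^2(\Omega):v|_T\in\mathcal P_p(T)\ \forall T\in\mathcal T_H\}$; or the Brezzi–Douglas–Marini pair of a fixed order $p\ge1$: $\boldsymbol\Sigma_H=\{\boldsymbol\tau\in\boldsymbol H(\mathrm{div};\Omega):\boldsymbol\tau|_T\in\mathcal P_p(T)^2\ \forall T\in\mathcal T_H\}$, $U_H=\{v\in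 L^2(\Omega):v|_T\in\mathcal P_{p-1}(T)\ \forall T\in\mathcal T_H\}$. The same family and the same $p$ are used on all triangulations; $p$ is fixed, so constants may depend on $p$. $Q_H:L^2(\Omega)\to U_H$ is the $L^2$ projection and $f_H=Q_Hf$ (similarly $f_h=Q_hf$ on $\mathcal T_h$). Discrete problem: for $g\in U_H$, $(\boldsymbol\sigma_H,u_H)=\mathcal L_H^{-1}g$ is the unique pair in $\boldsymbol\Sigma_H\times U_H$ with $(\boldsymbol\sigma_H,\boldsymbol\tau_H)-(\mathrm{div}\,\boldsymbol\tau_H,u_H)=0$ for all $\boldsymbol\tau_H\in\boldsymbol\Sigma_H$ and $(\mathrm{div}\,\boldsymbol\sigma_H,v_H)=(g,v_H)$ for all $v_H\in U_H$; one writes $\boldsymbol\sigma_H=\mathcal L_H^{-1}g$ for the first component. $\mathcal L_h^{-1}$ is the same on $\mathcal T_h$. Data oscillation: for $g\in L^2(\Omega)$, $\mathrm{osc}(g,\mathcal T_H)=\big(\sum_{T\in\mathcal T_H}H_T^2\|g-Q_Hg\|_{L^2(T)}^2\big)^{1/2}$, with $H_T=\mathrm{diam}(T)$. In particular $\mathrm{osc}(f_h,\mathcal T_H)=\big(\sum_{T\in\mathcal T_H}H_T^2\|f_h-f_H\|_{L^2(T)}^2\big)^{1/2}$. *)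

(* Defs.v *)
From HB Require Import structures.
From mathcomp Require Import all_boot all_order all_algebra.
From mathcomp Require Import all_classical all_reals all_analysis.

Set Implicit Arguments.
Unset Strict Implicit.
Unset Printing Implicit Defensive.

Import Order.TTheory GRing.Theory Num.Theory.
Import numFieldNormedType.Exports.

Local Open Scope classical_set_scope.
Local Open Scope ring_scope.

Section Plane.
Context {R : realType}.

(* The norm that [R * R] carries in the library is the sup norm, hence the
   separate Euclidean norm below (both induce the same topology). *)
Definition eucl (x : R * R) : R := Num.sqrt (x.1 ^+ 2 + x.2 ^+ 2).

Definition segment (a b : R * R) : set (R * R) :=
  [set x | exists t : R, 0 <= t <= 1 /\
     x = ((1 - t) * a.1 + t * b.1, (1 - t) * a.2 + t * b.2)].

Definition frontier (A : set (R * R)) : set (R * R) := closure A `\` A°.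

Definition path_connected (A : set (R * R)) : Prop :=
  forall x y, A x -> A y ->
  exists g : R -> R * R, [/\ {within `[0, 1], continuous g},
    forall t, 0 <= t <= 1 -> A (g t), g 0 = x & g 1 = y].

Definition simply_connected (A : set (R * R)) : Prop :=
  path_connected A /\
  forall g : R -> R * R, {within `[0, 1], continuous g} ->
    (forall t, 0 <= t <= 1 -> A (g t)) -> g 0 = g 1 ->
  exists H : R * R -> R * R,
    [/\ {within [set ts : R * R | 0 <= ts.1 <= 1 /\ 0 <= ts.2 <= 1],
           continuous H},
        forall t s, 0 <= t <= 1 -> 0 <= s <= 1 -> A (H (t, s)),
        forall t, 0 <= t <= 1 -> H (t, 0) = g t,
        forall t, 0 <= t <= 1 -> H (t, 1) = g 0 &
        forall s, 0 <= s <= 1 -> H (0, s) = g 0 /\ H (1, s) = g 0].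

(* The boundary is not required to be a Jordan curve: slits are allowed. *)
Definition polygonal_domain (Om : set (R * R)) : Prop :=
  [/\ Om !=set0, open Om, connected Om, bounded_set Om &
      exists s : seq ((R * R) * (R * R)),
        frontier Om = [set x | exists2 e, e \in s & segment e.1 e.2 x]].

End Plane.

Section L2.
Context {R : realType}.

Definition plane_measure :
    {measure set (measurableTypeR R * measurableTypeR R) -> \bar R} :=
  (@lebesgue_measure R \x @lebesgue_measure R)%E.

(* Elements of L^2(D) are represented by functions on the whole plane; only
   their values on [D] matter, and only up to a null set. *)
Definition L2 (D : set (R * R)) (f : R * R -> R) : Prop :=
  (f \_ D) \in Lfun plane_measure 2%:E.

Definition inner (D : set (R * R)) (f g : R * R -> R) : R :=
  \int[plane_measure]_(x in D) (f x * g x).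

Definition norm2 (D : set (R * R)) (f : R * R -> R) : R :=
  Num.sqrt (inner D f f).

Definition vL2 (D : set (R * R)) (s : R * R -> R * R) : Prop :=
  L2 D (fun x => (s x).1) /\ L2 D (fun x => (s x).2).

Definition vinner (D : set (R * R)) (s t : R * R -> R * R) : R :=
  \int[plane_measure]_(x in D) ((s x).1 * (t x).1 + (s x).2 * (t x).2).

Definition vnorm2 (D : set (R * R)) (s : R * R -> R * R) : R :=
  Num.sqrt (vinner D s s).

Definition is_L2proj (Om : set (R * R)) (V : set (R * R -> R))
    (f q : R * R -> R) : Prop :=
  V q /\ forall v, V v -> inner Om (f \- q) v = 0.

End L2.

Section Hdiv.
Context {R : realType}.

Definition partial1 (phi : R * R -> R) (x : R * R) : R := 'D_(1, 0) phi x.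
Definition partial2 (phi : R * R -> R) (x : R * R) : R := 'D_(0, 1) phi x.

(* C^oo: all iterated partial derivatives are everywhere (Frechet)
   differentiable. *)
Definition smooth (phi : R * R -> R) : Prop :=
  forall (s : seq bool) (x : R * R),
    differentiable
      (foldr (fun b => if b then partial1 else partial2) phi s) x.

Definition test_function (Om : set (R * R)) (phi : R * R -> R) : Prop :=
  smooth phi /\
  exists K : set (R * R),
    [/\ compact K, K `<=` Om & forall x, ~ K x -> phi x = 0].

(* [s] belongs to H(div; Om) and div s = d in the sense of distributions. *)
Definition is_div (Om : set (R * R)) (s : R * R -> R * R) (d : R * R -> R)
    : Prop :=
  [/\ vL2 Om s, L2 Om d &
      forall phi, test_function Om phi ->
        vinner Om s (fun x => (partial1 phi x, partial2 phi x)) =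
        - inner Om d phi].

Definition Hdiv (Om : set (R * R)) : set (R * R -> R * R) :=
  [set s | exists d, is_div Om s d].

(* Common form of the continuous and the discrete mixed problem. *)
Definition mixed_solution (Om : set (R * R)) (Sigma : set (R * R -> R * R))
    (U : set (R * R -> R)) (g : R * R -> R)
    (s : R * R -> R * R) (u : R * R -> R) : Prop :=
  [/\ Sigma s, U u,
      forall t dt, Sigma t -> is_div Om t dt ->
        vinner Om s t - inner Om dt u = 0 &
      forall ds v, is_div Om s ds -> U v -> inner Om ds v = inner Om g v].

End Hdiv.

Section Mesh.
Context {R : realType}.

(* [(v0, v1, v2)] is the triangle with these vertices, labelled so that [v0] is
   its newest vertex; the refinement edge is then [v1 v2]. *)
Definition triangle : Type := ((R * R) * (R * R) * (R * R))%type.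
Implicit Types (T : triangle) (M : seq triangle).

Definition vertices T : seq (R * R) := [:: T.1.1; T.1.2; T.2].

Definition region T : set (R * R) :=
  [set x | exists a b c : R,
     [/\ 0 <= a, 0 <= b, 0 <= c, a + b + c = 1 &
         x = (a * T.1.1.1 + b * T.1.2.1 + c * T.2.1,
              a * T.1.1.2 + b * T.1.2.2 + c * T.2.2)]].

Definition nondegenerate T : Prop :=
  (T.1.2.1 - T.1.1.1) * (T.2.2 - T.1.1.2)
    - (T.2.1 - T.1.1.1) * (T.1.2.2 - T.1.1.2) != 0.

Definition diam T : R :=
  sup [set d | exists x y, [/\ region T x, region T y & d = eucl (x - y)]].

Definition inscribed_diam T : R :=
  sup [set d | exists (c : R * R) (r : R),
     [/\ 0 <= r, forall x, eucl (x - c) <= r -> region T x & d = 2 * r]].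

(* Ciarlet's condition h_T <= gamma * rho_T. *)
Definition shape_regular (gamma : R) M : Prop :=
  forall T, T \in M -> diam T <= gamma * inscribed_diam T.

Definition conforming_triangulation (Om : set (R * R)) M : Prop :=
  [/\ uniq M,
      forall T, T \in M -> nondegenerate T /\ (region T)° `<=` Om,
      closure Om = [set x | exists2 T, T \in M & region T x] &
      forall T T', T \in M -> T' \in M -> T != T' ->
        [\/ region T `&` region T' = set0,
            exists v, [/\ v \in vertices T, v \in vertices T' &
              region T `&` region T' = [set v]] |
            exists v w, [/\ v != w,
              (v \in vertices T) && (w \in vertices T),
              (v \in vertices T') && (w \in vertices T') &
              region T `&` region T' = segment v w]]].

Definition midpoint (a b : R * R) : R * R :=
  ((a.1 + b.1) / 2, (a.2 + b.2) / 2).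

Definition child1 T : triangle := (midpoint T.1.2 T.2, T.1.1, T.1.2).
Definition child2 T : triangle := (midpoint T.1.2 T.2, T.1.1, T.2).

(* [nvb_refinement M M']: [M'] is obtained from [M] by finitely many newest
   vertex bisections; the intermediate meshes need not be conforming. *)
Inductive nvb_refinement M : seq triangle -> Prop :=
| nvb_refl : nvb_refinement M M
| nvb_bisect M1 T M2 :
    nvb_refinement M (M1 ++ T :: M2) ->
    nvb_refinement M (M1 ++ child1 T :: child2 T :: M2).

End Mesh.

Arguments triangle : clear implicits.

Section Spaces.
Context {R : realType}.

(* Polynomial functions of total degree at most [p]. *)
Definition Poly2 (p : nat) : set (R * R -> R) :=
  [set g | exists c : nat -> nat -> R, forall x,
     g x = \sum_(i < p.+1) \sum_(j < p.+1 | (i + j <= p)%N)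
             c i j * x.1 ^+ i * x.2 ^+ j].

Inductive mixed_family := RT | BDM.

Definition valid_order (F : mixed_family) (p : nat) : Prop :=
  match F with RT => True | BDM => (1 <= p)%N end.

Definition local_field (F : mixed_family) (p : nat) : set (R * R -> R * R) :=
  match F with
  | RT => [set s | exists q1 q2 r, [/\ Poly2 p q1, Poly2 p q2, Poly2 p r &
             forall x, s x = (q1 x + x.1 * r x, q2 x + x.2 * r x)]]
  | BDM => [set s | exists q1 q2, [/\ Poly2 p q1, Poly2 p q2 &
              forall x, s x = (q1 x, q2 x)]]
  end.

Definition scalar_degree (F : mixed_family) (p : nat) : nat :=
  match F with RT => p | BDM => p.-1 end.

(* Elements of L^2 and H(div) are defined up to null sets, so their
   restrictions to an element are polynomial almost everywhere. *)
Definition Sigma_h (F : mixed_family) (p : nat) (Om : set (R * R))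
    (M : seq (triangle R)) : set (R * R -> R * R) :=
  [set s | Hdiv Om s /\
     forall T, T \in M -> exists2 q, local_field F p q &
       {ae plane_measure, forall x, region T x -> s x = q x}].

Definition U_h (F : mixed_family) (p : nat) (Om : set (R * R))
    (M : seq (triangle R)) : set (R * R -> R) :=
  [set v | L2 Om v /\
     forall T, T \in M -> exists2 q, Poly2 (scalar_degree F p) q &
       {ae plane_measure, forall x, region T x -> v x = q x}].

(* [o] is osc(g, M), where Qg denotes the L^2 projection of [g] onto U_M. The
   L^2(T) norm is taken on the interior of the closed triangle, which lies in
   [Om]; on the boundary of [Om] the function [g] is unconstrained. *)
Definition is_osc (F : mixed_family) (p : nat) (Om : set (R * R))
    (M : seq (triangle R)) (g : R * R -> R) (o : R) : Prop :=
  exists2 Qg, is_L2proj Om (U_h F p Om M) g Qg &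
    o = Num.sqrt
          (\sum_(T <- M) diam T ^+ 2 * norm2 (region T)° (g \- Qg) ^+ 2).

End Spaces.

(* Main.v *)
(* Let [e = sigma - sigma_h], [tau = sigma_h - sigma_H].  On each coarse triangle
   the function [f_h - f_H] has mean zero, and there is a field [t] in [Sigma_h],
   supported in the coarse triangles, with [div t = f_h - f_H = div tau] and
   [||t|| <= 2 osc].  The mixed equations give [(e, tau - t) = 0], hence
   [(e, tau) = (e, t) <= ||e|| ||t||]; so [C0 = 4] works, uniformly in the shape
   regularity.

   The field [t] is built along the bisection tree of a coarse triangle by a
   Haar-type decomposition.  At an interior node [T] with vertices [v0, v1, v2],
   the field [x - v1] on the first child and [v2 - x] on the second has constant
   divergence [2], [-2] and no flux through the boundary of [T], so it transfers
   mean values between the children.  On a leaf the remaining polynomial [b] is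
   inverted by Appell's second order operator on the simplex: it preserves the
   degree, its eigenvalues on nonconstant polynomials are at most [-3], and it is
   in divergence form with weights vanishing on the edges, so that [b = L v] is
   the divergence of a polynomial field without normal flux.  Bisection reduces
   [tsize] by the factor [5/6], which keeps the energy bound uniform in the depth
   of the tree.

   Every integration by parts is obtained by differentiating the integral along
   measure preserving maps (translations and one piecewise affine flow), see
   [flow_pint]; no trace theory is needed. *)
Require Import Defs.
From HB Require Import structures.
From mathcomp Require Import all_boot all_order all_algebra.
From mathcomp Require Import all_classical all_reals all_analysis.
From mathcomp Require Import measurable_realfun ring lra.
Import Order.TTheory GRing.Theory Num.Theory.
Import numFieldNormedType.Exports.
Set Implicit Arguments.
Unset Strict Implicit.
Unset Printing Implicit Defensive.
Local Open Scope classical_set_scope.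
Local Open Scope ring_scope.

(** * Integration over the plane *)

(** The number of bisections between the two meshes is unbounded, so an estimate per level that is
    merely added up would grow with the depth. The divergences produced at different levels of a
    tree are orthogonal, hence they add up exactly. The fields are not orthogonal, and the
    contraction of [tsize] has to pay only for their cross terms. All constants come from squared
    side lengths, never from angles. No building block has flux through the boundary of its own
    triangle. Therefore blocks from different levels and different triangles can be added freely
    inside H(div), although the intermediate meshes may be nonconforming. The mean value of
    [f_h - f_H] matters at the root only: the tree construction prescribes the divergence up to a
    constant, and this constant vanishes because a field without boundary flux has a divergence of
    mean zero. The discrete equation tests [div sigma_h] against piecewise polynomials only. To
    conclude [div sigma_h = f_h] one must know that the distributional divergence of a piecewise
    polynomial field is itself piecewise polynomial; the smooth bumps and the du Bois-Reymond lemma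
    serve this purpose. *)

Section Integration.
Context {R : realType}.
Implicit Types (f g : R * R -> R).
Local Notation mu := (@plane_measure R).
Local Notation plane := (measurableTypeR R * measurableTypeR R)%type.

Definition pmeas f : Prop := measurable_fun [set: plane] f.
Definition pintegrable f : Prop := mu.-integrable setT (EFin \o f).
Definition pint f : R := \int[mu]_x f x.

Definition pae (A : R * R -> Prop) : Prop := {ae mu, forall x, A x}.

Lemma paeE (A : R * R -> Prop) : pae A = mu.-negligible (~` A).
Proof. by []. Qed.

Lemma paeS (A B : R * R -> Prop) : (forall x, A x -> B x) -> pae A -> pae B.
Proof. by move=> AB; rewrite !paeE; apply: negligibleS; exact: subsetC. Qed.

Lemma paeI (A B : R * R -> Prop) : pae A -> pae B -> pae (fun x => A x /\ B x).
Proof. by rewrite !paeE => mA mB; rewrite [~` _]setCI; exact: negligibleU. Qed.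

Lemma paeW (A : R * R -> Prop) : (forall x, A x) -> pae A.
Proof. by move=> h; apply: aeW. Qed.

Lemma pae_seq (I : eqType) (s : seq I) (A : I -> R * R -> Prop) :
  (forall i, i \in s -> pae (A i)) -> pae (fun x => forall i, i \in s -> A i x).
Proof.
elim: s => [|i s IH] h; first exact: paeW.
have hi := h i (mem_head _ _).
have hs := IH (fun j js => h j (mem_behead (s := i :: s) js)).
by apply: paeS (paeI hi hs) => x [Ai As] j; rewrite inE => /predU1P[->|/As].
Qed.

Lemma eq_pint f g : f =1 g -> pint f = pint g.
Proof. by move=> fg; rewrite (funext fg). Qed.

Lemma pint0 : pint (fun=> 0) = 0.
Proof. by rewrite /pint /Rintegral integral0. Qed.

Lemma pintegrable_meas f : pintegrable f -> pmeas f.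
Proof. by move/integrableP => [/measurable_EFinP]. Qed.

Lemma pintegrableD f g : pintegrable f -> pintegrable g ->
  pintegrable (fun x => f x + g x).
Proof.
by move=> fi gi; have := integrableD measurableT fi gi; apply: eq_integrable.
Qed.

Lemma pintegrableZ a f : pintegrable f -> pintegrable (fun x => a * f x).
Proof.
by move=> fi; have := integrableZl measurableT a fi; apply: eq_integrable.
Qed.

Lemma pintegrableB f g : pintegrable f -> pintegrable g ->
  pintegrable (fun x => f x - g x).
Proof.
by move=> fi gi; have := integrableB measurableT fi gi; apply: eq_integrable.
Qed.

Lemma pintD f g : pintegrable f -> pintegrable g ->
  pint (fun x => f x + g x) = pint f + pint g.
Proof. by move=> fi gi; rewrite /pint RintegralD. Qed.

Lemma pintB f g : pintegrable f -> pintegrable g ->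
  pint (fun x => f x - g x) = pint f - pint g.
Proof. by move=> fi gi; rewrite /pint RintegralB. Qed.

Lemma pintZ a f : pintegrable f -> pint (fun x => a * f x) = a * pint f.
Proof. by move=> fi; rewrite /pint RintegralZl. Qed.

Lemma pint_ge0 f : (forall x, 0 <= f x) -> 0 <= pint f.
Proof. by move=> f0; apply: Rintegral_ge0. Qed.

Lemma le_pint f g : pintegrable f -> pintegrable g -> (forall x, f x <= g x) ->
  pint f <= pint g.
Proof. by move=> fi gi fg; apply: le_Rintegral. Qed.

Lemma le_pintegrable f g : pmeas f -> pintegrable g ->
  (forall x, `|f x| <= g x) -> pintegrable f.
Proof.
move=> mf gi fg; apply: le_integrable gi => //; first exact/measurable_EFinP.
by move=> x _ /=; rewrite lee_fin (le_trans (fg x))// ler_norm.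
Qed.

Lemma ae_eq_pint f g : pmeas f -> pmeas g -> pae (fun x => f x = g x) ->
  pint f = pint g.
Proof.
move=> mf mg fg; rewrite /pint /Rintegral; congr fine.
apply: ae_eq_integral => //; [exact/measurable_EFinP|exact/measurable_EFinP|].
by apply: paeS fg => x /= -> _.
Qed.

Lemma pint_eq0_ae f : pintegrable f -> (forall x, 0 <= f x) -> pint f = 0 ->
  pae (fun x => f x = 0).
Proof.
move=> fi f0 If; have mf := pintegrable_meas fi.
have : (\int[mu]_x `|(EFin \o f) x| = 0)%E.
  rewrite -[RHS]/((0 : R)%:E) -If /pint /Rintegral fineK; last first.
    exact: integrable_fin_num.
  by apply: eq_integral => x _ /=; rewrite ger0_norm.
move/ae_eq_integral_abs => /(_ measurableT) H.
have {}H := H (proj2 (measurable_EFinP _ _) mf).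
by apply: paeS H => x /(_ I) /= [].
Qed.

Lemma pmeas_cst a : pmeas (fun=> a). Proof. exact: measurable_cst. Qed.
Lemma pmeasD f g : pmeas f -> pmeas g -> pmeas (fun x => f x + g x).
Proof. exact: measurable_funD. Qed.
Lemma pmeasB f g : pmeas f -> pmeas g -> pmeas (fun x => f x - g x).
Proof. exact: measurable_funB. Qed.
Lemma pmeasM f g : pmeas f -> pmeas g -> pmeas (fun x => f x * g x).
Proof. exact: measurable_funM. Qed.
Lemma pmeas_fst : pmeas fst. Proof. exact: measurable_fst. Qed.
Lemma pmeas_snd : pmeas snd. Proof. exact: measurable_snd. Qed.

Lemma pmeas_comp (h : R -> R) f : measurable_fun setT h -> pmeas f ->
  pmeas (fun x => h (f x)).
Proof. by move=> mh mf; apply: measurableT_comp. Qed.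

Lemma pmeas_lt f g : pmeas f -> pmeas g ->
  measurable ([set x | f x < g x] : set plane).
Proof.
move=> mf mg; have := measurable_fun_ltr mf mg.
by move=> /(_ measurableT [set true] I); rewrite setTI; apply.
Qed.

Lemma pmeas_indic (A : set plane) : measurable A -> pmeas (\1_A).
Proof. by move=> mA; exact: measurable_indic. Qed.

Lemma pmeas_box a b c d : measurable ([set x | [&& a < x.1, x.1 < b, c < x.2 &
  x.2 < d]] : set plane).
Proof.
rewrite [X in measurable X](_ : _ = ([set x | a < x.1] `&` [set x | x.1 < b]) `&`
  ([set x | c < x.2] `&` [set x | x.2 < d])); last first.
  by apply/seteqP; split => x /= => [/and4P[? ? ? ?]//|[[-> ->][-> ->]]].
apply: measurableI; apply: measurableI; apply: (pmeas_lt);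
 try exact: pmeas_cst; try exact: pmeas_fst; exact: pmeas_snd.
Qed.

Definition box (B : R) : set plane := `[- B, B] `*` `[- B, B].

Lemma measurable_box B : measurable (box B).
Proof. by apply: measurableX. Qed.

Lemma boxP B x : box B x <-> `|x.1| <= B /\ `|x.2| <= B.
Proof. by rewrite /box /= !in_itv /= !ler_norml. Qed.

Lemma mu_box_fin B : (mu (box B) < +oo)%E.
Proof.
rewrite [mu _](@product_measure1E _ _ _ _ R)//=.
rewrite lebesgue_measure_itv /=; case: ifP => _; last by rewrite mule0.
by rewrite -EFinB -EFinM ltry.
Qed.

(** One constant bounds both the values and the support, so [B * \1_(box B)] is an integrable
    majorant. The class is stable under products with locally bounded measurable functions, which
    covers all integrands built from polynomials, test functions and indicators of triangles. *)
Definition nice_by B f := pmeas f /\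
  forall x, `|f x| <= B /\ (f x != 0 -> `|x.1| <= B /\ `|x.2| <= B).
Definition nice f := exists B, nice_by B f.

Lemma pintegrable_indic (A : set plane) : measurable A -> (mu A < +oo)%E ->
  pintegrable (\1_A).
Proof.
move=> mA Aoo; apply/integrableP; split.
  by apply/measurable_EFinP; exact: pmeas_indic.
rewrite (eq_integral (EFin \o \1_A)) ?integral_indic ?setIT//.
by move=> x _ /=; rewrite ger0_norm// indicE ler0n.
Qed.

Lemma nice_le_indic B f x : nice_by B f -> `|f x| <= B * \1_(box B) x.
Proof.
move=> [_ /(_ x)[fB fx]]; rewrite indicE.
have [/boxP xB|xB] := pselect (box B x).
  by rewrite mem_set ?mulr1//; exact/boxP.
rewrite memNset// mulr0; have [->|/fx xx] := eqVneq (f x) 0; first by rewrite normr0.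
by exfalso; apply: xB; exact/boxP.
Qed.

Lemma nice_pintegrable f : nice f -> pintegrable f.
Proof.
move=> [B nB]; apply: (@le_pintegrable _ (fun x => B * \1_(box B) x)).
- by case: nB.
- by apply: pintegrableZ; apply: pintegrable_indic (measurable_box _) (mu_box_fin _).
- by move=> x; exact: nice_le_indic.
Qed.

Lemma nice_meas f : nice f -> pmeas f. Proof. by case=> B []. Qed.

Lemma nice0 : nice (fun=> 0).
Proof. by exists 0; split=> [|x]; [exact: pmeas_cst|rewrite normr0 eqxx]. Qed.

Lemma niceD f g : nice f -> nice g -> nice (fun x => f x + g x).
Proof.
move=> [B Bf] [C Cg].
have B0 : 0 <= B by case: Bf => _ /(_ (0,0)) [+ _]; exact: le_trans.
have C0 : 0 <= C by case: Cg => _ /(_ (0,0)) [+ _]; exact: le_trans.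
exists (B + C); split; first by apply: pmeasD; [case: Bf|case: Cg].
move=> x; have [_ /(_ x)[f1 f2]] := Bf; have [_ /(_ x)[g1 g2]] := Cg; split.
  by rewrite (le_trans (ler_normD _ _))// lerD.
have [f0|/f2[]] := eqVneq (f x) 0; last by move=> *; lra.
rewrite f0 add0r => /g2[*]; lra.
Qed.

Definition locbounded f := forall B, exists C, forall x, box B x -> `|f x| <= C.

Lemma nice_locb f : nice f -> locbounded f.
Proof. by move=> [C [_ Cf]] B; exists C => x _; case: (Cf x). Qed.

Lemma niceM f g : nice f -> pmeas g -> locbounded g -> nice (fun x => f x * g x).
Proof.
move=> [B Bf] mg /(_ B) [C Cg].
have B0 : 0 <= B by case: Bf => _ /(_ (0,0)) [+ _]; exact: le_trans.
exists (Num.max (B * C) B); split; first by apply: pmeasM => //; case: Bf.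
move=> x; have [_ /(_ x)[f1 f2]] := Bf; split.
  have [->|/f2 /boxP xB] := eqVneq (f x) 0; first by rewrite mul0r normr0 le_max B0 orbT.
  by rewrite normrM le_max ler_pM// Cg.
rewrite mulf_eq0 negb_or => /andP[/f2[h1 h2] _].
by rewrite !le_max h1 h2 !orbT.
Qed.

Lemma niceZ a f : nice f -> nice (fun x => a * f x).
Proof.
move=> nf; rewrite (_ : (fun _ => _) = (fun x => f x * a)).
  by apply: niceM => //; [exact: pmeas_cst|move=> B; exists `|a|].
by apply/funext => x; rewrite mulrC.
Qed.

Lemma niceMM f g : nice f -> nice g -> nice (fun x => f x * g x).
Proof. by move=> nf ng; apply: niceM => //; [exact: nice_meas|exact: nice_locb]. Qed.

Lemma niceB f g : nice f -> nice g -> nice (fun x => f x - g x).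
Proof.
move=> nf ng; rewrite (_ : (fun _ => _) = (fun x => f x + (-1) * g x)).
  by apply: niceD => //; exact: niceZ.
by apply/funext => x; rewrite mulN1r.
Qed.

Lemma nice_sum (I : Type) (s : seq I) (F : I -> R * R -> R) :
  (forall i, nice (F i)) -> nice (fun x => \sum_(i <- s) F i x).
Proof.
move=> nF; elim: s => [|i s IH].
  by under eq_fun do rewrite big_nil; exact: nice0.
by under eq_fun do rewrite big_cons; exact: niceD.
Qed.

Lemma bounded_convergence (F : nat -> R * R -> R) f (B : R) :
  (forall n, nice_by B (F n)) -> pmeas f ->
  pae (fun x => F n x @[n --> \oo] --> f x) ->
  pint (F n) @[n --> \oo] --> pint f.
Proof.
move=> nF mf Ff.
have [] := @dominated_convergence _ _ _ mu setT measurableT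
  (fun n => EFin \o F n) (EFin \o f) (EFin \o (fun x => B * \1_(box B) x)).
- by move=> n; apply/measurable_EFinP; case: (nF n).
- exact/measurable_EFinP.
- by apply: paeS Ff => x /= Fx _; apply: cvg_EFin => //; exact: nearW.
- by apply: pintegrableZ; apply: pintegrable_indic (measurable_box _) (mu_box_fin _).
- by apply: aeW => x n _ /=; rewrite lee_fin; exact: nice_le_indic.
move=> fi _; rewrite /pint /Rintegral => H.
apply: fine_cvg => /=; rewrite fineK; last exact: integrable_fin_num.
exact: H.
Qed.

End Integration.

(** * Measure preserving maps and weak divergences *)

Section Invariance.
Context {R : realType}.
Implicit Types (f g : R * R -> R).
Local Notation mu := (@plane_measure R).
Local Notation plane := (measurableTypeR R * measurableTypeR R)%type.
Local Notation leb := (@lebesgue_measure R).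

(** The pushforward agrees with Lebesgue measure on half-open intervals, which determine it. Scaling
    is treated in the same way. *)
Lemma lebesgue_translate (c : R) (A : set (measurableTypeR R)) : measurable A ->
  leb ((fun y => y + c) @^-1` A) = leb A.
Proof.
move=> mA.
have mf : measurable_fun [set: measurableTypeR R] (fun y : R => y + c).
  by apply: measurable_funD; [exact: measurable_id|exact: measurable_cst].
pose h : measurableTypeR R -> measurableTypeR R := fun y : R => y + c.
pose hm : {mfun measurableTypeR R >-> measurableTypeR R} :=
  HB.pack h (isMeasurableFun.Build _ _ _ _ h mf).
apply/esym/(@lebesgue_measure_unique R (pushforward leb hm)) => //.
move=> _ [[a b]] _ <-; rewrite /pushforward /=.
transitivity (leb `]a - c, b - c]%classic); last first.
  congr (leb _); rewrite /h.
  by apply/seteqP; split => y /=; rewrite !in_itv /= => /andP[h1 h2];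
     apply/andP; split; lra.
rewrite [in LHS]lebesgue_measure_itv [in RHS]lebesgue_measure_itv /= !lte_fin ltrD2r.
by case: ifP => // _; rewrite -!EFinB; congr EFin; lra.
Qed.

Lemma lebesgue_scale_pos (k : R) (A : set (measurableTypeR R)) : 0 < k ->
  measurable A -> leb A = (k%:E * leb ((fun y => (k * y)%R) @^-1` A))%E.
Proof.
move=> k0 mA.
have mf : measurable_fun [set: measurableTypeR R] (fun y : R => k * y).
  by apply: measurable_funM; [exact: measurable_cst|exact: measurable_id].
pose kn := NngNum (ltW k0).
pose h : measurableTypeR R -> measurableTypeR R := fun y : R => k * y.
pose hm : {mfun measurableTypeR R >-> measurableTypeR R} :=
  HB.pack h (isMeasurableFun.Build _ _ _ _ h mf).
apply: (@lebesgue_measure_unique R (mscale kn (pushforward leb hm))) => //.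
move=> _ [[a b]] _ <-; rewrite /mscale /pushforward /=.
transitivity (k%:E * leb `](a / k)%R, (b / k)%R]%classic)%E; last first.
  congr (_ * leb _)%E; rewrite /h.
  by apply/seteqP; split => y /=; rewrite !in_itv /= ltr_pdivrMr// ler_pdivlMr// ![y * k]mulrC.
rewrite [in LHS]lebesgue_measure_itv [in RHS]lebesgue_measure_itv /= !lte_fin ltr_pM2r ?invr_gt0//.
case: ifP => // _; last by rewrite mule0.
by rewrite -!EFinB -EFinM; congr EFin; field; rewrite gt_eqF.
Qed.

Lemma lebesgue_scale (k : R) (A : set (measurableTypeR R)) : k != 0 ->
  measurable A -> leb ((fun y => k * y) @^-1` A) = (`|k|^-1%:E * leb A)%E.
Proof.
move=> k0 mA; have [k1|k1|k1] := ltgtP k 0.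
- have nk : 0 < - k by lra.
  have mB : measurable ((-%R : R -> measurableTypeR R) @^-1` A).
    by have := (@oppr_measurable R setT) measurableT A mA; rewrite setTI; exact.
  rewrite -(lebesgue_measureN mA) /pushforward (lebesgue_scale_pos nk mB).
  rewrite muleA -EFinM ltr0_norm// mulVf ?gt_eqF// mul1e; congr (leb _).
  by apply/seteqP; split => y /=; rewrite mulNr opprK.
- by rewrite (lebesgue_scale_pos k1 mA) muleA -EFinM gtr0_norm// mulVf// mul1e.
- by rewrite k1 eqxx in k0.
Qed.

(** The factor refers to preimages, so for a linear map it is the inverse of the absolute value of
    the determinant. *)
Definition scales_by (c : R) (h : R * R -> R * R) : Prop :=
  [/\ 0 < c, measurable_fun [set: plane] (h : plane -> plane) &
   forall E : set plane, measurable E -> mu (h @^-1` E) = (c%:E * mu E)%E].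

Lemma scales_preimage c h (E : set plane) : scales_by c h -> measurable E ->
  measurable (h @^-1` E : set plane).
Proof. by move=> [_ mh _] mE; have := mh measurableT _ mE; rewrite setTI. Qed.

Lemma scales_comp c1 c2 h1 h2 : scales_by c1 h1 -> scales_by c2 h2 ->
  scales_by (c1 * c2) (h2 \o h1).
Proof.
move=> s1 s2; have [c1p m1 e1] := s1; have [c2p m2 e2] := s2; split.
- exact: mulr_gt0.
- exact: (measurableT_comp m2 m1).
- move=> E mE; rewrite comp_preimage e1 ?e2 ?muleA ?EFinM//.
  exact: scales_preimage s2 mE.
Qed.

Lemma scales_inv c h k : scales_by c h -> measurable_fun [set: plane] (k : plane -> plane) ->
  cancel h k -> cancel k h -> scales_by c^-1 k.
Proof.
move=> [c0 mh e] mk hk kh; split => //; first by rewrite invr_gt0.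
move=> E mE.
have mkE : measurable (k @^-1` E : set plane) by have := mk measurableT _ mE; rewrite setTI.
have := e _ mkE; rewrite (_ : h @^-1` _ = E); last first.
  by apply/seteqP; split => x /=; rewrite hk.
by move=> ->; rewrite muleA -EFinM mulVf ?mul1e// gt_eqF.
Qed.

Lemma measurable_pair f g : pmeas f -> pmeas g ->
  measurable_fun [set: plane] ((fun x => (f x, g x)) : plane -> plane).
Proof. by move=> mf mg; apply: measurable_fun_pair. Qed.

(** On each vertical line the map is a translation, so Fubini reduces the claim to dimension one.
    The profile [psi] need not be linear: the flow that bends at the bisection line is such a shear
    with a piecewise affine profile. *)
Lemma scales_shear (psi : R -> R) : measurable_fun [set: measurableTypeR R] psi ->
  scales_by 1 (fun x => (x.1, x.2 + psi x.1)).
Proof.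
move=> mpsi.
have mh : measurable_fun [set: plane] ((fun x => (x.1, x.2 + psi x.1)) : plane -> plane).
  apply: measurable_pair; first exact: pmeas_fst.
  apply: pmeasD; first exact: pmeas_snd.
  by apply: (pmeas_comp mpsi); exact: pmeas_fst.
split=> // E mE; rewrite mul1e /plane_measure /product_measure1 /=.
apply: eq_integral => x _ /=.
rewrite -(lebesgue_translate (psi x) (measurable_xsection x mE)).
by congr (leb _); apply/seteqP; split => y /=; rewrite /xsection /= !inE.
Qed.

Lemma scales_stretch (k : R) : k != 0 -> scales_by `|k|^-1 (fun x => (x.1, k * x.2)).
Proof.
move=> k0.
have mh : measurable_fun [set: plane] ((fun x => (x.1, k * x.2)) : plane -> plane).
  apply: measurable_pair; first exact: pmeas_fst.
  by apply: pmeasM; [exact: pmeas_cst|exact: pmeas_snd].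
split=> //; first by rewrite invr_gt0 normr_gt0.
move=> E mE; rewrite /plane_measure /product_measure1 /=.
rewrite -ge0_integralZl//; last first.
- exact: measurable_fun_xsection.
apply: eq_integral => x _ /=.
rewrite -(lebesgue_scale k0 (measurable_xsection x mE)).
by congr (leb _); apply/seteqP; split => y /=; rewrite /xsection /= !inE.
Qed.

Lemma scales_swap : scales_by 1 (fun x => (x.2, x.1)).
Proof.
have mh : measurable_fun [set: plane] ((fun x => (x.2, x.1)) : plane -> plane).
  by apply: measurable_pair; [exact: pmeas_snd|exact: pmeas_fst].
split=> // E mE; rewrite mul1e; apply/esym.
apply: (@product_measure_unique _ _ _ _ R leb leb (pushforward mu (fun x => (x.2, x.1)))) => //.
move=> A B mA mB; transitivity (mu (B `*` A)).
  by congr (mu _); apply/seteqP; split => x /= [].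
by rewrite [LHS](@product_measure1E _ _ _ _ R)//= muleC.
Qed.

Lemma scales_ext c h k : h =1 k -> scales_by c h -> scales_by c k.
Proof. by move=> hk; rewrite (funext hk). Qed.

Lemma scales_shear1 (k : R) : scales_by 1 (fun x => (x.1 + k * x.2, x.2)).
Proof.
have mk : measurable_fun [set: measurableTypeR R] (fun y : R => k * y).
  by apply: measurable_funM; [exact: measurable_cst|exact: measurable_id].
have := scales_comp (scales_comp scales_swap (scales_shear mk)) scales_swap.
by rewrite !mul1r; apply: scales_ext => x.
Qed.

Lemma scales_translate (v : R * R) : scales_by 1 (fun x => (x.1 + v.1, x.2 + v.2)).
Proof.
have sh (c : R) := @scales_shear (fun=> c) (@measurable_cst _ _ _ _ _ _).
have := scales_comp (scales_comp (scales_comp scales_swap (sh v.1)) scales_swap) (sh v.2).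
by rewrite !mul1r; apply: scales_ext => x.
Qed.

(** Gaussian elimination: with a nonzero pivot [a] the map is a product of shears, stretches and
    swaps, and a zero pivot is removed by swapping the coordinates. The factor stays unspecified
    because the map is only used to conjugate another one, where the factor cancels. *)
Lemma scales_linear (a b c d : R) : a * d - b * c != 0 ->
  exists k, scales_by k (fun x => (a * x.1 + b * x.2, c * x.1 + d * x.2)).
Proof.
have lin_a0 (a' b' c' d' : R) : a' != 0 -> a' * d' - b' * c' != 0 ->
    exists k, scales_by k (fun x => (a' * x.1 + b' * x.2, c' * x.1 + d' * x.2)).
  move=> a0 D0.
  have mk : measurable_fun [set: measurableTypeR R] (fun y : R => c' / a' * y).
    by apply: measurable_funM; [exact: measurable_cst|exact: measurable_id].
  have d0 : d' - b' * c' / a' != 0.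
    apply: contraNneq D0 => h; rewrite (_ : _ - _ = a' * (d' - b' * c' / a')).
      by rewrite h mulr0.
    by field.
  eexists.
  have := scales_comp (scales_comp (scales_comp (scales_comp (scales_comp
    (scales_shear1 (b' / a')) scales_swap) (scales_stretch a0)) scales_swap)
    (scales_stretch d0)) (scales_shear mk).
  apply: scales_ext => x /=.
  by congr (_, _); field.
move=> D0; have [a0|/lin_a0 h] := eqVneq a 0; last exact: h D0.
have b0 : b != 0 by apply: contraNneq D0 => ->; rewrite a0 !mul0r subrr.
have [|k sk] := lin_a0 b a d c b0.
  by rewrite -opprB oppr_eq0.
exists (1 * k); have := scales_comp scales_swap sk.
by apply: scales_ext => x /=; rewrite addrC [X in (_, X)]addrC.
Qed.

Lemma scales_affine (m a b : R * R) : a.1 * b.2 - b.1 * a.2 != 0 ->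
  exists k, scales_by k
    (fun x => (m.1 + x.1 * a.1 + x.2 * b.1, m.2 + x.1 * a.2 + x.2 * b.2)).
Proof.
move=> /scales_linear[k sk]; exists (k * 1).
have := scales_comp sk (scales_translate m); apply: scales_ext => x /=.
by congr (_, _); ring.
Qed.

Lemma scales_pint h f : scales_by 1 h -> pintegrable f -> pintegrable (f \o h) ->
  pint (f \o h) = pint f.
Proof.
move=> [_ mh e] fi fhi; have mf := pintegrable_meas fi.
pose hm : {mfun plane >-> plane} :=
  HB.pack (h : plane -> plane) (isMeasurableFun.Build _ _ _ _ (h : plane -> plane) mh).
rewrite /pint /Rintegral; congr fine.
have -> : (\int[mu]_x ((f \o h) x)%:E = \int[pushforward mu hm]_x (f x)%:E)%E.
  by rewrite (@integral_pushforward _ _ _ _ R _ mh mu setT)//; exact/measurable_EFinP.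
by apply: eq_measure_integral => A mA _; rewrite -[RHS]mul1e; exact: e.
Qed.

End Invariance.

(** * Continuously differentiable functions and differentiation of integrals along flows *)

Section ContinuouslyDifferentiable.
Context {R : realType}.
Implicit Types (f g phi : R * R -> R) (x v : R * R).
Local Notation plane := (measurableTypeR R * measurableTypeR R)%type.

Lemma open_plane_measurable (U : set (R * R)) : open U -> measurable (U : set plane).
Proof.
move=> oU.
pose bx (q : rat * rat * rat * rat) : set plane :=
  [set x | [&& ratr q.1.1.1 < x.1, x.1 < ratr q.1.1.2, ratr q.1.2 < x.2 &
     x.2 < ratr q.2]].
have -> : (U : set plane) = \bigcup_(q in [set q | bx q `<=` U]) bx q.
  apply/seteqP; split => [x Ux|x [q /= + xq]]; last exact.
  have /nbhs_ballP[e /= e0 eU] := oU x Ux.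
  have /rat_in_itvoo[a] : x.1 - e < x.1 by lra.
  have /rat_in_itvoo[b] : x.1 < x.1 + e by lra.
  have /rat_in_itvoo[c] : x.2 - e < x.2 by lra.
  have /rat_in_itvoo[d] : x.2 < x.2 + e by lra.
  rewrite !in_itv /= => /andP[d1 d2] /andP[c1 c2] /andP[b1 b2] /andP[a1 a2].
  exists (a, b, c, d); last by rewrite /bx /= a2 b1 c2 d1.
  move=> y /and4P[h1 h2 h3 h4]; apply: eU.
  split; rewrite -ball_normE /= ltr_norml; apply/andP; split; simpl in *; lra.
have cT : countable [set: rat * rat * rat * rat] by exact: countableP.
rewrite bigcup_mkcond; apply: (countable_bigcupT_measurable cT) => q.
by case: ifPn => _; [exact: pmeas_box|exact: measurable0].
Qed.

Lemma continuous_pmeas f : continuous f -> pmeas f.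
Proof.
move=> cf; apply: (measurability _ (RGenOInfty.measurableE R)).
move=> /= _ [_ [a ->]] <-; rewrite setTI; apply: open_plane_measurable.
by move/continuousP : cf; apply; exact: interval_open.
Qed.

Lemma continuous_locbounded f : continuous f -> locbounded f.
Proof.
move=> cf B.
have cB : compact (box B : set (R * R)).
  by apply: compact_setX; exact: segment_compact.
have cfB : compact (f @` (box B : set (R * R))).
  by apply: continuous_compact => //; exact: continuous_subspaceT.
have [M [_ MfB]] := compact_bounded cfB.
exists (M + 1) => x xB; apply: (MfB (M + 1)); first by rewrite ltrDl.
by exists x.
Qed.

(** The gradient is carried along as a pair of explicit functions, so that product and chain rules
    become algebraic identities checked by [ring]. *)
Definition C1 phi (p1 p2 : R * R -> R) : Prop :=
  [/\ continuous phi, continuous p1, continuous p2 &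
      forall x v, is_derive x v phi (v.1 * p1 x + v.2 * p2 x)].

Lemma C1_meas phi p1 p2 : C1 phi p1 p2 -> [/\ pmeas phi, pmeas p1 & pmeas p2].
Proof. by move=> [? ? ? _]; split; exact: continuous_pmeas. Qed.

Lemma C1_locb phi p1 p2 : C1 phi p1 p2 ->
  [/\ locbounded phi, locbounded p1 & locbounded p2].
Proof. by move=> [? ? ? _]; split; exact: continuous_locbounded. Qed.

Lemma is_derive_line phi x v h d : is_derive (x + h *: v) v phi d ->
  is_derive h 1 (fun k : R => phi (x + k *: v)) d.
Proof.
move=> [ex dv].
have E : (fun k : R => k^-1 *: (phi (x + (k *: 1 + h) *: v) - phi (x + h *: v))) =
  (fun k : R => k^-1 *: (phi (k *: v + (x + h *: v)) - phi (x + h *: v))).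
  apply/funext => k; congr (_ *: (phi _ - _)).
  by rewrite scalerDl [k *: 1]mulr1 addrCA.
by split; [rewrite /derivable E|rewrite /derive E].
Qed.

Lemma C1_lipschitz phi p1 p2 B : C1 phi p1 p2 -> exists2 L, 0 <= L &
  forall x y, box B x -> box B y ->
    `|phi y - phi x| <= L * (`|y.1 - x.1| + `|y.2 - x.2|).
Proof.
move=> C; have [_ b1 b2] := C1_locb C; have [cf _ _ df] := C.
have [L1 H1] := b1 B; have [L2 H2] := b2 B.
exists (`|L1| + `|L2|); first by rewrite addr_ge0.
move=> x y xB yB; pose v := y - x.
have dg (h : R) : is_derive h 1 (fun k : R => phi (x + k *: v))
    (v.1 * p1 (x + h *: v) + v.2 * p2 (x + h *: v)).
  by apply: is_derive_line; exact: df.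
have [|c] := @MVT R _ _ 0 1 ltr01 (fun h _ => dg h).
  apply: continuous_subspaceT => h.
  have [+ _] := dg h; by move/derivable1_diffP/differentiable_continuous.
rewrite in_itv /= => /andP[c0 c1].
rewrite scale1r scale0r addr0 subr0 mulr1 {1}/v (addrC x) subrK => ->.
have cB : box B (x + c *: v).
  move: xB yB => /boxP[x1 x2] /boxP[y1 y2]; apply/boxP; rewrite /v /=.
  move: x1 x2 y1 y2; rewrite !ler_norml => /andP[? ?] /andP[? ?] /andP[? ?] /andP[? ?].
  by rewrite /GRing.scale /=; split; apply/andP; split; nra.
rewrite (le_trans (ler_normD _ _))// !normrM.
have h1 := H1 _ cB; have h2 := H2 _ cB.
have l1 := ler_norm L1; have l2 := ler_norm L2.
have n1 := normr_ge0 L1; have n2 := normr_ge0 L2.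
have m1 := normr_ge0 (y.1 - x.1); have m2 := normr_ge0 (y.2 - x.2).
have k1 := normr_ge0 (p1 (x + c *: v)); have k2 := normr_ge0 (p2 (x + c *: v)).
rewrite /v /= in h1 h2 k1 k2 *.
set a1 := `|p1 _| in h1 k1 *; set a2 := `|p2 _| in h2 k2 *.
nra.
Qed.

Lemma C1_quotient phi p1 p2 x v : C1 phi p1 p2 ->
  n.+1%:R * (phi (x + n.+1%:R^-1 *: v) - phi x) @[n --> \oo]
    --> v.1 * p1 x + v.2 * p2 x.
Proof.
move=> [_ _ _ /(_ x v)[ex <-]].
have : (fun h : R => h^-1 *: (phi (h *: v + x) - phi x)) @ 0^' --> 'D_v phi x by [].
move=> H; have K : n.+1%:R^-1 @[n --> \oo] --> (0 : R)^'.
  move=> A nA; have := @cvg_harmonic R _ nA.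
  move=> h; have {}h : \forall n \near \oo, (@harmonic R n != 0 -> A (harmonic n)) by exact: h.
  by apply: filterS h => n; apply; rewrite /harmonic /= invr_neq0.
have := cvg_comp _ _ K H; apply: cvg_trans; apply: near_eq_cvg.
by apply: nearW => n /=; rewrite invrK [x + _]addrC.
Qed.

Lemma C1_cst c : C1 (fun=> c) (fun=> 0) (fun=> 0).
Proof.
split; try by move=> x; exact: cst_continuous.
by move=> x v; rewrite !mulr0 addr0; exact: is_derive_cst.
Qed.

Lemma C1D f f1 f2 g g1 g2 : C1 f f1 f2 -> C1 g g1 g2 ->
  C1 (fun x => f x + g x) (fun x => f1 x + g1 x) (fun x => f2 x + g2 x).
Proof.
move=> [cf cf1 cf2 df] [cg cg1 cg2 dg]; split.
- by move=> x; apply: continuousD; [exact: cf|exact: cg].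
- by move=> x; apply: continuousD; [exact: cf1|exact: cg1].
- by move=> x; apply: continuousD; [exact: cf2|exact: cg2].
- move=> x v; apply: (is_derive_eq (is_deriveD (df x v) (dg x v))); ring.
Qed.

Lemma C1M f f1 f2 g g1 g2 : C1 f f1 f2 -> C1 g g1 g2 ->
  C1 (fun x => f x * g x) (fun x => f1 x * g x + f x * g1 x)
     (fun x => f2 x * g x + f x * g2 x).
Proof.
have cM (a b : R * R -> R) : continuous a -> continuous b ->
    continuous (fun x => a x * b x).
  by move=> ca cb x; apply: continuousM; [exact: ca|exact: cb].
have cD (a b : R * R -> R) : continuous a -> continuous b ->
    continuous (fun x => a x + b x).
  by move=> ca cb x; apply: continuousD; [exact: ca|exact: cb].
move=> [cf cf1 cf2 df] [cg cg1 cg2 dg]; split.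
- exact: cM.
- by apply: cD; apply: cM.
- by apply: cD; apply: cM.
- move=> x v; apply: (is_derive_eq (is_deriveM (df x v) (dg x v))).
  by rewrite /GRing.scale /=; ring.
Qed.

Lemma C1_fst : C1 fst (fun=> 1) (fun=> 0).
Proof.
split; try by move=> x; exact: cst_continuous.
  by move=> x; exact: cvg_fst.
move=> x v; rewrite mulr1 mulr0 addr0.
have E : (fun h : R => h^-1 *: ((h *: v + x).1 - x.1)) @ 0^' --> v.1.
  apply: cvg_near_cst; near=> h; rewrite /= addrK scalerA mulVf ?scale1r//.
  by near: h; exact: nbhs_dnbhs_neq.
by split; [apply/cvg_ex; exists v.1|exact/cvg_lim].
Unshelve. all: by end_near. Qed.

Lemma C1_snd : C1 snd (fun=> 0) (fun=> 1).
Proof.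
split; try by move=> x; exact: cst_continuous.
  by move=> x; exact: cvg_snd.
move=> x v; rewrite mulr1 mulr0 add0r.
have E : (fun h : R => h^-1 *: ((h *: v + x).2 - x.2)) @ 0^' --> v.2.
  apply: cvg_near_cst; near=> h; rewrite /= addrK scalerA mulVf ?scale1r//.
  by near: h; exact: nbhs_dnbhs_neq.
by split; [apply/cvg_ex; exists v.2|exact/cvg_lim].
Unshelve. all: by end_near. Qed.

Lemma C1_ext f f1 f2 g g1 g2 : f =1 g -> f1 =1 g1 -> f2 =1 g2 ->
  C1 f f1 f2 -> C1 g g1 g2.
Proof. by move=> /funext -> /funext -> /funext ->. Qed.

Lemma C1Z c f f1 f2 : C1 f f1 f2 ->
  C1 (fun x => c * f x) (fun x => c * f1 x) (fun x => c * f2 x).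
Proof.
move=> Cf; have := C1M (C1_cst c) Cf.
by apply: C1_ext => x; rewrite // mul0r add0r.
Qed.

Lemma C1B f f1 f2 g g1 g2 : C1 f f1 f2 -> C1 g g1 g2 ->
  C1 (fun x => f x - g x) (fun x => f1 x - g1 x) (fun x => f2 x - g2 x).
Proof.
move=> Cf Cg; have := C1D Cf (C1Z (-1) Cg).
by apply: C1_ext => x; rewrite mulN1r.
Qed.

Lemma harmonic_le1 (n : nat) : n.+1%:R^-1 <= 1 :> R.
Proof. by rewrite invf_le1 ?ltr0n// ler1n. Qed.

Lemma normr_shift (a b B M : R) : `|b| <= B -> `|a - b| <= M -> `|a| <= B + M.
Proof.
move=> hb hab; rewrite -[a](subrK b) addrC (le_trans (ler_normD _ _))//; exact: lerD.
Qed.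

(** The integral of [g * phi] is invariant under [Psi n], so the difference quotients [F n] have
    integral zero, and they converge boundedly to the stated integrand. The function [g] has to be
    Lipschitz only along the flow: it may jump across a line which the flow preserves. This is how
    truncated fields are treated without boundary terms. *)
Lemma flow_pint (Psi : nat -> R * R -> R * R) (g dg w1 w2 : R * R -> R) (M : R)
    phi p1 p2 :
  (forall n, scales_by 1 (Psi n)) ->
  (forall n x, `|(Psi n x).1 - x.1| <= M * n.+1%:R^-1 /\
               `|(Psi n x).2 - x.2| <= M * n.+1%:R^-1) ->
  nice g -> pmeas dg -> pmeas w1 -> pmeas w2 ->
  (forall n x, `|g (Psi n x) - g x| <= M * n.+1%:R^-1) ->
  pae (fun x => n.+1%:R * (g (Psi n x) - g x) @[n --> \oo] --> dg x) ->
  pae (fun x => \forall n \near \oo, Psi n x = x + n.+1%:R^-1 *: (w1 x, w2 x)) ->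
  C1 phi p1 p2 ->
  pint (fun x => dg x * phi x + g x * (w1 x * p1 x + w2 x * p2 x)) = 0.
Proof.
move=> sP dP [B nB] mdg mw1 mw2 gL gd Pw C.
have [mphi mp1 mp2] := C1_meas C; have [bphi _ _] := C1_locb C.
have M0 : 0 <= M.
  have [+ _] := dP 0%N (0, 0); rewrite invr1 mulr1; exact: le_trans.
have B0 : 0 <= B by case: nB => _ /(_ (0,0)) [+ _]; exact: le_trans.
(* Points move by at most [M]. Hence only points of [box (B + M)] can be carried into the support of
   [g], and their images remain in [box (B + M + M)], where bounds for [phi] are needed. *)
have [L L0 HL] := C1_lipschitz (B + M + M) C.
have [K HK] := bphi (B + M + M).
have K0 : 0 <= K.
  by apply: le_trans (HK (0, 0) _) => //; apply/boxP; rewrite normr0; split; lra.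
pose F n x : R := n.+1%:R * (g (Psi n x) * phi (Psi n x) - g x * phi x).
have mg : pmeas g by case: nB.
have mcomp (f : R * R -> R) n : pmeas f -> pmeas (f \o Psi n).
  by move=> mf; have [_ mP _] := sP n; exact: (measurableT_comp mf mP).
have ng : nice g by exists B.
have ngphi : nice (fun x => g x * phi x) by exact: niceM.
have n1 n : 0 < n.+1%:R^-1 :> R by rewrite invr_gt0 ltr0n.
have dPM n x : `|(Psi n x).1 - x.1| <= M /\ `|(Psi n x).2 - x.2| <= M.
  have MM : M * n.+1%:R^-1 <= M by rewrite ler_piMr// harmonic_le1.
  by have [d1 d2] := dP n x; split; exact: le_trans MM.
have suppP n x : g (Psi n x) != 0 -> box (B + M) x.
  move=> gP; have [_ /(_ (Psi n x))[_ /(_ gP)[h1 h2]]] := nB.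
  have [d1 d2] := dPM n x.
  by apply/boxP; split; [apply: (normr_shift h1)|apply: (normr_shift h2)]; rewrite distrC.
have suppg x : g x != 0 -> box (B + M) x.
  move=> gx; have [_ /(_ x)[_ /(_ gx)[h1 h2]]] := nB.
  by apply/boxP; split; lra.
have boxP2 n x : box (B + M) x -> box (B + M + M) (Psi n x).
  move=> /boxP[h1 h2]; have [d1 d2] := dPM n x.
  by apply/boxP; split; [exact: (normr_shift h1)|exact: (normr_shift h2)].
have boxM x : box (B + M) x -> box (B + M + M) x.
  by move=> /boxP[h1 h2]; apply/boxP; split; lra.
(* The two summands bound the two terms of the product rule for differences: [g] times the quotient
   of [phi], and [phi] times the quotient of [g]. *)
pose D := B * (L * (M + M)) + K * M.
have D0 : 0 <= D by rewrite /D addr_ge0// ?mulr_ge0// addr_ge0.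
have nF n : nice_by (Num.max D (B + M)) (F n).
  split.
    apply: pmeasM; first exact: measurable_cst.
    apply: pmeasB; last exact: pmeasM.
    by apply: (mcomp (fun x => g x * phi x)); exact: pmeasM.
  move=> x; have [xB|xB] := pselect (box (B + M) x); last first.
    have g0 : g x = 0 by apply/eqP; apply: contra_notT xB => /suppg.
    have gP0 : g (Psi n x) = 0 by apply/eqP; apply: contra_notT xB => /suppP.
    by rewrite /F g0 gP0 !mul0r subr0 mulr0 normr0 eqxx le_max D0.
  split; last first.
    by move: xB => /boxP[h1 h2] _; rewrite !le_max h1 h2 !orbT.
  rewrite le_max; apply/orP; left.
  have -> : F n x = n.+1%:R * (g (Psi n x) * (phi (Psi n x) - phi x) +
      phi x * (g (Psi n x) - g x)) by rewrite /F; ring.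
  have hL := HL _ _ (boxM _ xB) (boxP2 n _ xB).
  have hK := HK _ (boxM _ xB).
  have [d1 d2] := dP n x; have hg := gL n x.
  have [_ /(_ (Psi n x))[hB _]] := nB.
  rewrite normrM ger0_norm// mulrC -ler_pdivlMr ?ltr0n//.
  rewrite (le_trans (ler_normD _ _))// !normrM /D mulrDl; apply: lerD.
    rewrite -!mulrA; apply: ler_pM => //; apply: (le_trans hL).
    by rewrite ler_wpM2l// mulrDl lerD.
  by rewrite -mulrA ler_pM.
have Fc : pae (fun x => F n x @[n --> \oo] -->
    dg x * phi x + g x * (w1 x * p1 x + w2 x * p2 x)).
  apply: paeS (paeI gd Pw) => x [gdx Pwx].
  have -> : F^~ x = (fun n => g (Psi n x) * (n.+1%:R * (phi (Psi n x) - phi x)) +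
      phi x * (n.+1%:R * (g (Psi n x) - g x))).
    by apply/funext => n; rewrite /F; ring.
  rewrite addrC; apply: cvgD; last by rewrite mulrC; apply: cvgMr.
  apply: cvgM; last first.
    have := @C1_quotient _ _ _ x (w1 x, w2 x) C; apply: cvg_trans; apply: near_eq_cvg.
    by near=> n; congr (_ * (phi _ - _)); apply/esym; near: n.
  apply/subr_cvg0.
  have H : M * n.+1%:R^-1 @[n --> \oo] --> (0 : R).
    by rewrite -(mulr0 M); apply: cvgMr; exact: cvg_harmonic.
  apply: norm_cvg0; apply: (squeeze_cvgr _ (cvg_cst 0) H).
  by apply: nearW => n; rewrite normr_ge0 gL.
have mD : pmeas (fun x => dg x * phi x + g x * (w1 x * p1 x + w2 x * p2 x)).
  by apply: pmeasD; apply: pmeasM => //; apply: pmeasD; exact: pmeasM.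
have IF n : pint (F n) = 0.
  have nP : pintegrable ((fun x => g x * phi x) \o Psi n).
    apply: nice_pintegrable; exists (Num.max (B * K) (B + M)); split.
      by apply: mcomp; exact: pmeasM.
    move=> x /=; have [g0|gP0] := eqVneq (g (Psi n x)) 0.
      by rewrite g0 mul0r normr0 eqxx le_max mulr_ge0.
    have xB := suppP _ _ gP0; split; last first.
      by move: xB => /boxP[h1 h2] _; rewrite !le_max h1 h2 !orbT.
    rewrite normrM le_max ler_pM//; first by have [_ /(_ (Psi n x))[]] := nB.
    by apply: HK; exact: boxP2.
  rewrite /F pintZ; last by apply: pintegrableB => //; exact: nice_pintegrable.
  rewrite pintB//; last exact: nice_pintegrable.
  have -> : pint (fun x => g (Psi n x) * phi (Psi n x)) = pint (fun x => g x * phi x).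
    by apply: (scales_pint (f := fun x => g x * phi x) (sP n)) => //; exact: nice_pintegrable.
  by rewrite subrr mulr0.
have := bounded_convergence nF mD Fc.
rewrite (_ : (fun n => pint (F n)) = cst 0); last exact/funext.
by move=> h; rewrite -(cvg_lim _ h)// lim_cst.
Unshelve. all: by end_near. Qed.

End ContinuouslyDifferentiable.

(** * Affine functions and weak divergences of truncated fields *)

Section AffineForms.
Context {R : realType}.
Implicit Types (f g phi l p q r : R * R -> R) (x v : R * R).
Local Notation mu := (@plane_measure R).
Local Notation plane := (measurableTypeR R * measurableTypeR R)%type.
Local Notation leb := (@lebesgue_measure R).

Definition affine l (c1 c2 : R) : Prop :=
  forall x v, l (x + v) = l x + (c1 * v.1 + c2 * v.2).

Lemma affine_C1 l c1 c2 : affine l c1 c2 -> C1 l (fun=> c1) (fun=> c2).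
Proof.
move=> al; have := C1D (C1_cst (l 0)) (C1D (C1Z c1 C1_fst) (C1Z c2 C1_snd)).
by apply: C1_ext => x; rewrite ?mulr1 ?mulr0 ?addr0 ?add0r// -al add0r.
Qed.

Lemma affine_pmeas l c1 c2 : affine l c1 c2 -> pmeas l.
Proof. by move=> /affine_C1 /C1_meas []. Qed.

Lemma affine_locb l c1 c2 : affine l c1 c2 -> locbounded l.
Proof. by move=> /affine_C1 /C1_locb []. Qed.

Lemma pmeas_bool (b : R * R -> bool) : measurable ([set x | b x] : set plane) ->
  pmeas (fun x => (b x)%:R).
Proof.
move=> mb; rewrite (_ : (fun _ => _) = \1_([set x | b x])); first exact: pmeas_indic.
by apply/funext => x; rewrite indicE; case: (boolP (b x)) => bx;
  [rewrite mem_set|rewrite memNset//; exact/negP].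
Qed.

Lemma pmeas_ltb f g : pmeas f -> pmeas g -> pmeas (fun x => (f x < g x)%R%:R).
Proof. by move=> mf mg; apply: pmeas_bool; exact: pmeas_lt. Qed.

Lemma pmeas_andb (b c : R * R -> bool) : pmeas (fun x => (b x)%:R : R) ->
  pmeas (fun x => (c x)%:R : R) -> pmeas (fun x => (b x && c x)%:R : R).
Proof.
move=> mb mc; have := pmeasM mb mc; congr pmeas; apply/funext => x.
by case: (b x); case: (c x); rewrite /= ?mulr0 ?mulr1 ?mul0r.
Qed.

Lemma nice_bool (b : R * R -> bool) B : pmeas (fun x => (b x)%:R : R) ->
  (forall x, b x -> box B x) -> nice (fun x => (b x)%:R : R).
Proof.
move=> mb bB; exists (Num.max 1 B); split=> // x; split.
  by rewrite le_max; apply/orP; left; case: (b x); rewrite ?normr1 ?normr0.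
by case: (boolP (b x)) => [/bB/boxP[h1 h2] _|_]; rewrite ?eqxx// !le_max h1 h2 !orbT.
Qed.

(** If [c2] is nonzero, every vertical section of the zero set is a single point and Fubini applies;
    otherwise the coordinates are swapped. *)
Lemma affine_ker_null l c1 c2 : affine l c1 c2 -> (c1, c2) != (0, 0) ->
  pae (fun x => l x != 0).
Proof.
have pairE (a b : R) : (a, b) = (a, 0) + (0, b) :> R * R.
  by rewrite [RHS]surjective_pairing /= addr0 add0r.
have H l' d1 d2 : affine l' d1 d2 -> d2 != 0 -> mu ([set x | l' x == 0] : set plane) = 0%E.
  move=> al d0; rewrite /plane_measure /product_measure1 /=.
  rewrite -[RHS](@integral0 _ _ _ leb setT); apply: eq_integral => x _ /=.
  rewrite (_ : xsection _ x = [set - l' (x, 0) / d2]) ?lebesgue_measure_set1//.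
  apply/seteqP; split => y; rewrite /xsection /= ?inE /=.
    by rewrite (pairE x y) al /= mulr0 add0r addrC addr_eq0 => /eqP <-; rewrite mulrC mulKf.
  by move=> ->; rewrite (pairE x) al /= mulr0 add0r mulrCA mulfV// mulr1 subrr.
move=> al c0.
have ml : measurable ([set x | l x == 0] : set plane).
  rewrite (_ : [set x | _] = ~` ([set x | l x < 0] `|` [set x | 0 < l x])).
    by apply: measurableC; apply: measurableU; apply: pmeas_lt => //;
      try exact: pmeas_cst; exact: affine_pmeas al.
  apply/seteqP; split => x /=; first by move/eqP => ->; rewrite ltxx => -[].
  by move/not_orP => [/negP + /negP]; rewrite -!leNgt => h1 h2; rewrite eq_le h1 h2.
suff m0 : mu ([set x | l x == 0] : set plane) = 0%E.
  by exists [set x | l x == 0]; split=> // x /= /negP; rewrite negbK.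
have [c20|c20] := eqVneq c2 0; last exact: H al c20.
have c10 : c1 != 0 by apply: contraNneq c0 => ->; rewrite c20.
have [_ _ e] := @scales_swap R.
rewrite -[LHS]mul1e -(e _ ml).
apply: (H (fun x => l (x.2, x.1)) c2 c1) => // x v /=.
have -> : (x.2 + v.2, x.1 + v.1) = (x.2, x.1) + (v.2, v.1) :> R * R by [].
by rewrite al /= [X in _ + X]addrC.
Qed.

Definition weakdiv (t : R * R -> R * R) (d : R * R -> R) : Prop :=
  [/\ nice (fun x => (t x).1), nice (fun x => (t x).2), nice d &
   forall phi p1 p2, C1 phi p1 p2 ->
     pint (fun x => (t x).1 * p1 x + (t x).2 * p2 x + d x * phi x) = 0].

Lemma weakdivD t d t' d' : weakdiv t d -> weakdiv t' d' ->
  weakdiv (fun x => t x + t' x) (fun x => d x + d' x).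
Proof.
move=> [n1 n2 n3 w] [n1' n2' n3' w']; split; try exact: niceD.
move=> phi p1 p2 C; have [mphi mp1 mp2] := C1_meas C; have [bphi bp1 bp2] := C1_locb C.
have := pintD (nice_pintegrable (niceD (niceD (niceM n1 mp1 bp1) (niceM n2 mp2 bp2))
   (niceM n3 mphi bphi)))
  (nice_pintegrable (niceD (niceD (niceM n1' mp1 bp1) (niceM n2' mp2 bp2))
   (niceM n3' mphi bphi))).
rewrite w// w'// addr0 => E; rewrite -[RHS]E; apply: eq_pint => x /=; ring.
Qed.

Lemma weakdivZ a t d : weakdiv t d ->
  weakdiv (fun x => a *: t x) (fun x => a * d x).
Proof.
move=> [n1 n2 n3 w]; split; try exact: niceZ.
move=> phi p1 p2 C; have [mphi mp1 mp2] := C1_meas C; have [bphi bp1 bp2] := C1_locb C.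
have := pintZ a (nice_pintegrable (niceD (niceD (niceM n1 mp1 bp1) (niceM n2 mp2 bp2))
   (niceM n3 mphi bphi))).
rewrite w// mulr0 => E; rewrite -[RHS]E; apply: eq_pint => x /=.
by rewrite /GRing.scale /=; ring.
Qed.

Lemma weakdiv0 : weakdiv (fun=> 0) (fun=> 0).
Proof.
split; try exact: nice0.
by move=> phi p1 p2 _; rewrite -[RHS](@pint0 R); apply: eq_pint => x; rewrite !mul0r !addr0.
Qed.

Lemma weakdiv_sum (I : Type) (s : seq I) t d : (forall i, weakdiv (t i) (d i)) ->
  weakdiv (fun x => \sum_(i <- s) t i x) (fun x => \sum_(i <- s) d i x).
Proof.
move=> w; elim: s => [|i s IH].
  under eq_fun do rewrite big_nil; under [X in weakdiv _ X]eq_fun do rewrite big_nil.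
  exact: weakdiv0.
under eq_fun do rewrite big_cons; under [X in weakdiv _ X]eq_fun do rewrite big_cons.
exact: weakdivD.
Qed.

Lemma weakdiv_ext t d t' d' : t =1 t' -> d =1 d' -> weakdiv t d -> weakdiv t' d'.
Proof. by move=> /funext -> /funext ->. Qed.

Lemma pint_weakdiv t d : weakdiv t d -> pint d = 0.
Proof.
move=> [_ _ _ /(_ _ _ _ (C1_cst 1)) <-]; apply: eq_pint => x.
by rewrite !mulr0 !add0r mulr1.
Qed.

(** The shift leaves [p + q] unchanged, so whenever both factors of a product are positive they are
    smaller than 1; otherwise the product vanishes. *)
Lemma bubble_lipschitz (p q h : R) : p + q <= 1 -> 0 <= h -> h <= 1 ->
  `|Num.max (p + h) 0 * Num.max (q - h) 0 - Num.max p 0 * Num.max q 0| <= 4 * h.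
Proof.
move=> pq h0 h1.
have [a|a] := lerP (p + h) 0; have [b|b] := lerP (q - h) 0;
have [c|c] := lerP p 0; have [d|d] := lerP q 0;
 rewrite ?mulr0 ?mul0r ?subr0 ler_norml; apply/andP; split; nra.
Qed.

Lemma near_inv_lt (c : R) : 0 < c -> \forall n \near \oo, n.+1%:R^-1 < c.
Proof.
by move=> c0; have := near_infty_natSinv_lt (PosNum c0).
Qed.

Lemma cvg_near_const (u : nat -> R) (l : R) :
  (\forall n \near \oo, u n = l) -> u n @[n --> \oo] --> l.
Proof. by move=> h; apply: cvg_near_cst; exact: h. Qed.

(** Here [p], [q], [r] play the role of barycentric coordinates and [e] is directed along the edge
    [r = 0]. The weight [p q] removes the flux through the edges [p = 0] and [q = 0], and [e] is
    tangent to the third one. The divergence is the derivative of [p q w] along [e]. *)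
Lemma edge_bubble p q r cp1 cp2 cq1 cq2 cr1 cr2 (e : R * R) B w w1 w2 :
  affine p cp1 cp2 -> affine q cq1 cq2 -> affine r cr1 cr2 ->
  cp1 * e.1 + cp2 * e.2 = 1 -> cq1 * e.1 + cq2 * e.2 = -1 ->
  cr1 * e.1 + cr2 * e.2 = 0 -> (cr1, cr2) != (0, 0) ->
  (forall x, p x + q x + r x = 1) ->
  (forall x, [&& 0 < p x, 0 < q x & 0 < r x] -> box B x) ->
  C1 w w1 w2 ->
  weakdiv (fun x => ([&& 0 < p x, 0 < q x & 0 < r x]%:R * (p x * q x * w x)) *: e)
    (fun x => [&& 0 < p x, 0 < q x & 0 < r x]%:R *
       ((q x - p x) * w x + p x * q x * (e.1 * w1 x + e.2 * w2 x))).
Proof.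
move=> ap aq ar ep eq er cr sum1 bB Cw.
have mp := affine_pmeas ap; have mq := affine_pmeas aq; have mr := affine_pmeas ar.
have bp := affine_locb ap; have bq := affine_locb aq; have br := affine_locb ar.
pose b x := [&& 0 < p x, 0 < q x & 0 < r x].
have mb : pmeas (fun x => (b x)%:R : R).
  by do 2?[apply: pmeas_andb]; apply: pmeas_ltb => //; exact: pmeas_cst.
have nb : nice (fun x => (b x)%:R : R) by exact: nice_bool mb bB.
(* With positive parts the truncation is Lipschitz in the direction [e]. The remaining jump at
   [r = 0] is harmless since [r] is constant in this direction. *)
pose g x : R := Num.max (p x) 0 * Num.max (q x) 0 * (0 < r x)%R%:R.
have gE x : g x = (b x)%:R * (p x * q x).
  rewrite /g /b; have [a|a] := lerP (p x) 0; have [a'|a'] := lerP (q x) 0;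
  by rewrite ?mul0r ?mulr0 ?mul0r//=; rewrite mulrC.
have [mw mw1 mw2] := C1_meas Cw; have [bw bw1 bw2] := C1_locb Cw.
have ng : nice g.
  rewrite (_ : g = (fun x => (b x)%:R * p x * q x)).
    by apply: niceM => //; exact: niceM.
  by apply/funext => x; rewrite gE mulrA.
have ngw : nice (fun x => g x * w x) by exact: niceM.
have ndg : nice (fun x => (b x)%:R * (q x - p x)).
  rewrite (_ : (fun _ => _) = (fun x => (b x)%:R * q x - (b x)%:R * p x)).
    by apply: niceB; exact: niceM.
  by apply/funext => x; rewrite mulrBr.
have ndgw : nice (fun x => (b x)%:R * (q x - p x) * w x) by exact: niceM.
split.
- by have := niceZ e.1 ngw; congr nice; apply/funext => x; rewrite gE /b /= /GRing.scale /=; ring.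
- by have := niceZ e.2 ngw; congr nice; apply/funext => x; rewrite gE /b /= /GRing.scale /=; ring.
- have := niceD ndgw (niceD (niceZ e.1 (niceM ng mw1 bw1)) (niceZ e.2 (niceM ng mw2 bw2))).
  by congr nice; apply/funext => x; rewrite gE /b; ring.
move=> phi p1 p2 C.
pose M : R := `|e.1| + `|e.2| + 4.
have e10 := normr_ge0 e.1; have e20 := normr_ge0 e.2.
have tp (x : R * R) h : p (x + h *: e) = p x + h.
  by rewrite ap /= /GRing.scale /= -[in RHS](mulr1 h) -ep; ring.
have tq (x : R * R) h : q (x + h *: e) = q x - h.
  by rewrite aq /= /GRing.scale /= -[in RHS](mulr1 h) -mulrN -eq; ring.
have tr (x : R * R) h : r (x + h *: e) = r x.
  by rewrite ar /= /GRing.scale /= -[RHS]addr0 -[in RHS](mulr0 h) -er; ring.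
have h01 n : 0 <= n.+1%:R^-1 :> R by rewrite invr_ge0 ler0n.
(* The factor [w] is moved into the test function, which becomes [w * phi]; the flow then
   differentiates the product [p q] only. *)
have := @flow_pint R (fun n x => x + n.+1%:R^-1 *: e) g (fun x => (b x)%:R * (q x - p x))
  (fun=> e.1) (fun=> e.2) M _ _ _ _ _ ng (nice_meas ndg) (@pmeas_cst R _) (@pmeas_cst R _)
  _ _ _ (C1M Cw C).
move=> /(_ (fun n => scales_translate (n.+1%:R^-1 *: e))) H.
rewrite -[RHS]H.
- by apply: eq_pint => x; rewrite gE /b /= /GRing.scale /=; ring.
- move=> n x; rewrite /= ![_ + _ - _]addrAC !subrr !add0r /GRing.scale /=.
  by split; rewrite normrM (ger0_norm (h01 n)) mulrC ler_wpM2r// /M; lra.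
- move=> n x; rewrite /g tp tq tr -mulrBl normrM normr_nat.
  have [r0|r0] := ltP 0 (r x); last by rewrite mulr0 mulr_ge0// /M; lra.
  rewrite mulr1 (le_trans (bubble_lipschitz _ _ _))// ?harmonic_le1//.
    by have := sum1 x; lra.
  by rewrite ler_wpM2r// /M; lra.
- have pn : (cp1, cp2) != (0, 0).
    by apply/eqP => -[c1 c2]; move: ep; rewrite c1 c2 !mul0r; lra.
  have qn : (cq1, cq2) != (0, 0).
    by apply/eqP => -[c1 c2]; move: eq; rewrite c1 c2 !mul0r; lra.
  apply: paeS (paeI (affine_ker_null ap pn) (paeI (affine_ker_null aq qn)
    (affine_ker_null ar cr))) => x [p0 [q0 r0]].
  rewrite /g /b.
  have E n : p (x + n.+1%:R^-1 *: e) = p x + n.+1%:R^-1 by [].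
  have [rp|rp] := ltP 0 (r x); last first.
    by apply: cvg_near_const; apply: nearW => n; rewrite tr ltNge rp /= andbF !mulr0 subrr mulr0 andbF mul0r.
  rewrite andbT.
  have [pp|pp] := ltP 0 (p x); last first.
    have pl : 0 < - p x by rewrite oppr_gt0 lt_neqAle p0 pp.
    apply: cvg_near_const; near=> n.
    have hn : n.+1%:R^-1 < - p x by near: n; exact: near_inv_lt.
    rewrite tp tq tr (@max_r _ _ (p x + _)) /= ?(mul0r, mulr0, subrr)//.
    by rewrite -lerBrDl sub0r ltW.
  have [qp|qp] := ltP 0 (q x); last first.
    apply: cvg_near_const; apply: nearW => n.
    rewrite tp tq tr (@max_r _ _ (q x - _)) ?mulr0 ?mul0r ?subrr ?mulr0//.
    by rewrite subr_le0 (le_trans qp).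
  rewrite /= mul1r.
  (* Inside the triangle [(p + h) (q - h) - p q = h (q - p) - h ^ 2], so for small [h] the quotient
     is exactly [(q - p) - h]. *)
  have K : (q x - p x) - n.+1%:R^-1 @[n --> \oo] --> q x - p x - 0.
    by apply: cvgB; [exact: cvg_cst|exact: cvg_harmonic].
  rewrite subr0 in K; apply: cvg_trans K; apply: near_eq_cvg.
  near=> n.
  have hn : n.+1%:R^-1 < q x by near: n; exact: near_inv_lt.
  have hnn := h01 n.
  have : n.+1%:R * n.+1%:R^-1 = 1 :> R by rewrite mulfV.
  rewrite tp tq tr rp; move: hn hnn; set a' := _^-1; set a := n.+1%:R => hn hnn aa.
  rewrite !max_l ?mulr1; [|lra|lra].
  rewrite (_ : _ - a' = (q x - p x) * (a * a') - a' * (a * a')); first by ring.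
  by rewrite aa !mulr1.
- by apply: paeW => x; apply: nearW => n; rewrite -surjective_pairing.
Unshelve. all: by end_near. Qed.

Lemma pmeas_norm f : pmeas f -> pmeas (fun x => `|f x|).
Proof. by move=> mf; exact: (pmeas_comp (@normr_measurable R setT)). Qed.

Lemma cvg_scaled_step (u : nat -> R) (l : R) :
  (\forall n \near \oo, u n = l * n.+1%:R^-1) ->
  n.+1%:R * u n @[n --> \oo] --> l.
Proof.
move=> ul; apply: cvg_near_const; near=> n.
have -> : u n = l * n.+1%:R^-1 by near: n.
by rewrite mulrCA mulfV ?mulr1.
Unshelve. all: by end_near. Qed.

Lemma maxr0_lipschitz (s t h : R) : `|s - t| <= h -> `|Num.max s 0 - Num.max t 0| <= h.
Proof.
rewrite !ler_norml => /andP[h1 h2].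
by have [k1|k1] := lerP s 0; have [k2|k2] := lerP t 0; apply/andP; split; lra.
Qed.

Lemma maxr0_step_pos (c k h : R) : `|k| <= h -> h < c -> Num.max (c + k) 0 - Num.max c 0 = k.
Proof. by rewrite ler_norml => /andP[h1 h2] hc; rewrite !max_l; lra. Qed.

Lemma maxr0_step_neg (c k h : R) : `|k| <= h -> h < - c -> Num.max (c + k) 0 - Num.max c 0 = 0.
Proof. by rewrite ler_norml => /andP[h1 h2] hc; rewrite !max_r; lra. Qed.

(** * The Haar field of one bisection *)

Section Haar.
Variables (y z : R * R -> R) (cy1 cy2 cz1 cz2 B : R) (m a b : R * R).
Hypotheses (ay : affine y cy1 cy2) (az : affine z cz1 cz2).
Hypotheses (ya : cy1 * a.1 + cy2 * a.2 = 1) (yb : cy1 * b.1 + cy2 * b.2 = 0).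
Hypotheses (za : cz1 * a.1 + cz2 * a.2 = 0) (zb : cz1 * b.1 + cz2 * b.2 = 1).
Hypothesis coords : forall x, x = m + y x *: a + z x *: b.
Hypotheses (ym : y m = 0) (zm : z m = 0).
Hypothesis bounded_roof : forall x, (0 < z x) && (`|y x| + z x < 1) -> box B x.

(** The open parent triangle in coordinates centred at the midpoint [m] of the refinement edge:
    [z = 0] is that edge, [|y| + z = 1] is the roof formed by the other two sides, and [y = 0] is
    the bisecting line. *)
Let S x : bool := (0 < z x) && (`|y x| + z x < 1).
Let sgy x : R := (0 < y x)%R%:R - (y x < 0)%R%:R.

Let my : pmeas y. Proof. exact: affine_pmeas ay. Qed.
Let sgy_le1 x : `|sgy x| <= 1.
Proof.
rewrite /sgy; case: (ltrgtP 0 (y x)) => _ /=;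
by rewrite ?subr0 ?sub0r ?normrN ?normr1 ?normr0 ?subrr.
Qed.
Let mz : pmeas z. Proof. exact: affine_pmeas az. Qed.
Let by_ : locbounded y. Proof. exact: affine_locb ay. Qed.
Let bz : locbounded z. Proof. exact: affine_locb az. Qed.

Let ysh (x : R * R) h k : y (x + (h *: a + k *: b)) = y x + h.
Proof.
rewrite ay /= /GRing.scale /=; congr (_ + _).
rewrite -[RHS]mulr1 -ya -[RHS]addr0 -(mulr0 k) -yb; ring.
Qed.

Let zsh (x : R * R) h k : z (x + (h *: a + k *: b)) = z x + k.
Proof.
rewrite az /= /GRing.scale /=; congr (_ + _).
rewrite -[RHS]mulr1 -zb -[RHS]addr0 -(mulr0 h) -za; ring.
Qed.

Let mS : pmeas (fun x => (S x)%:R : R).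
Proof.
apply: pmeas_andb; apply: pmeas_ltb => //; try exact: pmeas_cst.
by apply: pmeasD => //; exact: pmeas_norm.
Qed.

Let nS : nice (fun x => (S x)%:R : R).
Proof. exact: nice_bool mS bounded_roof. Qed.

Let msgy : pmeas sgy.
Proof. by apply: pmeasB; apply: pmeas_ltb => //; exact: pmeas_cst. Qed.

Let bsgy : locbounded sgy.
Proof. by move=> C; exists 1 => x _; exact: sgy_le1. Qed.

Let bny : locbounded (fun x => `|y x|).
Proof. by move=> C; have [D hD] := by_ C; exists D => x /hD; rewrite normr_id. Qed.

Let c_yn0 : (cy1, cy2) != (0, 0).
Proof. by apply/eqP => -[c1 c2]; move: ya; rewrite c1 c2 !mul0r; lra. Qed.
Let c_zn0 : (cz1, cz2) != (0, 0).
Proof. by apply/eqP => -[c1 c2]; move: zb; rewrite c1 c2 !mul0r; lra. Qed.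

Let off_lines : pae (fun x => [/\ y x != 0, z x != 0, z x + y x != 1 & z x - y x != 1]).
Proof.
have a1 : affine (fun x => z x + y x - 1) (cz1 + cy1) (cz2 + cy2).
  by move=> x v; rewrite ay az; ring.
have a2 : affine (fun x => z x - y x - 1) (cz1 - cy1) (cz2 - cy2).
  by move=> x v; rewrite ay az; ring.
have n1 : (cz1 + cy1, cz2 + cy2) != (0, 0).
  by apply/eqP => -[c1 c2]; have : (cz1 + cy1) * b.1 + (cz2 + cy2) * b.2 = 1
    by [rewrite !mulrDl addrACA zb yb addr0]; rewrite c1 c2; lra.
have n2 : (cz1 - cy1, cz2 - cy2) != (0, 0).
  by apply/eqP => -[c1 c2]; have : (cz1 - cy1) * b.1 + (cz2 - cy2) * b.2 = 1
    by [rewrite !mulrBl addrACA zb -opprD yb subr0]; rewrite c1 c2; lra.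
apply: paeS (paeI (paeI (affine_ker_null ay c_yn0) (affine_ker_null az c_zn0))
  (paeI (affine_ker_null a1 n1) (affine_ker_null a2 n2))) => x [[h1 h2] [h3 h4]].
by split=> //; rewrite -subr_eq0.
Qed.

Let h01 n : 0 <= n.+1%:R^-1 :> R. Proof. by rewrite invr_ge0 ler0n. Qed.

Let near_sg x : y x != 0 -> \forall n \near \oo,
  `|y x| - `|y x - n.+1%:R^-1| = sgy x * n.+1%:R^-1.
Proof.
move=> y0; near=> n.
have hn : n.+1%:R^-1 < `|y x| by near: n; apply: near_inv_lt; rewrite normr_gt0.
have h0 := h01 n; rewrite /sgy; move: hn h0; set h := n.+1%:R^-1; case: (ltrgtP 0 (y x)) => /= yx.
- by rewrite gtr0_norm// => hn h0; rewrite ger0_norm ?subr0 ?mul1r; lra.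
- by rewrite ltr0_norm// => hn h0; rewrite ler0_norm ?sub0r ?mulN1r; lra.
- by move: (y0); rewrite -yx eqxx.
Unshelve. all: by end_near. Qed.

Let tri x (h : R) : 0 <= h -> `|(`|y x| - `|y x - h|)| <= h.
Proof.
move=> h0; have := ler_dist_dist (y x) (y x - h).
by rewrite opprB addrCA subrr addr0 (ger0_norm h0).
Qed.

Let M : R := `|a.1| + `|a.2| + `|b.1| + `|b.2| + 1.

(** Translation along the base. The weight vanishes on the roof, which the translation crosses, and
    jumps only at the base line, which it preserves. *)
Lemma roof_translation : weakdiv
  (fun x => ((S x)%:R * (1 - `|y x| - z x)) *: - a) (fun x => (S x)%:R * sgy x).
Proof.
pose g x : R := (0 < z x)%R%:R * Num.max (1 - `|y x| - z x) 0.
have gE x : g x = (S x)%:R * (1 - `|y x| - z x).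
  rewrite /g /S; case: (0 < z x) => /=; last by rewrite !mul0r.
  by rewrite mul1r; case: (ltP (`|y x| + z x) 1) => h;
    [rewrite max_l ?mul1r//|rewrite max_r ?mul0r//]; lra.
have ng : nice g.
  have := niceB (niceB nS (niceM nS (pmeas_norm my) bny)) (niceM nS mz bz).
  by congr nice; apply/funext => x; rewrite gE; ring.
split.
- by have := niceZ (- a.1) ng; congr nice; apply/funext => x; rewrite gE /= /GRing.scale /=; ring.
- by have := niceZ (- a.2) ng; congr nice; apply/funext => x; rewrite gE /= /GRing.scale /=; ring.
- exact: niceM.
move=> phi p1 p2 C.
have := @flow_pint R (fun n x => x + n.+1%:R^-1 *: - a) g (fun x => (S x)%:R * sgy x)
  (fun=> - a.1) (fun=> - a.2) M _ _ _ _ _ ng (pmeasM mS msgy) (@pmeas_cst R _) (@pmeas_cst R _)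
  _ _ _ C.
move=> /(_ (fun n => scales_translate (n.+1%:R^-1 *: - a))) H.
have sh (x : R * R) h : x + h *: - a = x + (- h *: a + 0 *: b).
  by rewrite scale0r addr0 scalerN scaleNr.
have a10 := normr_ge0 a.1; have a20 := normr_ge0 a.2.
have b10 := normr_ge0 b.1; have b20 := normr_ge0 b.2.
rewrite -[RHS]H.
- by apply: eq_pint => x; rewrite gE /= /GRing.scale /=; ring.
- move=> n x; rewrite /= ![_ + _ - _]addrAC !subrr !add0r /GRing.scale /=.
  by split; rewrite normrM normrN (ger0_norm (h01 n)) mulrC ler_wpM2r// /M; lra.
- move=> n x; rewrite /g sh ysh zsh addr0 -mulrBr normrM normr_nat.
  case: (0 < z x); last by rewrite mul0r mulr_ge0// /M; lra.
  rewrite mul1r; set h := n.+1%:R^-1; have h0 : 0 <= h by exact: h01.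
  have hM : h <= M * h by rewrite -{1}(mul1r h) ler_wpM2r// /M; lra.
  apply: le_trans hM; apply: maxr0_lipschitz.
  have -> : 1 - `|y x - h| - z x - (1 - `|y x| - z x) = `|y x| - `|y x - h| by ring.
  exact: tri.
- apply: paeS off_lines => x [y0 z0 zy1 zy2]; apply: cvg_scaled_step.
  have ns := near_sg y0.
  rewrite /g /S; have [zp|zp] := ltP 0 (z x); last first.
    by apply: nearW => n; rewrite sh zsh addr0 ltNge zp /= !mul0r subrr.
  have E n : 1 - `|y x - n.+1%:R^-1| - z x =
      (1 - `|y x| - z x) + (`|y x| - `|y x - n.+1%:R^-1|) by ring.
  have [lt1|ge1] := ltP (`|y x| + z x) 1.
    near=> n; rewrite sh ysh zsh addr0 zp !mul1r E (@maxr0_step_pos _ _ n.+1%:R^-1).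
    - by near: n.
    - exact: tri.
    - by near: n; apply: near_inv_lt; rewrite -addrA -opprD subr_gt0.
  have gt1 : 1 < `|y x| + z x.
    rewrite lt_neqAle ge1 andbT eq_sym.
    by have [yx|yx] := lerP 0 (y x); [rewrite (ger0_norm yx) addrC|rewrite (ltr0_norm yx) addrC].
  near=> n; rewrite sh ysh zsh addr0 zp !mul1r E (@maxr0_step_neg _ _ n.+1%:R^-1).
  - by rewrite andbF !mul0r.
  - exact: tri.
  - by near: n; apply: near_inv_lt; rewrite oppr_gt0 -addrA -opprD subr_lt0.
- by apply: paeW => x; apply: nearW => n.
Unshelve. all: by end_near. Qed.

(** The flow that moves [y] at unit speed and keeps [|y| + z] constant, so that its paths are
    parallel to the sides of the roof and bend at the bisecting line. In the coordinates [(y, z)] it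
    is a vertical shear followed by a horizontal translation, hence it preserves the measure. *)
Let bent (n : nat) (x : R * R) : R * R :=
  x + (- n.+1%:R^-1 *: a + (`|y x| - `|y x - n.+1%:R^-1|) *: b).

Let det_ab : a.1 * b.2 - b.1 * a.2 != 0.
Proof.
have : (cy1 * cz2 - cy2 * cz1) * (a.1 * b.2 - b.1 * a.2) = 1.
  have -> : (cy1 * cz2 - cy2 * cz1) * (a.1 * b.2 - b.1 * a.2) =
    (cy1 * a.1 + cy2 * a.2) * (cz1 * b.1 + cz2 * b.2) -
    (cy1 * b.1 + cy2 * b.2) * (cz1 * a.1 + cz2 * a.2) by ring.
  by rewrite ya zb yb mul0r mul1r subr0.
by move=> E; apply/eqP => D; move: E; rewrite D mulr0; lra.
Qed.

Let bent_scales n : scales_by 1 (bent n).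
Proof.
have [k sk] := scales_affine m det_ab.
pose A (x : R * R) : R * R := (m.1 + x.1 * a.1 + x.2 * b.1, m.2 + x.1 * a.2 + x.2 * b.2).
pose A' x : R * R := (y x, z x).
have AE x : A x = m + (x.1 *: a + x.2 *: b).
  by rewrite [RHS]surjective_pairing /A /= /GRing.scale /= !addrA.
have sA : scales_by k A by exact: sk.
have mA' : measurable_fun [set: plane] (A' : plane -> plane) by exact: measurable_pair.
have AA' : cancel A A'.
  by move=> x; rewrite AE /A' ysh zsh ym zm !add0r -surjective_pairing.
have A'A : cancel A' A by move=> x; rewrite AE /A' /= addrA -coords.
have sA' := scales_inv sA mA' AA' A'A.
pose h : R := n.+1%:R^-1.
have mpsi : measurable_fun [set: measurableTypeR R] (fun s : R => `|s| - `|s - h|).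
  apply: measurable_funB; first exact: normr_measurable.
  apply: measurableT_comp; first exact: normr_measurable.
  by apply: measurable_funB; [exact: measurable_id|exact: measurable_cst].
have := scales_comp (scales_comp (scales_comp sA' (scales_shear mpsi))
  (scales_translate (- h, 0))) sA.
have [k0 _ _] := sA.
rewrite !mulr1 mulVf ?gt_eqF//; apply: scales_ext => x /=.
rewrite AE /= /bent addr0 -/h; have := coords x; set u := y x; set v := z x => E.
rewrite [in RHS]E [LHS]surjective_pairing [RHS]surjective_pairing /= /GRing.scale /=.
by congr (_, _); ring.
Qed.

(** The roles are exchanged with respect to the translation: now the roof is preserved by the flow,
    and the weight [z] vanishes on the base. *)
Lemma roof_bent_flow : weakdiv
  (fun x => ((S x)%:R * z x) *: (sgy x *: b - a)) (fun x => (S x)%:R * sgy x).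
Proof.
pose g x : R := (`|y x| + z x < 1)%R%:R * Num.max (z x) 0.
have gE x : g x = (S x)%:R * z x.
  rewrite /g /S; case: (`|y x| + z x < 1); rewrite ?andbT ?andbF ?mul0r// mul1r.
  by case: (ltP 0 (z x)) => h; rewrite ?mul1r ?mul0r.
have ng : nice g by rewrite (funext gE); exact: niceM.
have w1m : pmeas (fun x => sgy x * b.1 - a.1).
  by apply: pmeasB; [apply: pmeasM|]; rewrite //; exact: pmeas_cst.
have w2m : pmeas (fun x => sgy x * b.2 - a.2).
  by apply: pmeasB; [apply: pmeasM|]; rewrite //; exact: pmeas_cst.
have ngs := niceM ng msgy bsgy.
split.
- by have := niceB (niceZ b.1 ngs) (niceZ a.1 ng); congr nice; apply/funext => x;
    rewrite gE /= /GRing.scale /= /GRing.scale /=; ring.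
- by have := niceB (niceZ b.2 ngs) (niceZ a.2 ng); congr nice; apply/funext => x;
    rewrite gE /= /GRing.scale /= /GRing.scale /=; ring.
- exact: niceM.
move=> phi p1 p2 C.
have a10 := normr_ge0 a.1; have a20 := normr_ge0 a.2.
have b10 := normr_ge0 b.1; have b20 := normr_ge0 b.2.
have bnd (c1 c2 : R) n x : `|c1| + `|c2| <= M ->
    `|- n.+1%:R^-1 * c1 + (`|y x| - `|y x - n.+1%:R^-1|) * c2| <= M * n.+1%:R^-1.
  move=> hM; apply: (@le_trans _ _ ((`|c1| + `|c2|) * n.+1%:R^-1)); last exact: ler_wpM2r.
  rewrite (le_trans (ler_normD _ _))// !normrM normrN (ger0_norm (h01 n)) mulrDl.
  by rewrite mulrC lerD2l mulrC ler_wpM2l// tri.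
have := @flow_pint R bent g (fun x => (S x)%:R * sgy x)
  (fun x => sgy x * b.1 - a.1) (fun x => sgy x * b.2 - a.2) M _ _ _ bent_scales
  _ ng (pmeasM mS msgy) w1m w2m _ _ _ C => H.
rewrite -[RHS]H.
- apply: eq_pint => x; rewrite gE /= /GRing.scale /= /GRing.scale /=; ring.
- move=> n x; rewrite /bent /= ![_ + _ - _]addrAC !subrr !add0r /GRing.scale /=.
  by split; apply: bnd; rewrite /M; lra.
- move=> n x; rewrite /g /bent ysh zsh.
  set h := n.+1%:R^-1; have h0 : 0 <= h by exact: h01.
  have -> : `|y x - h| + (z x + (`|y x| - `|y x - h|)) = `|y x| + z x by ring.
  rewrite -mulrBr normrM normr_nat.
  case: (_ < 1); last by rewrite mul0r mulr_ge0// /M; lra.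
  have hM : h <= M * h by rewrite -{1}(mul1r h) ler_wpM2r// /M; lra.
  rewrite mul1r; apply: le_trans hM; apply: maxr0_lipschitz.
  by rewrite addrAC subrr add0r tri.
- apply: paeS off_lines => x [y0 z0 zy1 zy2]; apply: cvg_scaled_step.
  have ns := near_sg y0.
  near=> n.
  have sn : `|y x| - `|y x - n.+1%:R^-1| = sgy x * n.+1%:R^-1 by near: n.
  rewrite -mulrA -sn /g /S /bent ysh zsh.
  have -> : `|y x - n.+1%:R^-1| + (z x + (`|y x| - `|y x - n.+1%:R^-1|)) = `|y x| + z x by ring.
  case: (`|y x| + z x < 1); last by rewrite !mul0r subrr andbF !mul0r.
  have hn : n.+1%:R^-1 < `|z x| by near: n; apply: near_inv_lt; rewrite normr_gt0.
  have trn := tri x (h01 n).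
  rewrite !mul1r andbT; have [zp|zp] := ltrP 0 (z x).
    by rewrite -[X in _ - X](max_l (ltW zp)) (maxr0_step_pos trn) ?mul1r// -(gtr0_norm zp).
  by rewrite -[X in _ - X](max_r zp) (maxr0_step_neg trn) ?mul0r// -(ler0_norm zp).
- apply: paeS off_lines => x [y0 _ _ _].
  apply: filterS (near_sg y0) => n sn; rewrite /bent sn; congr (_ + _).
  by rewrite [RHS]surjective_pairing [LHS]surjective_pairing /= /GRing.scale /=; congr (_, _); ring.
Unshelve. all: by end_near. Qed.

(** For [y > 0] the sum of the two fields is [(y - 1) a + z b], that is [x - (m + a)], and for
    [y < 0] it is [(m - a) - x]: both are radial fields centred at the end points of the base. *)
Lemma haar_weakdiv : weakdiv
  (fun x => (S x)%:R *: ((z x * sgy x) *: b - (1 - `|y x|) *: a))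
  (fun x => (S x)%:R * (2 * sgy x)).
Proof.
have := weakdivD roof_translation roof_bent_flow; apply: weakdiv_ext => x; last by ring.
rewrite [LHS]surjective_pairing [RHS]surjective_pairing /= /GRing.scale /= /GRing.scale /=.
by congr (_, _); ring.
Qed.

End Haar.

End AffineForms.

(** * Appell's operator on polynomials *)

Section BivariatePolynomials.
Context {R : realType}.
Implicit Types (f g h u v w l r : R * R -> R).

Definition mono (i j : nat) : R * R -> R := fun x => x.1 ^+ i * x.2 ^+ j.

Lemma Poly2_mono k i j : (i + j <= k)%N -> Poly2 k (mono i j).
Proof.
move=> ijk; exists (fun a b => ((a == i) && (b == j))%:R) => x.
have ik : (i < k.+1)%N by rewrite ltnS (leq_trans _ ijk) ?leq_addr.
have jk : (j < k.+1)%N by rewrite ltnS (leq_trans _ ijk) ?leq_addl.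
rewrite (bigD1 (Ordinal ik))//= [X in _ + X]big1 ?addr0; last first.
  move=> a ai; rewrite big1// => b _.
  have -> : (a == i :> nat) = false by apply/negbTE; rewrite -val_eqE in ai.
  by rewrite /= !mul0r.
rewrite (bigD1 (Ordinal jk))//= [X in _ + X]big1 ?addr0; last first.
  move=> b /andP[_ bj]; have -> : (b == j :> nat) = false.
    by apply/negbTE; rewrite -val_eqE in bj.
  by rewrite andbF !mul0r.
by rewrite !eqxx mul1r.
Qed.

Lemma Poly2D k f g : Poly2 k f -> Poly2 k g -> Poly2 k (fun x => f x + g x).
Proof.
move=> [c cf] [d dg]; exists (fun i j => c i j + d i j) => x.
rewrite cf dg -big_split; apply: eq_bigr => i _; rewrite -big_split.
by apply: eq_bigr => j _; rewrite !mulrDl.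
Qed.

Lemma Poly2Z k a f : Poly2 k f -> Poly2 k (fun x => a * f x).
Proof.
move=> [c cf]; exists (fun i j => a * c i j) => x.
rewrite cf big_distrr; apply: eq_bigr => i _; rewrite big_distrr.
by apply: eq_bigr => j _; rewrite /= !mulrA.
Qed.

Lemma Poly2_span k (P : (R * R -> R) -> Prop) :
  (forall i j, (i + j <= k)%N -> P (mono i j)) ->
  (forall f g, P f -> P g -> P (fun x => f x + g x)) ->
  (forall a f, P f -> P (fun x => a * f x)) ->
  forall f, Poly2 k f -> P f.
Proof.
move=> Pm PD PZ f [c /funext ->].
have P0 : P (fun=> 0).
  have := PZ 0 _ (Pm 0%N 0%N (leq0n k)).
  by under eq_fun do rewrite mul0r.
have PS (I : Type) (s : seq I) (Q : pred I) (F : I -> R * R -> R) :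
    (forall i, Q i -> P (F i)) -> P (fun x => \sum_(i <- s | Q i) F i x).
  move=> PF; elim: s => [|i s IH]; first by under eq_fun do rewrite big_nil.
  under eq_fun do rewrite big_cons.
  by case: (boolP (Q i)) => // /PF Pi; exact: PD.
apply: (PS _ _ xpredT (fun (i : 'I_k.+1) x => \sum_(j < k.+1 | (i + j <= k)%N)
  c i j * x.1 ^+ i * x.2 ^+ j)) => i _.
apply: (PS _ _ (fun j : 'I_k.+1 => (i + j <= k)%N)
  (fun j x => c i j * x.1 ^+ i * x.2 ^+ j)) => j ij.
have := PZ (c i j) _ (Pm i j ij); congr P; apply/funext => x.
by rewrite mulrA.
Qed.

Lemma Poly2_ext k f g : f =1 g -> Poly2 k f -> Poly2 k g.
Proof. by move=> /funext ->. Qed.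

Lemma Poly2W k n f : (k <= n)%N -> Poly2 k f -> Poly2 n f.
Proof.
move=> kn; apply: Poly2_span.
- by move=> i j ij; apply: Poly2_mono; exact: leq_trans kn.
- by move=> *; exact: Poly2D.
- by move=> *; exact: Poly2Z.
Qed.

Lemma Poly2_cst k (a : R) : Poly2 k (fun=> a).
Proof.
have := Poly2Z a (@Poly2_mono k 0 0 (leq0n k)); apply: Poly2_ext => x.
by rewrite /mono !expr0 !mulr1.
Qed.

Lemma Poly2B k f g : Poly2 k f -> Poly2 k g -> Poly2 k (fun x => f x - g x).
Proof.
move=> Pf Pg; have := Poly2D Pf (Poly2Z (-1) Pg).
by apply: Poly2_ext => x; rewrite mulN1r.
Qed.

Lemma Poly2_fst : Poly2 1 (fst : R * R -> R).
Proof.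
by have := @Poly2_mono 1 1 0 isT; apply: Poly2_ext => x; rewrite /mono expr0 mulr1 expr1.
Qed.

Lemma Poly2_snd : Poly2 1 (snd : R * R -> R).
Proof.
by have := @Poly2_mono 1 0 1 isT; apply: Poly2_ext => x; rewrite /mono expr0 mul1r expr1.
Qed.

Lemma Poly2M k n f g : Poly2 k f -> Poly2 n g -> Poly2 (k + n) (fun x => f x * g x).
Proof.
move=> Pf Pg; move: f Pf; apply: Poly2_span.
- move=> i j ij; move: g Pg; apply: Poly2_span.
  + move=> a b ab; have ijab : ((i + a) + (j + b) <= k + n)%N by rewrite addnACA leq_add.
    by have := Poly2_mono ijab; apply: Poly2_ext => x; rewrite /mono !exprD; ring.
  + move=> f g Pf Pg; have := Poly2D Pf Pg.
    by apply: Poly2_ext => x; rewrite mulrDr.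
  + by move=> a f Pf; have := Poly2Z a Pf; apply: Poly2_ext => x; rewrite mulrCA.
- move=> f h Pf Ph; have := Poly2D Pf Ph.
  by apply: Poly2_ext => x; rewrite mulrDl.
- by move=> a f Pf; have := Poly2Z a Pf; apply: Poly2_ext => x; rewrite mulrA.
Qed.

Lemma Poly2_comp k f g h : Poly2 1 g -> Poly2 1 h -> Poly2 k f ->
  Poly2 k (fun x => f (g x, h x)).
Proof.
move=> Pg Ph.
have PX (u : R * R -> R) n : Poly2 1 u -> Poly2 n (fun x => u x ^+ n).
  move=> Pu; elim: n => [|n IH].
    by have := @Poly2_cst 0 1; apply: Poly2_ext => x; rewrite expr0.
  by have := Poly2M Pu IH; rewrite add1n; apply: Poly2_ext => x; rewrite exprS.
move: f; apply: Poly2_span.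
- by move=> i j ij; have := Poly2M (PX _ i Pg) (PX _ j Ph); exact: Poly2W.
- by move=> u w Pu Pw; exact: Poly2D.
- by move=> a u Pu; exact: Poly2Z.
Qed.

(* [L v = D1 (s (1 - s - r) D1 v) + D2 (r (1 - s - r) D2 v)
     + (D1 - D2) (s r (D1 - D2) v)], with [v1 = D1 v], [v2 = D2 v], [l = L v]:
   the operator of Appell's polynomials on the simplex, which preserves the total
   degree and acts on the part of top degree [n] as [- n (n + 2)]. *)
Inductive appell (k : nat) : (R * R -> R) -> (R * R -> R) -> (R * R -> R) ->
    (R * R -> R) -> Prop :=
| appell_mono i j : (i + j <= k)%N ->
    appell k (mono i j) (fun x => i%:R * mono i.-1 j x) (fun x => j%:R * mono i j.-1 x)
      (fun x => i%:R ^+ 2 * mono i.-1 j x + j%:R ^+ 2 * mono i j.-1 x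
                - ((i + j) * (i + j + 2))%:R * mono i j x)
| appellD f f1 f2 lf g g1 g2 lg : appell k f f1 f2 lf -> appell k g g1 g2 lg ->
    appell k (fun x => f x + g x) (fun x => f1 x + g1 x) (fun x => f2 x + g2 x)
      (fun x => lf x + lg x)
| appellZ a f f1 f2 lf : appell k f f1 f2 lf ->
    appell k (fun x => a * f x) (fun x => a * f1 x) (fun x => a * f2 x)
      (fun x => a * lf x).

Definition in_appell k v l := exists v1 v2, appell k v v1 v2 l.

Lemma in_appell_ext k v l v' l' : v =1 v' -> l =1 l' -> in_appell k v l -> in_appell k v' l'.
Proof. by move=> /funext -> /funext ->. Qed.

Lemma in_appellD k v l v' l' : in_appell k v l -> in_appell k v' l' ->
  in_appell k (fun x => v x + v' x) (fun x => l x + l' x).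
Proof. by move=> [a [b h]] [a' [b' h']]; do 2 eexists; exact: appellD h h'. Qed.

Lemma in_appellZ k c v l : in_appell k v l ->
  in_appell k (fun x => c * v x) (fun x => c * l x).
Proof. by move=> [a [b h]]; do 2 eexists; exact: appellZ h. Qed.

Lemma in_appell0 k : in_appell k (fun=> 0) (fun=> 0).
Proof.
have [a [b h]] : in_appell k (mono 0 0) (fun x => 0%:R ^+ 2 * mono 0.-1 0 x + 0%:R ^+ 2 * mono 0 0.-1 x
                - ((0 + 0) * (0 + 0 + 2))%:R * mono 0 0 x).
  by do 2 eexists; exact: appell_mono.
have := in_appellZ 0 (ex_intro _ a (ex_intro _ b h)).
by apply: in_appell_ext => x; rewrite mul0r.
Qed.

Lemma appellW k n v v1 v2 l : (k <= n)%N -> appell k v v1 v2 l -> appell n v v1 v2 l.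
Proof.
move=> kn; elim.
- by move=> i j ij; apply: appell_mono; exact: leq_trans kn.
- by move=> *; exact: appellD.
- by move=> *; exact: appellZ.
Qed.

Lemma in_appellW k n v l : (k <= n)%N -> in_appell k v l -> in_appell n v l.
Proof. by move=> kn [a [b h]]; exists a, b; exact: appellW h. Qed.

(** The derivatives are multiplied by their coordinates because the product has degree at most [k]
    even for [k = 0], and because this is the form in which they enter the field on a leaf. *)
Lemma Poly2_appell k v v1 v2 l : appell k v v1 v2 l ->
  [/\ Poly2 k v, Poly2 k l, Poly2 k (fun x => x.1 * v1 x) & Poly2 k (fun x => x.2 * v2 x)].
Proof.
have Pm i j : (i + j <= k)%N -> Poly2 k (fun x => i%:R * mono i.-1 j x).
  case: i => [_|i ij]; last by apply: Poly2Z; apply: Poly2_mono; rewrite (leq_trans _ ij)// leq_add2r.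
  by have := Poly2_cst k 0; apply: Poly2_ext => x; rewrite mul0r.
have Pm' i j : (i + j <= k)%N -> Poly2 k (fun x => j%:R * mono i j.-1 x).
  case: j => [_|j ij]; last by apply: Poly2Z; apply: Poly2_mono; rewrite (leq_trans _ ij)// leq_add2l.
  by have := Poly2_cst k 0; apply: Poly2_ext => x; rewrite mul0r.
elim.
- move=> i j ij; split.
  + exact: Poly2_mono.
  + have := Poly2B (Poly2D (Poly2Z i%:R (Pm _ _ ij)) (Poly2Z j%:R (Pm' _ _ ij)))
      (Poly2Z ((i + j) * (i + j + 2))%:R (Poly2_mono ij)).
    by apply: Poly2_ext => x; rewrite !mulrA -!expr2.
  + have := Poly2Z i%:R (Poly2_mono ij); apply: Poly2_ext => x.
    by rewrite /mono; case: (i) => [|n]; rewrite ?mul0r ?mulr0// exprS; ring.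
  + have := Poly2Z j%:R (Poly2_mono ij); apply: Poly2_ext => x.
    by rewrite /mono; case: (j) => [|n]; rewrite ?mul0r ?mulr0// exprS; ring.
- move=> f f1 f2 lf g g1 g2 lg _ [a1 a2 a3 a4] _ [b1 b2 b3 b4]; split; try exact: Poly2D.
  + by have := Poly2D a3 b3; apply: Poly2_ext => x; rewrite mulrDr.
  + by have := Poly2D a4 b4; apply: Poly2_ext => x; rewrite mulrDr.
- move=> a f f1 f2 lf _ [a1 a2 a3 a4]; split; try exact: Poly2Z.
  + by have := Poly2Z a a3; apply: Poly2_ext => x; rewrite mulrCA.
  + by have := Poly2Z a a4; apply: Poly2_ext => x; rewrite mulrCA.
Qed.

Lemma in_appell_Poly2 k v : Poly2 k v -> exists l, in_appell k v l.
Proof.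
move: v; apply: Poly2_span.
- by move=> i j ij; eexists; do 2 eexists; exact: appell_mono.
- by move=> f g [lf hf] [lg hg]; eexists; exact: in_appellD hf hg.
- by move=> a f [lf hf]; eexists; exact: in_appellZ hf.
Qed.

(* The image of a monomial under [L], with its top degree part split off. *)
Lemma in_appell_top k i j : (i + j = k.+1)%N -> exists2 r, Poly2 k r &
  in_appell k.+1 (mono i j) (fun x => r x - (k.+1 * k.+3)%:R * mono i j x).
Proof.
move=> ij.
have Pm : Poly2 k (fun x => i%:R ^+ 2 * mono i.-1 j x).
  move: ij; case: i => [_|i ij].
    by have := Poly2_cst k 0; apply: Poly2_ext => x; rewrite expr0n mul0r.
  by apply: Poly2Z; apply: Poly2_mono; move: ij; rewrite addSn => -[->].
have Pm' : Poly2 k (fun x => j%:R ^+ 2 * mono i j.-1 x).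
  move: ij; case: j {Pm} => [_|j ij].
    by have := Poly2_cst k 0; apply: Poly2_ext => x; rewrite expr0n mul0r.
  by apply: Poly2Z; apply: Poly2_mono; move: ij; rewrite addnS => -[->].
eexists; first exact: Poly2D Pm Pm'.
have ijk : (i + j <= k.+1)%N by rewrite ij.
do 2 eexists; have := appell_mono ijk; rewrite ij.
by rewrite addn2; exact.
Qed.

(** With respect to the degree, [L] is triangular with diagonal entries [- n (n + 2)]. When [m]
    avoids the values [n (n + 2)], the operator [L + m] is inverted by treating the top degree first
    and correcting the lower order terms by induction. *)
Lemma appell_solve k (m : R) b : (forall n, (n <= k)%N -> m != (n * n.+2)%:R) ->
  Poly2 k b -> exists v l, in_appell k v l /\ forall x, l x + m * v x = b x.
Proof.
elim: k b => [|k IH] b hm Pb.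
  have m0 : m != 0 by have := hm 0%N isT; rewrite mul0n.
  move: b Pb; apply: Poly2_span.
  - move=> i j; rewrite leqn0 addn_eq0 => /andP[/eqP -> /eqP ->].
    do 2 eexists; split.
      by apply: (in_appellZ m^-1); do 2 eexists; exact: (@appell_mono 0 0 0).
    by move=> x; rewrite /= !mul0r expr0n !mul0r addr0 subr0 mulr0 add0r mulVKf.
  - move=> f g [v [l [h e]]] [v' [l' [h' e']]]; do 2 eexists.
    split; first exact: in_appellD h h'.
    by move=> x; rewrite -e -e'; ring.
  - move=> a f [v [l [h e]]]; do 2 eexists; split; first exact: in_appellZ a _ _ h.
    by move=> x; rewrite -e; ring.
move: b Pb; apply: Poly2_span.
- move=> i j; rewrite leq_eqVlt ltnS => /orP[/eqP ij|ij]; last first.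
    have [||v [l [h e]]] := IH (mono i j); [|exact: Poly2_mono|].
      by move=> n nk; apply: hm; exact: leqW.
    by exists v, l; split=> //; exact: in_appellW h.
  have [r Pr hr] := in_appell_top ij.
  have mk := hm k.+1 (leqnn _).
  pose c : R := m - (k.+1 * k.+3)%:R.
  have c0 : c != 0 by rewrite subr_eq0.
  have [||v [l [h e]]] := IH (fun x => - c^-1 * r x); [|exact: Poly2Z|].
    by move=> n nk; apply: hm; exact: leqW.
  do 2 eexists; split.
    by apply: in_appellD (in_appellZ c^-1 hr) (in_appellW (leqnSn k) h).
  move=> x; rewrite /= -[RHS](mulVKf c0).
  have := e x; rewrite /c => E.
  have -> : l x = - (m - (k.+1 * k.+3)%:R)^-1 * r x - m * v x by rewrite -E addrK.
  ring.
- move=> f g [v [l [h e]]] [v' [l' [h' e']]]; do 2 eexists.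
  split; first exact: in_appellD h h'.
  by move=> x; rewrite -e -e'; ring.
- move=> a f [v [l [h e]]]; do 2 eexists; split; first exact: in_appellZ a _ _ h.
  by move=> x; rewrite -e; ring.
Qed.

(** A leading part is completed to an eigenvector by lower order terms. There is no resonance, since
    [n (n + 2)] is strictly increasing in [n]. *)
Lemma appell_eigenvector k b : Poly2 k.+1 b ->
  exists w, in_appell k.+1 w (fun x => - (k.+1 * k.+3)%:R * w x) /\
            Poly2 k (fun x => b x - w x).
Proof.
have nres n : (n <= k)%N -> (k.+1 * k.+3)%:R != (n * n.+2)%:R :> R.
  by move=> nk; rewrite eqr_nat gtn_eqF// ltn_mul.
move: b; apply: Poly2_span.
- move=> i j; rewrite leq_eqVlt ltnS => /orP[/eqP ij|ij]; last first.
    exists (fun=> 0); split.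
      by have := in_appell0 k.+1; apply: in_appell_ext => x; rewrite ?mulr0.
    by have := Poly2_mono ij; apply: Poly2_ext => x; rewrite subr0.
  have [r Pr hr] := in_appell_top ij.
  have [v [l [h e]]] := appell_solve nres (Poly2Z (-1) Pr).
  exists (fun x => mono i j x + v x); split.
    have := in_appellD hr (in_appellW (leqnSn k) h); apply: in_appell_ext => // x.
    have -> : l x = -1 * r x - (k.+1 * k.+3)%:R * v x by rewrite -e addrK.
    ring.
  have [v1 [v2 /Poly2_appell [Pv _ _ _]]] := h.
  have := Poly2Z (-1) Pv; apply: Poly2_ext => x; ring.
- move=> f g [w [h P]] [w' [h' P']]; exists (fun x => w x + w' x); split.
    by have := in_appellD h h'; apply: in_appell_ext => // x; rewrite mulrDr.
  by have := Poly2D P P'; apply: Poly2_ext => x; ring.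
- move=> a f [w [h P]]; exists (fun x => a * w x); split.
    by have := in_appellZ a h; apply: in_appell_ext => // x; rewrite mulrCA.
  by have := Poly2Z a P; apply: Poly2_ext => x; ring.
Qed.

(* An [L]-symmetric form makes the eigenvectors of different degrees orthogonal,
   and the smallest nonzero eigenvalue of [- L] is 3. *)
Lemma appell_invert (ip : (R * R -> R) -> (R * R -> R) -> R) K :
  (forall f g, Poly2 K f -> Poly2 K g -> ip f g = ip g f) ->
  (forall f g h, Poly2 K f -> Poly2 K g -> Poly2 K h ->
     ip (fun x => f x + g x) h = ip f h + ip g h) ->
  (forall a f h, Poly2 K f -> Poly2 K h -> ip (fun x => a * f x) h = a * ip f h) ->
  (forall f, Poly2 K f -> 0 <= ip f f) ->
  (forall v l w m, in_appell K v l -> in_appell K w m -> ip l w = ip v m) ->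
  forall b, Poly2 K b -> exists v c,
    in_appell K v (fun x => b x - c) /\
    - ip v (fun x => b x - c) <= 3^-1 * ip (fun x => b x - c) (fun x => b x - c).
Proof.
move=> ipC ipD ipZ ip0 ipL.
have ipDr f g h : Poly2 K f -> Poly2 K g -> Poly2 K h ->
     ip h (fun x => f x + g x) = ip h f + ip h g.
  by move=> Pf Pg Ph; rewrite ipC ?ipD ?[ip _ h]ipC//; exact: Poly2D.
have ipZr a f h : Poly2 K f -> Poly2 K h -> ip h (fun x => a * f x) = a * ip h f.
  by move=> Pf Ph; rewrite ipC ?ipZ ?[ip _ h]ipC//; exact: Poly2Z.
(* The induction runs over the degree of [b], while the form keeps its fixed domain, the polynomials
   of degree at most [K]. *)
suff main k b : (k <= K)%N -> Poly2 k b -> exists v c,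
    in_appell k v (fun x => b x - c) /\
    - ip v (fun x => b x - c) <= 3^-1 * ip (fun x => b x - c) (fun x => b x - c).
  by move=> b Pb; exact: main.
elim: k b => [|k IH] b kK Pb.
  exists (fun=> 0), (b 0).
  have bc x : b x - b 0 = 0.
    have [c cb] := Pb; apply/eqP; rewrite subr_eq0 !cb; apply/eqP.
    apply: eq_bigr => i _; apply: eq_bigr => j ij.
    move: ij; rewrite leqn0 addn_eq0 => /andP[/eqP -> /eqP ->].
    by rewrite !expr0.
  have E : (fun x => b x - b 0) = (fun=> 0) by apply/funext => x; exact: bc.
  rewrite E; split; first exact: in_appell0.
  have Z : ip (fun=> 0) (fun=> 0) = 0.
    have := ipZ 0 (fun=> 0) (fun=> 0) (Poly2_cst _ _) (Poly2_cst _ _).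
    by rewrite !mul0r.
  by rewrite Z oppr0 mulr0.
have [w [hw Pbw]] := appell_eigenvector Pb.
set kap : R := (k.+1 * k.+3)%:R in hw.
have [||v' [c [hv' le']]] := IH (fun x => b x - w x); [exact: ltnW|exact: Pbw|].
have kap3 : 3 <= kap by rewrite /kap ler_nat (@leq_mul 1 3).
have kap0 : kap != 0 by rewrite gt_eqF//; lra.
have hwK := in_appellW kK hw.
have hvK := in_appellW (ltnW kK) hv'.
have [w1 [w2 /Poly2_appell [PwK _ _ _]]] := hwK.
have [u1 [u2 /Poly2_appell [PvK _ _ _]]] := hvK.
pose b' x := b x - w x - c.
have PbK : Poly2 K b' by exact: Poly2W (ltnW kK) (Poly2B Pbw (Poly2_cst k c)).
have Pk_b' : Poly2 k b' by exact: Poly2B Pbw (Poly2_cst k c).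
have Eb x : b x - c = b' x + w x by rewrite /b'; ring.
rewrite -/b' in le' hv'; clearbody b'.
(* Write [u = L z + kap z] with [z] of degree at most [k], and move [L] from [z] to [w], where it
   acts as multiplication by [- kap]: the two contributions cancel. *)
have orth u : Poly2 k u -> ip w u = 0.
  move=> Pu.
  have [|z [l [h e]]] := @appell_solve k kap u _ Pu.
    by move=> n nk; rewrite /kap eqr_nat gtn_eqF// ltn_mul.
  have hzK := in_appellW (ltnW kK) h.
  have [z1 [z2 /Poly2_appell [PzK PlK _ _]]] := hzK.
  rewrite -(funext e) ipDr//; last exact: Poly2Z.
  rewrite ipZr// -(ipL _ _ _ _ hwK hzK) ipZ// mulNr addNr//.
have Pk_v : Poly2 k v' by have [x1 [x2 /Poly2_appell []]] := hv'.
(* As [L w = - kap w], the polynomial [- w / kap] is a preimage of the eigenvector part. By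
   orthogonality it contributes exactly [ip w w / kap] to the left-hand side of the bound. *)
exists (fun x => v' x + - kap^-1 * w x), c.
have Pkw : Poly2 K (fun x => - kap^-1 * w x) by exact: Poly2Z.
split.
  have := in_appellD (in_appellW (leqnSn k) hv') (in_appellZ (- kap^-1) hw).
  by apply: in_appell_ext => // x; rewrite mulrA mulrNN mulVf// mul1r Eb.
rewrite (funext Eb) ipD//; last exact: Poly2D.
rewrite !ipDr// ?ipD//; last exact: Poly2D.
rewrite !ipZ//.
have -> : ip v' w = 0 by rewrite ipC// orth.
have -> : ip b' w = 0 by rewrite ipC// orth.
rewrite (orth b')//.
have ww := ip0 _ PwK.
have kk : kap^-1 <= 3^-1 by rewrite lef_pV2 ?posrE//; lra.
have : kap^-1 * ip w w <= 3^-1 * ip w w by exact: ler_wpM2r.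
rewrite mulr0 add0r mulNr addr0 add0r; move: le'; set X := kap^-1 * ip w w.
by move: (ip v' b') (ip b' b') (ip w w) X => a1 a2 a3 a4; lra.
Qed.

End BivariatePolynomials.

(** * Triangles *)

Section Triangles.
Context {R : realType}.
Implicit Types (T : triangle R) (x v : R * R).

Definition tdet T : R :=
  (T.1.2.1 - T.1.1.1) * (T.2.2 - T.1.1.2) - (T.2.1 - T.1.1.1) * (T.1.2.2 - T.1.1.2).

(** Barycentric coordinates by Cramer's rule. A quotient by zero is zero, so the affine expansions
    below hold for degenerate triangles too. *)
Definition lam1 T x : R :=
  ((x.1 - T.1.1.1) * (T.2.2 - T.1.1.2) - (T.2.1 - T.1.1.1) * (x.2 - T.1.1.2)) / tdet T.
Definition lam2 T x : R :=
  ((T.1.2.1 - T.1.1.1) * (x.2 - T.1.1.2) - (x.1 - T.1.1.1) * (T.1.2.2 - T.1.1.2)) / tdet T.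
Definition lam0 T x : R := 1 - lam1 T x - lam2 T x.

Definition open_tri T x : bool := [&& 0 < lam0 T x, 0 < lam1 T x & 0 < lam2 T x].

Lemma affine_lam1 T : affine (lam1 T) ((T.2.2 - T.1.1.2) / tdet T)
  (- (T.2.1 - T.1.1.1) / tdet T).
Proof. by move=> x v; rewrite /lam1 /=; ring. Qed.

Lemma affine_lam2 T : affine (lam2 T) (- (T.1.2.2 - T.1.1.2) / tdet T)
  ((T.1.2.1 - T.1.1.1) / tdet T).
Proof. by move=> x v; rewrite /lam2 /=; ring. Qed.

Lemma affine_lam0 T : affine (lam0 T)
  (- ((T.2.2 - T.1.1.2) / tdet T) - (- (T.1.2.2 - T.1.1.2) / tdet T))
  (- (- (T.2.1 - T.1.1.1) / tdet T) - (T.1.2.1 - T.1.1.1) / tdet T).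
Proof. by move=> x v; rewrite /lam0 affine_lam1 affine_lam2; ring. Qed.

Lemma lam_sum T x : lam0 T x + lam1 T x + lam2 T x = 1.
Proof. by rewrite /lam0; ring. Qed.

Section Nondegenerate.
Variable T : triangle R.
Hypothesis ndT : Defs.nondegenerate T.

Let D0 : tdet T != 0. Proof. exact: ndT. Qed.

Lemma bary_coords x : x = lam0 T x *: T.1.1 + lam1 T x *: T.1.2 + lam2 T x *: T.2.
Proof.
rewrite [LHS]surjective_pairing [RHS]surjective_pairing /= /GRing.scale /= /lam0 /lam1 /lam2.
by move: D0; rewrite /tdet => D0'; congr (_, _); field.
Qed.

Lemma lam_bary (a b c : R) : a + b + c = 1 ->
  let x := (a * T.1.1.1 + b * T.1.2.1 + c * T.2.1, a * T.1.1.2 + b * T.1.2.2 + c * T.2.2) in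
  [/\ lam0 T x = a, lam1 T x = b & lam2 T x = c].
Proof.
move=> abc x; have aE : a = 1 - b - c by rewrite -abc; ring.
have h1 : lam1 T x = b by move: D0; rewrite /lam1 /x /= /tdet aE => D0'; field.
have h2 : lam2 T x = c by move: D0; rewrite /lam2 /x /= /tdet aE => D0'; field.
by split=> //; rewrite /lam0 h1 h2 aE.
Qed.

Lemma regionP x : region T x <-> [/\ 0 <= lam0 T x, 0 <= lam1 T x & 0 <= lam2 T x].
Proof.
split=> [[a [b [c [a0 b0 c0 abc ->]]]]|[h0 h1 h2]].
  by have [-> -> ->] := lam_bary abc.
exists (lam0 T x), (lam1 T x), (lam2 T x); split=> //; first exact: lam_sum.
by rewrite {1}(bary_coords x) [LHS]surjective_pairing.
Qed.

Lemma open_tri_region x : open_tri T x -> region T x.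
Proof. by move=> /and3P[h0 h1 h2]; apply/regionP; split; exact: ltW. Qed.

Definition tri_bound : R :=
  `|T.1.1.1| + `|T.1.1.2| + `|T.1.2.1| + `|T.1.2.2| + `|T.2.1| + `|T.2.2|.

Lemma region_box x : region T x -> box tri_bound x.
Proof.
have H (a b c u v w B : R) : 0 <= a -> 0 <= b -> 0 <= c -> a + b + c = 1 ->
    `|u| <= B -> `|v| <= B -> `|w| <= B -> `|a * u + b * v + c * w| <= B.
  move=> a0 b0 c0 abc; rewrite !ler_norml => /andP[? ?] /andP[? ?] /andP[? ?].
  have aE : a = 1 - b - c by lra.
  by rewrite aE in a0 *; apply/andP; split; nra.
move=> [a [b [c [a0 b0 c0 abc ->]]]]; apply/boxP; rewrite /tri_bound.
have n1 := normr_ge0 T.1.1.1; have n2 := normr_ge0 T.1.1.2.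
have n3 := normr_ge0 T.1.2.1; have n4 := normr_ge0 T.1.2.2.
have n5 := normr_ge0 T.2.1; have n6 := normr_ge0 T.2.2.
by split; apply: H => //; lra.
Qed.

Lemma open_tri_box x : open_tri T x -> box tri_bound x.
Proof. by move=> /open_tri_region /region_box. Qed.

Let c1 : ((T.2.2 - T.1.1.2) / tdet T, - (T.2.1 - T.1.1.1) / tdet T) != (0, 0).
Proof.
apply/eqP => -[/eqP a /eqP b]; move: a b.
rewrite !mulf_eq0 invr_eq0 (negbTE D0) !orbF oppr_eq0 => /eqP a /eqP b.
by move/eqP: D0; apply; rewrite /tdet a b; ring.
Qed.

Let c2 : (- (T.1.2.2 - T.1.1.2) / tdet T, (T.1.2.1 - T.1.1.1) / tdet T) != (0, 0).
Proof.
apply/eqP => -[/eqP a /eqP b]; move: a b.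
rewrite !mulf_eq0 invr_eq0 (negbTE D0) !orbF oppr_eq0 => /eqP a /eqP b.
by move/eqP: D0; apply; rewrite /tdet a b; ring.
Qed.

Let c0 : (- ((T.2.2 - T.1.1.2) / tdet T) - (- (T.1.2.2 - T.1.1.2) / tdet T),
  - (- (T.2.1 - T.1.1.1) / tdet T) - (T.1.2.1 - T.1.1.1) / tdet T) != (0, 0).
Proof.
apply/eqP => -[a b]; move/eqP: D0; apply.
have := affine_lam0 T T.1.1 (T.1.2 - T.1.1).
rewrite a b !mul0r addr0 addr0 addrC subrK.
have [+ _ _] := @lam_bary 0 1 0 (etrans (addr0 _) (add0r _)).
rewrite /= !mul0r !mul1r !add0r !addr0 -surjective_pairing => ->.
have [+ _ _] := @lam_bary 1 0 0 (etrans (addr0 _) (addr0 _)).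
rewrite /= !mul0r !mul1r !addr0 -surjective_pairing => ->.
by move=> h; exfalso; lra.
Qed.

Lemma lam_neq0_ae : pae (fun x => [/\ lam0 T x != 0, lam1 T x != 0 & lam2 T x != 0]).
Proof.
apply: paeS (paeI (affine_ker_null (affine_lam0 T) c0) (paeI
  (affine_ker_null (affine_lam1 T) c1) (affine_ker_null (affine_lam2 T) c2))).
by move=> x [h0 [h1 h2]].
Qed.

Lemma region_open_tri_ae : pae (fun x => region T x -> open_tri T x).
Proof.
apply: paeS lam_neq0_ae => x [n0 n1 n2] /regionP[h0 h1 h2].
by rewrite /open_tri !lt_neqAle ![0 == _]eq_sym n0 n1 n2 h0 h1 h2.
Qed.

Lemma lam1_neq_lam2_ae : pae (fun x => lam1 T x != lam2 T x).
Proof.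
pose d1 := (T.2.2 - T.1.1.2) / tdet T - (- (T.1.2.2 - T.1.1.2) / tdet T).
pose d2 := - (T.2.1 - T.1.1.1) / tdet T - (T.1.2.1 - T.1.1.1) / tdet T.
have al : affine (fun x => lam1 T x - lam2 T x) d1 d2.
  by move=> x v; rewrite affine_lam1 affine_lam2 /d1 /d2; ring.
have dn : (d1, d2) != (0, 0).
  apply/eqP => -[a b]; have := al T.1.1 (T.1.2 - T.1.1).
  rewrite a b !mul0r !addr0 [T.1.1 + _]addrC subrK.
  have [_ + +] := @lam_bary 0 1 0 (etrans (addr0 _) (add0r _)).
  rewrite /= !mul0r !mul1r !add0r !addr0 -surjective_pairing => -> ->.
  have [_ + +] := @lam_bary 1 0 0 (etrans (addr0 _) (addr0 _)).
  rewrite /= !mul0r !mul1r !addr0 -surjective_pairing => -> ->; lra.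
by apply: paeS (affine_ker_null al dn) => x; rewrite subr_eq0.
Qed.

Lemma pmeas_open_tri : pmeas (fun x => (open_tri T x)%:R : R).
Proof.
have m0 := affine_pmeas (affine_lam0 T); have m1 := affine_pmeas (affine_lam1 T).
have m2 := affine_pmeas (affine_lam2 T).
by do 2?[apply: pmeas_andb]; apply: pmeas_ltb => //; exact: pmeas_cst.
Qed.

Lemma nice_open_tri : nice (fun x => (open_tri T x)%:R : R).
Proof. exact: nice_bool pmeas_open_tri open_tri_box. Qed.

Lemma interior_region : (region T)° = [set x | open_tri T x].
Proof.
have cl (l : R * R -> R) a b : affine l a b -> continuous l.
  by move=> al; have [] := affine_C1 al.
have ol (l : R * R -> R) a b : affine l a b -> open [set x | 0 < l x].
  move=> /cl cont; rewrite (_ : [set x | _] = l @^-1` `]0, +oo[%classic).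
    by move/continuousP: cont; apply; exact: interval_open.
  by apply/seteqP; split => x /=; rewrite in_itv /= andbT.
apply/seteqP; split; last first.
  rewrite -open_subsetE; first by move=> x /open_tri_region.
  rewrite (_ : [set x | _] = [set x | 0 < lam0 T x] `&` ([set x | 0 < lam1 T x]
     `&` [set x | 0 < lam2 T x])).
    by apply: openI; [exact: ol (affine_lam0 T)|apply: openI;
      [exact: ol (affine_lam1 T)|exact: ol (affine_lam2 T)]].
  by apply/seteqP; split => x /=; rewrite /open_tri; [move=> /and3P[]|move=> [-> [-> ->]]].
move=> x Tx.
(* An interior point can be moved slightly in the direction in which [l] decreases at unit rate
   without leaving the region, so [l x] is at least the length of this step. *)
have pos (l : R * R -> R) a b v : affine l a b -> a * v.1 + b * v.2 = 1 ->
    (forall y, region T y -> 0 <= l y) -> 0 < l x.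
  move=> al av lT.
  have H : x + n.+1%:R^-1 *: (- v) @[n --> \oo] --> x.
    rewrite -[X in _ --> X]addr0; apply: cvgD; first exact: cvg_cst.
    rewrite -[X in _ --> X](scale0r (- v)); apply: cvgZl; exact: cvg_harmonic.
  have [n _ /(_ n (leqnn _))/lT] := H _ Tx.
  rewrite al /= /GRing.scale /= => h.
  have n0 : 0 < n.+1%:R^-1 :> R by rewrite invr_gt0.
  rewrite (lt_le_trans n0)// -subr_ge0 (le_trans h)// le_eqVlt; apply/orP; left; apply/eqP.
  by rewrite -[in RHS](mulr1 n.+1%:R^-1) -av; ring.
have v0 := @lam_bary 1 0 0 (etrans (addr0 _) (addr0 _)).
have v1 := @lam_bary 0 1 0 (etrans (addr0 _) (add0r _)).
have v2 := @lam_bary 0 0 1 (etrans (congr1 (+%R^~ 1) (addr0 0)) (add0r 1)).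
rewrite /= !mul0r !mul1r ?add0r ?addr0 -!surjective_pairing in v0 v1 v2.
have dir (l : R * R -> R) a b (p q : R * R) : affine l a b -> l p = 0 -> l q = 1 ->
    a * (q - p).1 + b * (q - p).2 = 1.
  by move=> al lp lq; have := al p (q - p); rewrite addrC subrK lp lq add0r.
have [a0 a1 a2] := v0; have [b0 b1 b2] := v1; have [d0 d1 d2] := v2.
apply/and3P; split.
- by apply: (pos _ _ _ _ (affine_lam0 T) (dir _ _ _ _ _ (affine_lam0 T) b0 a0)) => y /regionP[].
- by apply: (pos _ _ _ _ (affine_lam1 T) (dir _ _ _ _ _ (affine_lam1 T) a1 b1)) => y /regionP[].
- by apply: (pos _ _ _ _ (affine_lam2 T) (dir _ _ _ _ _ (affine_lam2 T) a2 d2)) => y /regionP[].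
Qed.

Lemma nondegenerate_children : Defs.nondegenerate (child1 T) /\ Defs.nondegenerate (child2 T).
Proof.
have two : (2 : R) != 0 by [].
split; rewrite /Defs.nondegenerate -/(tdet _).
  rewrite (_ : tdet _ = 2^-1 * tdet T); first by rewrite mulf_neq0// invr_neq0.
  by rewrite /tdet /= /midpoint /=; field.
rewrite (_ : tdet _ = - 2^-1 * tdet T); first by rewrite mulf_neq0// oppr_eq0 invr_neq0.
by rewrite /tdet /= /midpoint /=; field.
Qed.

Lemma lam_child1 x : [/\ lam0 (child1 T) x = 2 * lam2 T x,
  lam1 (child1 T) x = lam0 T x & lam2 (child1 T) x = lam1 T x - lam2 T x].
Proof.
have E : tdet (child1 T) = 2^-1 * tdet T by rewrite /tdet /= /midpoint /=; field.
have h1 : lam1 (child1 T) x = lam0 T x.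
  rewrite /lam1 E /lam0 /lam1 /lam2 /=; move: D0; rewrite /tdet /midpoint /= => D0'; by field.
have h2 : lam2 (child1 T) x = lam1 T x - lam2 T x.
  rewrite /lam2 E /lam1 /lam2 /=; move: D0; rewrite /tdet /midpoint /= => D0'; by field.
by split=> //; rewrite {1}/lam0 h1 h2 /lam0; ring.
Qed.

Lemma lam_child2 x : [/\ lam0 (child2 T) x = 2 * lam1 T x,
  lam1 (child2 T) x = lam0 T x & lam2 (child2 T) x = lam2 T x - lam1 T x].
Proof.
have E : tdet (child2 T) = - 2^-1 * tdet T by rewrite /tdet /= /midpoint /=; field.
have h1 : lam1 (child2 T) x = lam0 T x.
  rewrite /lam1 E /lam0 /lam1 /lam2 /=; move: D0; rewrite /tdet /midpoint /= => D0'; by field.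
have h2 : lam2 (child2 T) x = lam2 T x - lam1 T x.
  rewrite /lam2 E /lam1 /lam2 /=; move: D0; rewrite /tdet /midpoint /= => D0'; by field.
by split=> //; rewrite {1}/lam0 h1 h2 /lam0; ring.
Qed.

Lemma open_tri_child1 x : open_tri (child1 T) x = open_tri T x && (lam2 T x < lam1 T x).
Proof.
rewrite /open_tri; have [-> -> ->] := lam_child1 x.
rewrite [0 < lam1 T x - _]subr_gt0 pmulr_rgt0//.
case: (ltP 0 (lam2 T x)) => h2; case: (ltP (lam2 T x) (lam1 T x)) => h3;
  rewrite ?andbF ?andbT//=.
by rewrite (lt_trans h2 h3) andbT.
Qed.

Lemma open_tri_child2 x : open_tri (child2 T) x = open_tri T x && (lam1 T x < lam2 T x).
Proof.
rewrite /open_tri; have [-> -> ->] := lam_child2 x.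
rewrite [0 < lam2 T x - _]subr_gt0 pmulr_rgt0//.
case: (ltP 0 (lam1 T x)) => h2; case: (ltP (lam1 T x) (lam2 T x)) => h3;
  rewrite ?andbF ?andbT//=.
by rewrite (lt_trans h2 h3) andbT.
Qed.

End Nondegenerate.

Definition sqn (v : R * R) : R := v.1 ^+ 2 + v.2 ^+ 2.

(** The weight 1/2 on the refinement edge makes bisection a contraction. With equal weights the sum
    of the squared sides can grow: for sides [b] and nearly [b / 2] at [v0] it passes from about
    [3/2 |b|^2] to about [13/8 |b|^2] on the first child. *)
Definition tsize T : R := 2^-1 * sqn (T.1.2 - T.2) + sqn (T.1.2 - T.1.1) + sqn (T.2 - T.1.1).

Lemma sqn_ge0 v : 0 <= sqn v. Proof. by rewrite addr_ge0// sqr_ge0. Qed.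

Lemma tsize_ge0 T : 0 <= tsize T.
Proof.
have := sqn_ge0 (T.1.2 - T.2); have := sqn_ge0 (T.1.2 - T.1.1); have := sqn_ge0 (T.2 - T.1.1).
by rewrite /tsize; lra.
Qed.

(* With [b] and [c] the sides at [v0], the bound is a quadratic form in [(b, c)]
   with discriminant [(5/6)^2 - 4 (1/4) (3/4) < 0]. *)
Lemma tsize_child1 T : tsize (child1 T) <= 5 / 6 * tsize T.
Proof.
rewrite /tsize /child1 /midpoint /sqn /=.
set b1 := T.1.2.1 - T.1.1.1; set b2 := T.1.2.2 - T.1.1.2.
set c1 := T.2.1 - T.1.1.1; set c2 := T.2.2 - T.1.1.2.
have -> : T.1.1.1 - T.1.2.1 = - b1 by rewrite /b1; ring.
have -> : T.1.1.2 - T.1.2.2 = - b2 by rewrite /b2; ring.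
have -> : T.1.1.1 - (T.1.2.1 + T.2.1) / 2 = - (b1 + c1) / 2 by rewrite /b1 /c1; field.
have -> : T.1.1.2 - (T.1.2.2 + T.2.2) / 2 = - (b2 + c2) / 2 by rewrite /b2 /c2; field.
have -> : T.1.2.1 - (T.1.2.1 + T.2.1) / 2 = (b1 - c1) / 2 by rewrite /b1 /c1; field.
have -> : T.1.2.2 - (T.1.2.2 + T.2.2) / 2 = (b2 - c2) / 2 by rewrite /b2 /c2; field.
have -> : T.1.2.1 - T.2.1 = b1 - c1 by rewrite /b1 /c1; ring.
have -> : T.1.2.2 - T.2.2 = b2 - c2 by rewrite /b2 /c2; ring.
have h1 := sqr_ge0 (5 * c1 - 3 * b1); have h2 := sqr_ge0 (5 * c2 - 3 * b2).
have h3 := sqr_ge0 (5 * b1 - 8 * c1); have h4 := sqr_ge0 (5 * b2 - 8 * c2).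
have h5 := sqr_ge0 (3 * b1 - 5 * c1); have h6 := sqr_ge0 b1; have h7 := sqr_ge0 b2.
have h8 := sqr_ge0 c1; have h9 := sqr_ge0 c2.
nra.
Qed.

Lemma tsize_child2 T : tsize (child2 T) <= 5 / 6 * tsize T.
Proof.
have := tsize_child1 (T.1.1, T.2, T.1.2).
have -> : tsize (child1 (T.1.1, T.2, T.1.2)) = tsize (child2 T).
  by rewrite /tsize /child1 /child2 /midpoint /sqn /= [T.2.1 + _]addrC [T.2.2 + _]addrC.
suff -> : tsize (T.1.1, T.2, T.1.2) = tsize T by [].
by rewrite /tsize /sqn /=; ring.
Qed.

Lemma eucl_sqn v : eucl v ^+ 2 = sqn v.
Proof. by rewrite /eucl sqr_sqrtr// sqn_ge0. Qed.

Lemma vertex_region T : [/\ region T T.1.1, region T T.1.2 & region T T.2].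
Proof.
split.
- by exists 1, 0, 0; split=> //; rewrite ?addr0// !mul1r !mul0r !addr0 -surjective_pairing.
- by exists 0, 1, 0; split=> //; rewrite ?addr0 ?add0r// !mul1r !mul0r !addr0 !add0r -surjective_pairing.
- by exists 0, 0, 1; split=> //; rewrite ?addr0 ?add0r// !mul1r !mul0r !add0r -surjective_pairing.
Qed.

Lemma sqn_diam T x y : region T x -> region T y -> sqn (x - y) <= diam T ^+ 2.
Proof.
move=> Tx Ty; rewrite -eucl_sqn.
have e0 : 0 <= eucl (x - y) by exact: sqrtr_ge0.
suff le : eucl (x - y) <= diam T by rewrite lerXn2r// nnegrE// (le_trans e0).
apply: sup_ubound; last by exists x, y.
exists (Num.sqrt ((2 * tri_bound T) ^+ 2 + (2 * tri_bound T) ^+ 2)).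
move=> _ [a [b [/region_box/boxP[a1 a2] /region_box/boxP[b1 b2] ->]]].
rewrite /eucl ler_sqrt ?addr_ge0 ?sqr_ge0//.
have H (s t M : R) : `|s| <= M -> `|t| <= M -> (s - t) ^+ 2 <= (2 * M) ^+ 2.
  rewrite !ler_norml => /andP[? ?] /andP[? ?]; nra.
by apply: lerD; apply: H.
Qed.

Lemma tsize_diam T : tsize T <= 5 / 2 * diam T ^+ 2.
Proof.
have [r0 r1 r2] := vertex_region T.
have := sqn_diam r1 r2; have := sqn_diam r1 r0; have := sqn_diam r2 r0.
by rewrite /tsize; lra.
Qed.

End Triangles.

(** * The right inverse of the divergence on a leaf *)

Section LeafField.
Context {R : realType}.
Variable T : triangle R.
Hypothesis ndT : Defs.nondegenerate T.
Implicit Types (f g h u v w l m : R * R -> R).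

(** Polynomials live on the reference simplex and are pulled back to [T] by the coordinates
    [(lam1, lam2)], whose gradients are [(a1, b1)] and [(a2, b2)]. *)
Let ev f (x : R * R) : R := f (lam1 T x, lam2 T x).
Let a1 : R := (T.2.2 - T.1.1.2) / tdet T.
Let b1 : R := - (T.2.1 - T.1.1.1) / tdet T.
Let a2 : R := - (T.1.2.2 - T.1.1.2) / tdet T.
Let b2 : R := (T.1.2.1 - T.1.1.1) / tdet T.

Let bary1 x : x.1 = lam0 T x * T.1.1.1 + lam1 T x * T.1.2.1 + lam2 T x * T.2.1.
Proof. by rewrite {1}(bary_coords ndT x). Qed.

Let bary2 x : x.2 = lam0 T x * T.1.1.2 + lam1 T x * T.1.2.2 + lam2 T x * T.2.2.
Proof. by rewrite {1}(bary_coords ndT x). Qed.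

Let lam_v0 : [/\ lam0 T T.1.1 = 1, lam1 T T.1.1 = 0 & lam2 T T.1.1 = 0].
Proof.
have := @lam_bary R T ndT 1 0 0 (etrans (addr0 _) (addr0 _)).
by rewrite /= !mul0r !mul1r !addr0 -!surjective_pairing.
Qed.

Let lam_v1 : [/\ lam0 T T.1.2 = 0, lam1 T T.1.2 = 1 & lam2 T T.1.2 = 0].
Proof.
have := @lam_bary R T ndT 0 1 0 (etrans (addr0 _) (add0r _)).
by rewrite /= !mul0r !mul1r !add0r !addr0 -!surjective_pairing.
Qed.

Let lam_v2 : [/\ lam0 T T.2 = 0, lam1 T T.2 = 0 & lam2 T T.2 = 1].
Proof.
have := @lam_bary R T ndT 0 0 1 (etrans (congr1 (+%R^~ 1) (addr0 0)) (add0r 1)).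
by rewrite /= !mul0r !mul1r !add0r -!surjective_pairing.
Qed.

Let lam_dir l a b (p q : R * R) : affine l a b ->
  a * (q - p).1 + b * (q - p).2 = l q - l p.
Proof. by move=> al; rewrite -[in RHS](subrK p q) [q - p + p]addrC al addrAC subrr add0r. Qed.

Lemma C1_exp f f1 f2 n : C1 f f1 f2 ->
  C1 (fun x => f x ^+ n) (fun x => n%:R * f x ^+ n.-1 * f1 x)
     (fun x => n%:R * f x ^+ n.-1 * f2 x).
Proof.
move=> Cf; elim: n => [|n IH].
  by have := @C1_cst R 1; apply: C1_ext => x; rewrite ?expr0// !mul0r.
have := C1M Cf IH; apply: C1_ext => x; rewrite /= ?exprS//.
  by case: n {IH} => [|n]; rewrite /= ?exprS -[in RHS]natr1; ring.
by case: n {IH} => [|n]; rewrite /= ?exprS -[in RHS]natr1; ring.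
Qed.

Let C1_ev_mono i j : C1 (ev (mono i j))
  (fun x => ev (fun y => i%:R * mono i.-1 j y) x * a1 + ev (fun y => j%:R * mono i j.-1 y) x * a2)
  (fun x => ev (fun y => i%:R * mono i.-1 j y) x * b1 + ev (fun y => j%:R * mono i j.-1 y) x * b2).
Proof.
have := C1M (C1_exp i (affine_C1 (affine_lam1 T))) (C1_exp j (affine_C1 (affine_lam2 T))).
by apply: C1_ext => x; rewrite /ev /mono /=; rewrite -/a1 -/a2 -/b1 -/b2; ring.
Qed.

Let C1_ev_scaled_mono (c : R) i j : C1 (ev (fun x => c * mono i j x))
  (fun x => c * (ev (fun y => i%:R * mono i.-1 j y) x * a1 + ev (fun y => j%:R * mono i j.-1 y) x * a2))
  (fun x => c * (ev (fun y => i%:R * mono i.-1 j y) x * b1 + ev (fun y => j%:R * mono i j.-1 y) x * b2)).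
Proof. exact: C1Z (C1_ev_mono i j). Qed.

Lemma appell_C1 k v v1 v2 l : appell k v v1 v2 l ->
  C1 (ev v) (fun x => ev v1 x * a1 + ev v2 x * a2) (fun x => ev v1 x * b1 + ev v2 x * b2).
Proof.
elim.
- by move=> i j _; exact: C1_ev_mono.
- by move=> f f1 f2 lf g g1 g2 lg _ Cf _ Cg; have := C1D Cf Cg;
    apply: C1_ext => x; rewrite /ev; ring.
- by move=> a f f1 f2 lf _ Cf; have := C1Z a Cf; apply: C1_ext => x; rewrite /ev; ring.
Qed.

(** The flux of Appell's operator transported to [T]. Along each of the three edge vectors it has
    the derivative of the polynomial in that direction, weighted by the product of the two
    barycentric coordinates that vary along the edge. *)
Definition bubble_field v1 v2 (x : R * R) : R * R :=
  (lam1 T x * lam0 T x * v1 (lam1 T x, lam2 T x)) *: (T.1.2 - T.1.1) +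
  (lam2 T x * lam0 T x * v2 (lam1 T x, lam2 T x)) *: (T.2 - T.1.1) +
  (lam1 T x * lam2 T x * (v1 (lam1 T x, lam2 T x) - v2 (lam1 T x, lam2 T x)))
     *: (T.1.2 - T.2).

Let c0 : (- a1 - a2, - b1 - b2) != (0, 0).
Proof.
apply/eqP => -[a b]; have [h0 _ _] := lam_v0; have [k0 _ _] := lam_v1.
have := lam_dir T.1.1 T.1.2 (affine_lam0 T).
by rewrite -/a1 -/a2 -/b1 -/b2 a b h0 k0 !mul0r; lra.
Qed.

Let c1 : (a1, b1) != (0, 0).
Proof.
apply/eqP => -[a b]; have [_ h0 _] := lam_v0; have [_ k0 _] := lam_v1.
by have := lam_dir T.1.1 T.1.2 (affine_lam1 T); rewrite -/a1 -/b1 a b h0 k0 !mul0r; lra.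
Qed.

Let c2 : (a2, b2) != (0, 0).
Proof.
apply/eqP => -[a b]; have [_ _ h0] := lam_v0; have [_ _ k0] := lam_v2.
by have := lam_dir T.1.1 T.2 (affine_lam2 T); rewrite -/a2 -/b2 a b h0 k0 !mul0r; lra.
Qed.

Let perm_open_tri x :
  ([&& 0 < lam1 T x, 0 < lam0 T x & 0 < lam2 T x] = open_tri T x) *
  ([&& 0 < lam2 T x, 0 < lam0 T x & 0 < lam1 T x] = open_tri T x) *
  ([&& 0 < lam1 T x, 0 < lam2 T x & 0 < lam0 T x] = open_tri T x).
Proof.
by rewrite /open_tri; case: (0 < lam0 T x); case: (0 < lam1 T x); case: (0 < lam2 T x).
Qed.

(** The field is a sum of three edge bubbles, one per edge, with the factors [v1], [v2] and
    [v1 - v2]. By linearity only monomials have to be compared with the closed formula for [L]. *)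
Lemma appell_weakdiv k v v1 v2 l : appell k v v1 v2 l ->
  weakdiv (fun x => (open_tri T x)%:R *: bubble_field v1 v2 x)
          (fun x => (open_tri T x)%:R * ev l x).
Proof.
elim; last 2 first.
- move=> f f1 f2 lf g g1 g2 lg _ wf _ wg; have := weakdivD wf wg.
  apply: weakdiv_ext => x; last by rewrite /ev mulrDr.
  rewrite [LHS]surjective_pairing [RHS]surjective_pairing /bubble_field /= /GRing.scale /=.
  by congr (_, _); ring.
- move=> a f f1 f2 lf _ wf; have := weakdivZ a wf.
  apply: weakdiv_ext => x; last by rewrite /ev mulrCA.
  rewrite [LHS]surjective_pairing [RHS]surjective_pairing /bubble_field /= /GRing.scale /=.
  rewrite /GRing.scale /=; by congr (_, _); ring.
move=> i j _.
have [v00 v01 v02] := lam_v0; have [v10 v11 v12] := lam_v1; have [v20 v21 v22] := lam_v2.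
have d (l' : R * R -> R) a b p q : affine l' a b -> a * (q - p).1 + b * (q - p).2 = l' q - l' p.
  by move=> al; exact: lam_dir.
have s1 x : lam1 T x + lam0 T x + lam2 T x = 1 by rewrite -(lam_sum T x); ring.
have s2 x : lam2 T x + lam0 T x + lam1 T x = 1 by rewrite -(lam_sum T x); ring.
have s3 x : lam1 T x + lam2 T x + lam0 T x = 1 by rewrite -(lam_sum T x); ring.
have B x : open_tri T x -> box (tri_bound T) x by move/(open_tri_box ndT).
have W1 := C1_ev_scaled_mono i%:R i.-1 j.
have W2 := C1_ev_scaled_mono j%:R i j.-1.
have e1 := @edge_bubble R _ _ _ _ _ _ _ _ _ (T.1.2 - T.1.1) (tri_bound T) _ _ _
  (affine_lam1 T) (affine_lam0 T) (affine_lam2 T).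
have e2 := @edge_bubble R _ _ _ _ _ _ _ _ _ (T.2 - T.1.1) (tri_bound T) _ _ _
  (affine_lam2 T) (affine_lam0 T) (affine_lam1 T).
have e3 := @edge_bubble R _ _ _ _ _ _ _ _ _ (T.1.2 - T.2) (tri_bound T) _ _ _
  (affine_lam1 T) (affine_lam2 T) (affine_lam0 T).
have D11 : a1 * (T.1.2 - T.1.1).1 + b1 * (T.1.2 - T.1.1).2 = 1.
  by rewrite (d _ _ _ _ _ (affine_lam1 T)) v11 v01 subr0.
have D12 : a2 * (T.1.2 - T.1.1).1 + b2 * (T.1.2 - T.1.1).2 = 0.
  by rewrite (d _ _ _ _ _ (affine_lam2 T)) v12 v02 subr0.
have D21 : a1 * (T.2 - T.1.1).1 + b1 * (T.2 - T.1.1).2 = 0.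
  by rewrite (d _ _ _ _ _ (affine_lam1 T)) v21 v01 subr0.
have D22 : a2 * (T.2 - T.1.1).1 + b2 * (T.2 - T.1.1).2 = 1.
  by rewrite (d _ _ _ _ _ (affine_lam2 T)) v22 v02 subr0.
have D31 : a1 * (T.1.2 - T.2).1 + b1 * (T.1.2 - T.2).2 = 1.
  by rewrite (d _ _ _ _ _ (affine_lam1 T)) v11 v21 subr0.
have D32 : a2 * (T.1.2 - T.2).1 + b2 * (T.1.2 - T.2).2 = -1.
  by rewrite (d _ _ _ _ _ (affine_lam2 T)) v12 v22 sub0r.
have D10 : (- a1 - a2) * (T.1.2 - T.1.1).1 + (- b1 - b2) * (T.1.2 - T.1.1).2 = -1.
  by rewrite (d _ _ _ _ _ (affine_lam0 T)) v10 v00 sub0r.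
have D20 : (- a1 - a2) * (T.2 - T.1.1).1 + (- b1 - b2) * (T.2 - T.1.1).2 = -1.
  by rewrite (d _ _ _ _ _ (affine_lam0 T)) v20 v00 sub0r.
have D30 : (- a1 - a2) * (T.1.2 - T.2).1 + (- b1 - b2) * (T.1.2 - T.2).2 = 0.
  by rewrite (d _ _ _ _ _ (affine_lam0 T)) v10 v20 subr0.
have := weakdivD (weakdivD
  (e1 _ _ _ D11 D10 D12 c2 s1 (fun x => eq_ind_r (fun b : bool => b -> _) (B x) (perm_open_tri x).1.1) W1)
  (e2 _ _ _ D22 D20 D21 c1 s2 (fun x => eq_ind_r (fun b : bool => b -> _) (B x) (perm_open_tri x).1.2) W2))
  (e3 _ _ _ D31 D32 D30 c0 s3 (fun x => eq_ind_r (fun b : bool => b -> _) (B x) (perm_open_tri x).2) (C1B W1 W2)).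
apply: weakdiv_ext => x; rewrite !perm_open_tri.
  rewrite [LHS]surjective_pairing [RHS]surjective_pairing /bubble_field /= /GRing.scale /=.
  by rewrite /GRing.scale /= /ev; congr (_, _); ring.
move: ((open_tri T x)%:R : R) => o.
have dirw (e : R * R) x1 x2 c A B' : a1 * e.1 + b1 * e.2 = x1 -> a2 * e.1 + b2 * e.2 = x2 ->
  e.1 * (c * (A * a1 + B' * a2)) + e.2 * (c * (A * b1 + B' * b2)) = c * (A * x1 + B' * x2).
  by move=> <- <-; ring.
have dirB (e : R * R) P1 P2 Q1 Q2 X Y : e.1 * P1 + e.2 * P2 = X -> e.1 * Q1 + e.2 * Q2 = Y ->
  e.1 * (P1 - Q1) + e.2 * (P2 - Q2) = X - Y.
  by move=> <- <-; ring.
pose s := lam1 T x; pose r := lam2 T x; pose z := 1 - s - r.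
pose ss := i.-1%:R * mono i.-2 j (s, r); pose sr := j%:R * mono i.-1 j.-1 (s, r).
pose rs := i%:R * mono i.-1 j.-1 (s, r); pose rr := j.-1%:R * mono i j.-2 (s, r).
pose f1 := i%:R * mono i.-1 j (s, r); pose f2 := j%:R * mono i j.-1 (s, r).
transitivity (o * ((z - s) * f1 + s * z * (i%:R * (ss * 1 + sr * 0))) +
  o * ((z - r) * f2 + r * z * (j%:R * (rs * 0 + rr * 1))) +
  o * ((r - s) * (f1 - f2) + s * r * (i%:R * (ss * 1 + sr * -1) - j%:R * (rs * 1 + rr * -1)))).
  congr (_ * (_ + _ * _) + _ * (_ + _ * _) + _ * (_ + _ * _)).
  - exact: dirw D11 D12.
  - exact: dirw D21 D22.
  - exact: dirB (dirw _ _ _ _ _ _ D31 D32) (dirw _ _ _ _ _ _ D31 D32).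
rewrite /ev /f1 /f2 /ss /sr /rs /rr /z /s /r /mono /=.
move: (lam1 T x) (lam2 T x) => {s r z ss sr rs rr f1 f2} s r.
(* The exponents [i.-1] and [i.-2] are truncated at zero, so the exponents 0 and 1 are checked
   separately. *)
by case: i {W1 W2} => [|[|i]]; case: j => [|[|j]]; rewrite /= ?exprS ?expr0; ring.
Qed.

Let energy v1 v2 w1 w2 (x : R * R) : R :=
  lam1 T x * lam0 T x * (ev v1 x * ev w1 x) + lam2 T x * lam0 T x * (ev v2 x * ev w2 x) +
  lam1 T x * lam2 T x * ((ev v1 x - ev v2 x) * (ev w1 x - ev w2 x)).

Let ip f g : R := pint (fun x => (open_tri T x)%:R * (ev f x * ev g x)).

(** Green's formula without boundary term: the weak divergence of the flux of [v] is tested with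
    [w], and along the edge vectors the derivatives of [w] are [w1], [w2] and [w1 - w2]. The energy
    is symmetric, which makes [L] symmetric, and it also controls the norm of the flux. *)
Lemma appell_energy k v v1 v2 l w w1 w2 m :
  appell k v v1 v2 l -> appell k w w1 w2 m ->
  nice (fun x => (open_tri T x)%:R * energy v1 v2 w1 w2 x) /\
  pint (fun x => (open_tri T x)%:R * energy v1 v2 w1 w2 x) = - ip l w.
Proof.
move=> hv hw; have Cw := appell_C1 hw; have [n1 n2 n3 wd] := appell_weakdiv hv.
have [mw mw1 mw2] := C1_meas Cw; have [bw bw1 bw2] := C1_locb Cw.
have [v00 v01 v02] := lam_v0; have [v10 v11 v12] := lam_v1; have [v20 v21 v22] := lam_v2.
have D11 := lam_dir T.1.1 T.1.2 (affine_lam1 T).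
have D12 := lam_dir T.1.1 T.1.2 (affine_lam2 T).
have D21 := lam_dir T.1.1 T.2 (affine_lam1 T).
have D22 := lam_dir T.1.1 T.2 (affine_lam2 T).
have D31 := lam_dir T.2 T.1.2 (affine_lam1 T).
have D32 := lam_dir T.2 T.1.2 (affine_lam2 T).
rewrite -/a1 -/b1 -/a2 -/b2 in D11 D12 D21 D22 D31 D32.
have E x : ((open_tri T x)%:R *: bubble_field v1 v2 x).1 * (ev w1 x * a1 + ev w2 x * a2) +
    ((open_tri T x)%:R *: bubble_field v1 v2 x).2 * (ev w1 x * b1 + ev w2 x * b2) =
    (open_tri T x)%:R * energy v1 v2 w1 w2 x.
  have -> : energy v1 v2 w1 w2 x =
    lam1 T x * lam0 T x * ev v1 x * (ev w1 x * (lam1 T T.1.2 - lam1 T T.1.1) +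
                                     ev w2 x * (lam2 T T.1.2 - lam2 T T.1.1)) +
    lam2 T x * lam0 T x * ev v2 x * (ev w1 x * (lam1 T T.2 - lam1 T T.1.1) +
                                     ev w2 x * (lam2 T T.2 - lam2 T T.1.1)) +
    lam1 T x * lam2 T x * (ev v1 x - ev v2 x) * (ev w1 x * (lam1 T T.1.2 - lam1 T T.2) +
                                     ev w2 x * (lam2 T T.1.2 - lam2 T T.2)).
    by rewrite v01 v02 v11 v12 v21 v22 /energy; ring.
  by rewrite -D11 -D12 -D21 -D22 -D31 -D32 /bubble_field /= /GRing.scale /= /ev; ring.
have nE : nice (fun x => (open_tri T x)%:R * energy v1 v2 w1 w2 x).
  by rewrite -(funext E); apply: niceD; exact: niceM.
split=> //; apply/eqP; rewrite -addr_eq0; apply/eqP.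
have nlw : nice (fun x => (open_tri T x)%:R * (ev l x * ev w x)).
  by have := niceM n3 mw bw; congr nice; apply/funext => x; rewrite mulrA.
rewrite /ip -pintD; [|exact: nice_pintegrable|exact: nice_pintegrable].
rewrite -[RHS](wd _ _ _ Cw); apply: eq_pint => x.
by rewrite E mulrA.
Qed.

Let nice_ev f g k n : Poly2 k f -> Poly2 n g ->
  nice (fun x => (open_tri T x)%:R * (ev f x * ev g x)).
Proof.
move=> /in_appell_Poly2[l [v1 [v2 hf]]] /in_appell_Poly2[m [w1 [w2 hg]]].
have Cf := appell_C1 hf; have Cg := appell_C1 hg.
have [mC _ _] := C1_meas (C1M Cf Cg); have [bC _ _] := C1_locb (C1M Cf Cg).
exact: niceM (nice_open_tri ndT) mC bC.
Qed.

Lemma weighted_cauchy3 (al1 al2 al3 g1 g2 g3 u1 u2 u3 : R) :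
  0 <= al1 -> 0 <= al2 -> 0 <= al3 ->
  (al1 * g1 * u1 + al2 * g2 * u2 + al3 * g3 * u3) ^+ 2 <=
  (al1 * u1 ^+ 2 + al2 * u2 ^+ 2 + al3 * u3 ^+ 2) *
  (al1 * g1 ^+ 2 + al2 * g2 ^+ 2 + al3 * g3 ^+ 2).
Proof.
move=> h1 h2 h3; rewrite -subr_ge0.
rewrite (_ : _ - _ = al1 * al2 * (g1 * u2 - g2 * u1) ^+ 2 +
  al1 * al3 * (g1 * u3 - g3 * u1) ^+ 2 + al2 * al3 * (g2 * u3 - g3 * u2) ^+ 2); last by ring.
by rewrite !addr_ge0// mulr_ge0 ?sqr_ge0// mulr_ge0.
Qed.

(** Cauchy-Schwarz with the weights [lam_i lam_j] in each component separates the energy from the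
    weighted sum of the squared sides. Each weight is at most 1/4, and a quarter of the sum of the
    squared sides is at most [tsize T / 2]. *)
Lemma sqn_bubble_field v1 v2 x : open_tri T x ->
  sqn (bubble_field v1 v2 x) <= tsize T / 2 * energy v1 v2 v1 v2 x.
Proof.
move=> /and3P[h0 h1 h2].
have q10 : 0 <= lam1 T x * lam0 T x by rewrite mulr_ge0// ltW.
have q20 : 0 <= lam2 T x * lam0 T x by rewrite mulr_ge0// ltW.
have q12 : 0 <= lam1 T x * lam2 T x by rewrite mulr_ge0// ltW.
have lq (a b : R) : 0 < a -> 0 < b -> a + b <= 1 -> a * b <= 1 / 4.
  by move=> a0 b0 ab; have := sqr_ge0 (a - b); nra.
have ls := lam_sum T x.
have k10 : lam1 T x * lam0 T x <= 1 / 4 by apply: lq => //; lra.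
have k20 : lam2 T x * lam0 T x <= 1 / 4 by apply: lq => //; lra.
have k12 : lam1 T x * lam2 T x <= 1 / 4 by apply: lq => //; lra.
rewrite /sqn /bubble_field /= /GRing.scale /= /energy -/(ev v1 x) -/(ev v2 x) -!expr2.
have E0 : 0 <= lam1 T x * lam0 T x * ev v1 x ^+ 2 + lam2 T x * lam0 T x * ev v2 x ^+ 2 +
   lam1 T x * lam2 T x * (ev v1 x - ev v2 x) ^+ 2.
  by rewrite !addr_ge0// mulr_ge0// sqr_ge0.
have C1 := weighted_cauchy3 (ev v1 x) (ev v2 x) (ev v1 x - ev v2 x)
  (T.1.2.1 - T.1.1.1) (T.2.1 - T.1.1.1) (T.1.2.1 - T.2.1) q10 q20 q12.
have C2 := weighted_cauchy3 (ev v1 x) (ev v2 x) (ev v1 x - ev v2 x)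
  (T.1.2.2 - T.1.1.2) (T.2.2 - T.1.1.2) (T.1.2.2 - T.2.2) q10 q20 q12.
apply: le_trans (lerD C1 C2) _; rewrite -mulrDl ler_wpM2r//.
rewrite /tsize /sqn /=.
set A := lam1 T x * lam0 T x in q10 k10 *; set B := lam2 T x * lam0 T x in q20 k20 *.
set C := lam1 T x * lam2 T x in q12 k12 *.
have sq (a : R) (t : R) : a <= 1 / 4 -> a * t ^+ 2 <= 1 / 4 * t ^+ 2.
  by move=> a4; rewrite ler_wpM2r ?sqr_ge0.
have := sq _ (T.1.2.1 - T.1.1.1) k10; have := sq _ (T.2.1 - T.1.1.1) k20.
have := sq _ (T.1.2.1 - T.2.1) k12; have := sq _ (T.1.2.2 - T.1.1.2) k10.
have := sq _ (T.2.2 - T.1.1.2) k20; have := sq _ (T.1.2.2 - T.2.2) k12.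
have := sqr_ge0 (T.1.2.1 - T.1.1.1); have := sqr_ge0 (T.2.1 - T.1.1.1).
have := sqr_ge0 (T.1.2.2 - T.1.1.2); have := sqr_ge0 (T.2.2 - T.1.1.2).
lra.
Qed.

(** Regrouped around the vertices, the field is [- (lam1 v1) (x - T.1.2) - (lam2 v2) (x - T.2)]. The
    scalar factors have the scalar degree [k] of the family, so the field is of Raviart-Thomas type
    of order [k], and it has full degree [k + 1], which is [p] for BDM. *)
Lemma bubble_field_local F p v v1 v2 l : valid_order F p ->
  appell (scalar_degree F p) v v1 v2 l -> local_field F p (bubble_field v1 v2).
Proof.
move=> Fp /Poly2_appell[_ _ P1 P2].
have L1 : Poly2 1 (lam1 T).
  have := Poly2D (Poly2_cst 1 (lam1 T 0)) (Poly2D (Poly2Z a1 (@Poly2_fst R)) (Poly2Z b1 (@Poly2_snd R))).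
  by apply: Poly2_ext => x; rewrite -(affine_lam1 T) add0r.
have L2 : Poly2 1 (lam2 T).
  have := Poly2D (Poly2_cst 1 (lam2 T 0)) (Poly2D (Poly2Z a2 (@Poly2_fst R)) (Poly2Z b2 (@Poly2_snd R))).
  by apply: Poly2_ext => x; rewrite -(affine_lam2 T) add0r.
have {}P1 := Poly2_comp L1 L2 P1; have {}P2 := Poly2_comp L1 L2 P2.
have E x : bubble_field v1 v2 x =
   - (lam1 T x * ev v1 x) *: (x - T.1.2) - (lam2 T x * ev v2 x) *: (x - T.2).
  rewrite /bubble_field /ev.
  rewrite [LHS]surjective_pairing [RHS]surjective_pairing /= /GRing.scale /=.
  rewrite (bary1 x) (bary2 x); have -> : lam0 T x = 1 - lam1 T x - lam2 T x by [].
  by congr (_, _); ring.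
rewrite (funext E); case: F Fp P1 P2 => /= Fp P1 P2.
  exists (fun x => lam1 T x * ev v1 x * T.1.2.1 + lam2 T x * ev v2 x * T.2.1),
    (fun x => lam1 T x * ev v1 x * T.1.2.2 + lam2 T x * ev v2 x * T.2.2),
    (fun x => (-1) * (lam1 T x * ev v1 x) - lam2 T x * ev v2 x); split.
  - by have := Poly2D (Poly2Z T.1.2.1 P1) (Poly2Z T.2.1 P2); apply: Poly2_ext => x /=;
      rewrite /ev; ring.
  - by have := Poly2D (Poly2Z T.1.2.2 P1) (Poly2Z T.2.2 P2); apply: Poly2_ext => x /=;
      rewrite /ev; ring.
  - exact: Poly2B (Poly2Z _ P1) P2.
  - move=> x; rewrite [LHS]surjective_pairing /= /GRing.scale /=; by congr (_, _); ring.
exists (fun x => lam1 T x * ev v1 x * (T.1.2.1 - x.1) + lam2 T x * ev v2 x * (T.2.1 - x.1)),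
  (fun x => lam1 T x * ev v1 x * (T.1.2.2 - x.2) + lam2 T x * ev v2 x * (T.2.2 - x.2)).
have Pf c : Poly2 1 (fun x : R * R => c - x.1) by exact: Poly2B (Poly2_cst 1 c) Poly2_fst.
have Ps c : Poly2 1 (fun x : R * R => c - x.2) by exact: Poly2B (Poly2_cst 1 c) Poly2_snd.
split.
- have := Poly2D (Poly2M P1 (Pf T.1.2.1)) (Poly2M P2 (Pf T.2.1)).
  by rewrite addn1 prednK.
- have := Poly2D (Poly2M P1 (Ps T.1.2.2)) (Poly2M P2 (Ps T.2.2)).
  by rewrite addn1 prednK.
- move=> x; rewrite [LHS]surjective_pairing /= /GRing.scale /=; by congr (_, _); ring.
Qed.

Lemma leaf_right_inverse F p q : valid_order F p -> Poly2 (scalar_degree F p) q ->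
  exists t d c, [/\ weakdiv t d, forall x, ~~ open_tri T x -> t x = 0 /\ d x = 0,
    forall x, open_tri T x -> d x = q x - c,
    exists2 tau, local_field F p tau & forall x, open_tri T x -> t x = tau x &
    pint (fun x => sqn (t x)) <= 3 / 2 * tsize T * pint (fun x => d x ^+ 2)].
Proof.
move=> Fp; set k := scalar_degree F p => Pq.
(* The polynomial [q] written in reference coordinates, so that [ev b] gives it back. *)
pose b y := q (T.1.1.1 + y.1 * (T.1.2.1 - T.1.1.1) + y.2 * (T.2.1 - T.1.1.1),
               T.1.1.2 + y.1 * (T.1.2.2 - T.1.1.2) + y.2 * (T.2.2 - T.1.1.2)).
have Pb : Poly2 k b.
  have PL (a u w : R) : Poly2 1 (fun y : R * R => a + y.1 * u + y.2 * w).
    have := Poly2D (Poly2D (Poly2_cst 1 a) (Poly2Z u (@Poly2_fst R))) (Poly2Z w (@Poly2_snd R)).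
    by apply: Poly2_ext => y; ring.
  exact: (Poly2_comp (PL _ _ _) (PL _ _ _) Pq).
have bq x : ev b x = q x.
  rewrite /ev /b /= [in RHS](surjective_pairing x) (bary1 x) (bary2 x).
  have -> : lam0 T x = 1 - lam1 T x - lam2 T x by [].
  by congr (q (_, _)); ring.
have nE f g := @nice_ev f g k k.
have iE f g : Poly2 k f -> Poly2 k g -> pintegrable (fun x => (open_tri T x)%:R * (ev f x * ev g x)).
  by move=> Pf Pg; apply: nice_pintegrable; exact: nE.
have [||||v l w m [v1 [v2 hv]] [w1 [w2 hw]]|v [c [[v1 [v2 hv]] le]]] := @appell_invert R ip k _ _ _ _ _ b Pb.
- by move=> f g _ _; apply: eq_pint => x; rewrite [ev f x * _]mulrC.
- move=> f g h Pf Pg Ph; rewrite /ip -pintD; [|exact: iE|exact: iE].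
  by apply: eq_pint => x; rewrite /ev; ring.
- move=> a f h Pf Ph; rewrite /ip -pintZ; last exact: iE.
  by apply: eq_pint => x; rewrite /ev; ring.
- by move=> f Pf; apply: pint_ge0 => x; rewrite mulr_ge0// -expr2 sqr_ge0.
- have [_ e1] := appell_energy hv hw; have [_ e2] := appell_energy hw hv.
  have : - ip l w = - ip m v.
    by rewrite -e1 -e2; apply: eq_pint => x; rewrite /energy; ring.
  by move/oppr_inj => ->; apply: eq_pint => x; rewrite [ev m x * _]mulrC.
exists (fun x => (open_tri T x)%:R *: bubble_field v1 v2 x),
  (fun x => (open_tri T x)%:R * ev (fun y => b y - c) x), c.
have wd := appell_weakdiv hv.
have [nt1 nt2 nd _] := wd.
have [nen een] := appell_energy hv hv.
split=> //.
- by move=> x /negbTE ->; rewrite scale0r mul0r.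
- by move=> x ->; rewrite mul1r -bq.
- exists (bubble_field v1 v2); first exact: bubble_field_local hv.
  by move=> x ->; rewrite scale1r.
have nsq : nice (fun x => sqn ((open_tri T x)%:R *: bubble_field v1 v2 x)).
  by apply: niceD; rewrite /=; [have := niceMM nt1 nt1|have := niceMM nt2 nt2].
apply: (@le_trans _ _ (tsize T / 2 * pint (fun x => (open_tri T x)%:R * energy v1 v2 v1 v2 x))).
  rewrite -pintZ; last exact: nice_pintegrable.
  apply: le_pint; [exact: nice_pintegrable|exact/nice_pintegrable/niceZ|].
  move=> x; case: (boolP (open_tri T x)) => Tx.
    by rewrite scale1r mul1r sqn_bubble_field.
  by rewrite scale0r !mul0r mulr0 /sqn /= expr0n addr0.
rewrite een.
have -> : pint (fun x => ((open_tri T x)%:R * ev (fun y => b y - c) x) ^+ 2) =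
  ip (fun y => b y - c) (fun y => b y - c).
  by apply: eq_pint => x; case: (open_tri T x); rewrite ?mul1r ?mul0r ?expr0n// expr2.
have C : ip (fun y => b y - c) v = ip v (fun y => b y - c).
  by apply: eq_pint => x; rewrite [ev v x * _]mulrC.
rewrite C.
have Q0 := tsize_ge0 T.
have I0 : 0 <= ip (fun y => b y - c) (fun y => b y - c).
  by apply: pint_ge0 => x; rewrite mulr_ge0// -expr2 sqr_ge0.
have : tsize T / 2 * - ip v (fun y => b y - c) <= tsize T / 2 *
   (3^-1 * ip (fun y => b y - c) (fun y => b y - c)).
  by rewrite ler_wpM2l// mulr_ge0.
move=> h; apply: le_trans h _.
have := mulr_ge0 Q0 I0; move: (ip _ _) (tsize T) => I Q h.
(* The factor 1/2 of the flux bound and the factor 1/3 from the first nonzero eigenvalue give 1/6.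
   This is relaxed to 3/2, the constant that the induction on the tree reproduces. *)
rewrite (_ : Q / 2 * (3^-1 * I) = 1 / 6 * (Q * I)); last by field.
rewrite (_ : 3 / 2 * Q * I = 3 / 2 * (Q * I)); last by ring.
lra.
Qed.

End LeafField.

(** * Smooth bumps and the du Bois-Reymond lemma *)

Section TestFunctions.
Context {R : realType}.
Implicit Types (f g phi : R * R -> R) (x v : R * R).
Local Notation mu := (@plane_measure R).
Local Notation plane := (measurableTypeR R * measurableTypeR R)%type.

(** The classical flat function with all the negative powers that differentiation produces: the
    derivative of the [k]-th member is a combination of the members [k + 1] and [k + 2]. *)
Definition flat_exp (k : nat) (t : R) : R :=
  if 0 < t then t^-1 ^+ k * expR (- t^-1) else 0.

Lemma flat_exp_ge0 k t : 0 <= flat_exp k t.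
Proof.
by rewrite /flat_exp; case: ltP => // t0; rewrite mulr_ge0 ?expR_ge0// exprn_ge0// invr_ge0 ltW.
Qed.

(** With [u = t^-1], the inequality [(u / (k + 1)) ^ (k + 1) <= exp u] follows from [1 + s <= exp s]
    at [s = u / (k + 1)]. It leaves one factor [t], enough for the derivatives at the origin. *)
Lemma flat_exp_le k t : 0 < t -> flat_exp k t <= k.+1%:R ^+ k.+1 * t.
Proof.
move=> t0; rewrite /flat_exp t0; set u := t^-1; have u0 : 0 < u by rewrite invr_gt0.
have tE : t = u^-1 by rewrite invrK.
clearbody u.
have k0 : 0 < k.+1%:R :> R by rewrite ltr0n.
have h : (u / k.+1%:R) ^+ k.+1 <= expR u.
  have uE : u = k.+1%:R * (u / k.+1%:R) by rewrite mulrC divfK// lt0r_neq0.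
  rewrite [X in expR X]uE expRM_natl.
  apply: lerXn2r; rewrite ?nnegrE ?expR_ge0 ?divr_ge0// ltW//.
  by apply: lt_le_trans (expR_ge1Dx _); rewrite ltrDr.
rewrite expRN ler_pdivrMr ?expR_gt0//.
have uE : u ^+ k = k.+1%:R ^+ k.+1 * t * (u / k.+1%:R) ^+ k.+1.
  have gen (x y z : R) : x != 0 -> y != 0 -> z = y * x^-1 * (x * z * y^-1).
    by move=> x0 y0; field; rewrite x0 y0.
  by rewrite tE exprMn exprVn [u ^+ k.+1]exprS; apply: gen; rewrite ?expf_neq0// lt0r_neq0.
by rewrite [X in X <= _]uE ler_wpM2l// mulr_ge0// ?exprn_ge0// ltW.
Qed.

Lemma is_derive_flat_exp k (t : R) :
  is_derive t (1 : R) (flat_exp k : R -> R) (- k%:R * flat_exp k.+1 t + flat_exp k.+2 t).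
Proof.
have [t0|t0|t0] := ltgtP t 0.
- rewrite /flat_exp !(lt_gtF t0) mulr0 addr0.
  apply: (@near_eq_is_derive _ _ _ (cst (0 : R))) (is_derive_cst _ _ _).
  near=> s; have s0 : s < 0 by near: s; exact: lt_nbhsl.
  by rewrite (lt_gtF s0).
- have dinv : is_derive t 1 (fun s : R => s^-1) (- t ^- 2).
    have := @is_deriveV R id t 1 1 (lt0r_neq0 t0) (is_derive_id _ _).
    by rewrite /GRing.scale /= mulr1.
  have de : is_derive t 1 (fun s : R => expR (- s^-1)) (expR (- t^-1) * t ^- 2).
    have := @is_derive1_comp R expR (fun s => - s^-1) t _ _ (is_derive_expR _) (is_deriveN dinv).
    by rewrite opprK.
  apply: (@near_eq_is_derive _ _ _ (fun s : R => s^-1 ^+ k * expR (- s^-1))).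
    near=> s; have s0 : 0 < s by near: s; exact: lt_nbhsr.
    by rewrite /flat_exp s0.
  have dX : is_derive t (1 : R) (fun s : R => s^-1 ^+ k) (- k%:R * t^-1 ^+ k.+1).
    elim: k => [|k IH]; first by rewrite oppr0 mul0r; exact: is_derive_cst.
    have -> : (fun s : R => s^-1 ^+ k.+1) = (fun s : R => s^-1 * s^-1 ^+ k).
      by apply/funext => s; rewrite exprS.
    apply: (is_derive_eq (is_deriveM dinv IH)).
    by rewrite /GRing.scale /= -exprVn !exprS -natr1; ring.
  apply: (is_derive_eq (is_deriveM dX de)).
  by rewrite /flat_exp t0 /GRing.scale /= -exprVn !exprS; ring.
- rewrite t0 /flat_exp ltxx mulr0 addr0.
  have L : (fun h : R => h^-1 *: (flat_exp k (h *: 1 + 0) - flat_exp k 0)) @ 0^' --> (0 : R).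
    (* At the origin the difference quotient is the next member of the family, which tends to zero
       by the linear bound. *)
    have E : (fun h : R => h^-1 *: (flat_exp k (h *: 1 + 0) - flat_exp k 0)) = flat_exp k.+1.
      apply/funext => h; rewrite addr0 [h *: 1]mulr1 /flat_exp ltxx subr0 /GRing.scale /=.
      by case: ltP => h0; rewrite ?mulr0// mulrA -exprS.
    rewrite E; apply/cvgrPdist_le => e e0; near=> h.
    rewrite sub0r normrN ger0_norm ?flat_exp_ge0//.
    have [h0|h0] := ltP 0 h; last by rewrite /flat_exp ltNge h0 /= ltW.
    rewrite (le_trans (flat_exp_le _ h0))// -ler_pdivlMl ?exprn_gt0//.
    rewrite -(gtr0_norm h0) ltW//.
    by near: h; apply: dnbhs0_lt; rewrite mulr_gt0// invr_gt0 exprn_gt0.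
  split; first by apply/cvg_ex; exists 0.
  exact/cvg_lim.
Unshelve. all: by end_near. Qed.

(** A class closed under both partial derivatives. Smoothness then needs the differentiability of
    its members only, and no formula for iterated derivatives. *)
Inductive bump_algebra : (R * R -> R) -> Prop :=
| bump_flat k a b c : bump_algebra (fun x => flat_exp k (a * x.1 + b * x.2 + c))
| bumpD f g : bump_algebra f -> bump_algebra g -> bump_algebra (fun x => f x + g x)
| bumpM f g : bump_algebra f -> bump_algebra g -> bump_algebra (fun x => f x * g x)
| bumpZ a f : bump_algebra f -> bump_algebra (fun x => a * f x).

Lemma partial_line f x d v : is_derive x v f d -> 'D_v f x = d.
Proof. by move=> [_ ->]. Qed.

Lemma bump_algebra_partial f : bump_algebra f ->
  [/\ forall x, differentiable f x, bump_algebra (partial1 f) & bump_algebra (partial2 f)].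
Proof.
suff main : bump_algebra f -> exists p1 p2, [/\ bump_algebra p1, bump_algebra p2,
    forall x, differentiable f x & forall x v, is_derive x v f (v.1 * p1 x + v.2 * p2 x)].
  move=> /main[p1 [p2 [b1 b2 df D]]]; split=> //.
    by rewrite (_ : partial1 f = p1)//; apply/funext => x;
      rewrite /partial1 (partial_line (D x (1, 0))) /= mul1r mul0r addr0.
  by rewrite (_ : partial2 f = p2)//; apply/funext => x;
    rewrite /partial2 (partial_line (D x (0, 1))) /= mul1r mul0r add0r.
elim.
- move=> k a b c.
  pose l x : R := a * x.1 + b * x.2 + c.
  have al : affine l a b by move=> x v; rewrite /l /=; ring.
  have [cl _ _ dl] := affine_C1 al.
  exists (fun x => a * (- k%:R * flat_exp k.+1 (l x) + flat_exp k.+2 (l x))),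
    (fun x => b * (- k%:R * flat_exp k.+1 (l x) + flat_exp k.+2 (l x))).
  have bl : bump_algebra (fun x => - k%:R * flat_exp k.+1 (l x) + flat_exp k.+2 (l x)).
    by apply: bumpD; [apply: bumpZ|]; exact: bump_flat.
  have dfl x : differentiable l x.
    have d1 : differentiable (fst : R * R -> R) x by apply: linear_differentiable => y; exact: cvg_fst.
    have d2 : differentiable (snd : R * R -> R) x by apply: linear_differentiable => y; exact: cvg_snd.
    apply: differentiableD; last exact: differentiable_cst.
    by apply: differentiableD; apply: differentiableM => //; exact: differentiable_cst.
  have df x : differentiable (fun x => flat_exp k (l x)) x.
    apply: (@differentiable_comp _ _ _ _ l (flat_exp k)) => //.
    by apply/derivable1_diffP; have [] := is_derive_flat_exp k (l x).
  split=> //; try exact: bumpZ.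
  move=> x v; split; first exact: diff_derivable.
  rewrite deriveE// (@diff_comp _ _ _ _ l (flat_exp k))//; last first.
    by apply/derivable1_diffP; have [] := is_derive_flat_exp k (l x).
  rewrite /= -[X in 'd _ _ X]deriveE// (partial_line (dl x v)).
  have [ex1 e1] := is_derive_flat_exp k (l x).
  rewrite -[X in 'd _ _ X](mulr1 _) -[_ * 1]/(_ *: (1 : R)) linearZ /=.
  rewrite -deriveE; last exact/derivable1_diffP.
  by rewrite e1 /GRing.scale /=; ring.
- move=> f' g' _ [p1 [p2 [b1 b2 d D]]] _ [q1 [q2 [c1 c2 e E]]].
  exists (fun x => p1 x + q1 x), (fun x => p2 x + q2 x); split; try exact: bumpD.
    by move=> x; exact: differentiableD.
  by move=> x v; apply: (is_derive_eq (is_deriveD (D x v) (E x v))); ring.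
- move=> f' g' bf [p1 [p2 [b1 b2 d D]]] bg [q1 [q2 [c1 c2 e E]]].
  exists (fun x => p1 x * g' x + f' x * q1 x), (fun x => p2 x * g' x + f' x * q2 x); split.
  + by apply: bumpD; exact: bumpM.
  + by apply: bumpD; exact: bumpM.
  + by move=> x; exact: differentiableM.
  + move=> x v; apply: (is_derive_eq (is_deriveM (D x v) (E x v))).
    by rewrite /GRing.scale /=; ring.
- move=> a f' _ [p1 [p2 [b1 b2 d D]]].
  exists (fun x => a * p1 x), (fun x => a * p2 x); split; try exact: bumpZ.
    by move=> x; apply: differentiableM => //; exact: differentiable_cst.
  move=> x v; apply: (is_derive_eq (is_deriveZ a (D x v))).
  by rewrite /GRing.scale /=; ring.
Qed.

Lemma bump_algebra_smooth f : bump_algebra f -> smooth f.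
Proof.
move=> bf s x; suff : bump_algebra (foldr (fun b => if b then partial1 else partial2) f s).
  by move=> /bump_algebra_partial[].
by elim: s => //= b s /bump_algebra_partial[_ h1 h2]; case: b.
Qed.

Lemma test_function_C1 (Om : set (R * R)) phi : test_function Om phi ->
  C1 phi (partial1 phi) (partial2 phi).
Proof.
move=> [sm _].
have d0 x : differentiable phi x := sm [::] x.
have d1 x : differentiable (partial1 phi) x := sm [:: true] x.
have d2 x : differentiable (partial2 phi) x := sm [:: false] x.
split; try by move=> x; exact: differentiable_continuous.
move=> x v; split; first exact: diff_derivable.
rewrite deriveE// /partial1 /partial2 !deriveE//.
have {1}-> : v = v.1 *: ((1, 0) : R * R) + v.2 *: ((0, 1) : R * R).
  by rewrite [LHS]surjective_pairing [RHS]surjective_pairing /= /GRing.scale /= !mulr1 !mulr0 addr0 add0r.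
by rewrite linearD !linearZ.
Qed.

Lemma test_function_partial0 (Om : set (R * R)) phi x : test_function Om phi ->
  ~ Om x -> [/\ phi x = 0, partial1 phi x = 0 & partial2 phi x = 0].
Proof.
move=> [sm [K [cK KOm K0]]] Omx.
have nK : ~ K x by move=> /KOm.
have oK : open (~` K) by rewrite openC; apply: compact_closed => //; exact: norm_hausdorff.
have near0 : \forall y \near x, cst (0 : R) y = phi y.
  by have := oK x nK; apply: filterS => y nKy; rewrite K0.
split; first exact: K0.
  by have [_ <-] := near_eq_is_derive near0 (is_derive_cst (0 : R) x (1, 0)).
by have [_ <-] := near_eq_is_derive near0 (is_derive_cst (0 : R) x (0, 1)).
Qed.

Definition closed_rect (a b c d : R) : set (R * R) := `[a, b] `*` `[c, d].

Definition in_rect (a b c d : R) x : bool := [&& a < x.1, x.1 < b, c < x.2 & x.2 < d].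

(** For [t > 0] the values [exp (- 1 / ((n + 1) t))] tend to 1, and for [t <= 0] the factor is zero.
    A product of four such factors is supported in the closed rectangle and tends to the indicator
    of the open one. *)
Lemma rect_bump (U : set (R * R)) (a b c d : R) : closed_rect a b c d `<=` U ->
  exists phi : nat -> R * R -> R, [/\ forall n, test_function U (phi n),
    forall n x, 0 <= phi n x <= 1 &
    forall x, phi n x @[n --> \oo] --> ((in_rect a b c d x)%:R : R)].
Proof.
move=> RU.
pose e n (t : R) := flat_exp 0 (n.+1%:R * t).
have e0 n t : 0 <= e n t by exact: flat_exp_ge0.
have e1 n t : e n t <= 1.
  rewrite /e /flat_exp; case: ltP => // t0; rewrite expr0 mul1r -[X in _ <= X]expR0 ler_expR oppr_le0.
  by rewrite invr_ge0 ltW.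
have en n t : t <= 0 -> e n t = 0.
  by move=> t0; rewrite /e /flat_exp ltNge mulr_ge0_le0.
have ec t : e n t @[n --> \oo] --> ((0 < t)%R%:R : R).
  have [t0|t0] := ltP 0 t; last first.
    by rewrite (_ : e^~ t = cst 0); [exact: cvg_cst|apply/funext => n; rewrite en].
  rewrite (_ : e^~ t = (fun n => expR (- (n.+1%:R^-1 * t^-1)))); last first.
    by apply/funext => n; rewrite /e /flat_exp mulr_gt0 ?ltr0n// expr0 mul1r invfM.
  rewrite -[X in _ --> X]expR0 -[X in expR X]oppr0 -[X in - X](mul0r t^-1).
  apply: continuous_cvg; first exact: continuous_expR.
  by apply: cvgN; apply: cvgMl; exact: cvg_harmonic.
exists (fun n x => e n (x.1 - a) * e n (b - x.1) * (e n (x.2 - c) * e n (d - x.2))); split.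
- move=> n; split.
    apply: bump_algebra_smooth; rewrite /e.
    have B1 := bump_flat 0 n.+1%:R 0 (- (n.+1%:R * a)).
    have B2 := bump_flat 0 (- n.+1%:R) 0 (n.+1%:R * b).
    have B3 := bump_flat 0 0 n.+1%:R (- (n.+1%:R * c)).
    have B4 := bump_flat 0 0 (- n.+1%:R) (n.+1%:R * d).
    have := bumpM (bumpM B1 B2) (bumpM B3 B4); congr bump_algebra; apply/funext => x.
    by congr (flat_exp 0 _ * flat_exp 0 _ * (flat_exp 0 _ * flat_exp 0 _)); ring.
  exists (closed_rect a b c d); split=> //.
    by apply: compact_setX; exact: segment_compact.
  move=> x nx.
  have [h|h] := leP (x.1 - a) 0; first by rewrite (en _ _ h) !mul0r.
  have [h'|h'] := leP (b - x.1) 0; first by rewrite (en _ _ h') mulr0 mul0r.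
  have [k|k] := leP (x.2 - c) 0; first by rewrite (en _ _ k) mul0r mulr0.
  have [k'|k'] := leP (d - x.2) 0; first by rewrite (en _ _ k') !mulr0.
  exfalso; apply: nx; rewrite /closed_rect /= !in_itv /=.
  by split; apply/andP; split; lra.
- move=> n x; rewrite !mulr_ge0//=.
  by rewrite mulr_ile1 ?mulr_ge0// mulr_ile1.
- move=> x; rewrite /in_rect.
  have -> : ([&& a < x.1, x.1 < b, c < x.2 & x.2 < d])%:R =
    (0 < x.1 - a)%R%:R * (0 < b - x.1)%R%:R * ((0 < x.2 - c)%R%:R * (0 < d - x.2)%R%:R) :> R.
    by rewrite -!natrM !mulnb !subr_gt0 -!andbA.
  by apply: cvgM; apply: cvgM; exact: ec.
Qed.

Lemma pint_dominated (F : nat -> R * R -> R) f g : (forall n, pmeas (F n)) -> pmeas f ->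
  pintegrable g -> (forall n x, `|F n x| <= g x) ->
  (forall x, F n x @[n --> \oo] --> f x) -> pint (F n) @[n --> \oo] --> pint f.
Proof.
move=> mF mf gi Fg Ff.
have [] := @dominated_convergence _ _ _ mu setT measurableT
  (fun n => EFin \o F n) (EFin \o f) (EFin \o g).
- by move=> n; apply/measurable_EFinP; exact: mF.
- exact/measurable_EFinP.
- by apply: aeW => x _; apply: cvg_EFin; [exact: nearW|exact: Ff].
- exact: gi.
- by apply: aeW => x n _ /=; rewrite lee_fin.
move=> fi _; rewrite /pint /Rintegral => H.
apply: fine_cvg => /=; rewrite fineK; last exact: integrable_fin_num.
exact: H.
Qed.

Lemma pintegrable_norm f : pintegrable f -> pintegrable (fun x => `|f x|).
Proof.
move=> fi; have := integrable_norm fi.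
by apply: eq_integrable.
Qed.

Lemma pintegrable_mul1 (b : R * R -> R) f : pmeas b -> (forall x, `|b x| <= 1) ->
  pintegrable f -> pintegrable (fun x => b x * f x).
Proof.
move=> mb b1 fi; apply: le_pintegrable (pintegrable_norm fi) _.
  by apply: pmeasM => //; exact: pintegrable_meas.
by move=> x; rewrite normrM ler_piMl.
Qed.

(** Dynkin's argument for a signed integrand: the sets over which the integral vanishes form a
    lambda system. The map [u] will be either coordinate or the identity. The sequence [g] is there
    because the generating intervals are bounded, so the whole line is reached only as a monotone
    limit. *)
Lemma pi_lambda_pint d (T : measurableType d) (u : plane -> T) (G : set (set T))
    (g : nat -> set T) f :
  measurable_fun [set: plane] u -> setI_closed G -> measurable = <<s G >> ->
  (forall n, G (g n)) -> nondecreasing_seq g -> \bigcup_n g n = setT ->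
  pintegrable f -> (forall A, G A -> pint (fun x => \1_A (u x) * f x) = 0) ->
  forall A, measurable A -> pint (fun x => \1_A (u x) * f x) = 0.
Proof.
move=> mu_ GI mG gG gnd gT fi f0.
have m1 A : measurable A -> pmeas (fun x => \1_A (u x) : R).
  by move=> mA; apply: (measurableT_comp _ mu_); exact: measurable_indic.
have le1 A x : `|\1_A (u x) : R| <= 1.
  by rewrite indicE; case: (_ \in _); rewrite ?normr1 ?normr0.
have i1 A : measurable A -> pintegrable (fun x => \1_A (u x) * f x).
  by move=> mA; apply: pintegrable_mul1 => //; exact: m1.
pose H : set (set T) := [set A | measurable A /\ pint (fun x => \1_A (u x) * f x) = 0].
have limH (F : (set T)^nat) : nondecreasing_seq F -> (forall n, H (F n)) -> H (\bigcup_n F n).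
  move=> ndF HF; have mF : measurable (\bigcup_n F n).
    by apply: bigcupT_measurable => n; case: (HF n).
  split=> //.
  have : pint (fun x => \1_(F n) (u x) * f x) @[n --> \oo] -->
         pint (fun x => \1_(\bigcup_n F n) (u x) * f x).
    apply: (pint_dominated (g := fun x => `|f x|)).
    - by move=> n; apply: pintegrable_meas; apply: i1; case: (HF n).
    - by apply: pintegrable_meas; exact: i1.
    - exact: pintegrable_norm.
    - by move=> n x; rewrite normrM ler_piMl.
    - move=> x; apply: cvg_near_const.
      have [[n _ Fn]|nF] := pselect ((\bigcup_n F n) (u x)).
        exists n => // k /= nk.
        have Fk : F k (u x) by move: Fn; apply/subsetPset; exact: ndF.
        by rewrite !indicE !mem_set//; exists n.
      apply: nearW => k; rewrite !indicE !memNset// => Fk; apply: nF; by exists k.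
  rewrite (_ : (fun n => pint _) = cst 0); last by apply/funext => n; case: (HF n).
  by move=> h; rewrite -(cvg_lim _ h)// lim_cst.
have GH : G `<=` H.
  by move=> A GA; split; [rewrite mG; exact: sub_sigma_algebra|exact: f0].
have HT : H setT.
  by rewrite -gT; apply: limH => // n; exact: GH.
have lamH : lambda_system setT H.
  split=> //.
  - move=> A B BA [mA A0] [mB B0]; split; first exact: measurableD.
    have := pintB (i1 _ mA) (i1 _ mB); rewrite A0 B0 subrr => E; rewrite -[RHS]E.
    apply: eq_pint => x; rewrite !indicE in_setD -mulrBl; congr (_ * _).
    have [Bx|Bx] := boolP (u x \in B); last by rewrite andbT subr0.
    by rewrite andbF mem_set ?subrr//; apply: BA; rewrite inE in Bx.
move=> A mA; have := @lambda_system_subset T G GI setT H lamH GH (fun _ _ => @subsetT _ _) A.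
by rewrite -mG => /(_ mA) [].
Qed.

(** The vanishing is extended from intervals to measurable sets in one coordinate at a time, and
    then from product sets to all measurable sets of the plane. *)
Lemma pint_rect_ae0 f : pintegrable f ->
  (forall a b c d, pint (fun x => (in_rect a b c d x)%:R * f x) = 0) ->
  pae (fun x => f x = 0).
Proof.
move=> fi f0.
pose IT := measurableTypeR R.
pose G : set (set IT) := @ocitv R.
pose g (n : nat) : set IT := `](- n%:R), (n%:R)]%classic.
have GI : setI_closed G by exact: ocitvI.
have mG : @measurable _ IT = <<s G >> by [].
have gG n : G (g n) by exact: is_ocitv.
have gnd : nondecreasing_seq g.
  move=> m n mn; apply/subsetPset => x; rewrite /g /= !in_itv /= => /andP[h1 h2].
  have : m%:R <= n%:R :> R by rewrite ler_nat.
  by move=> h; apply/andP; split; lra.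
have gT : \bigcup_n g n = setT.
  apply/seteqP; split=> // x _; exists (Num.bound `|x|) => //=; rewrite /g /= in_itv /=.
  have := archi_boundP (normr_ge0 x); rewrite ltr_norml => /andP[h1 h2].
  by apply/andP; split; lra.
have mfst : measurable_fun [set: plane] (fst : plane -> IT) by exact: measurable_fst.
have msnd : measurable_fun [set: plane] (snd : plane -> IT) by exact: measurable_snd.
have mid : measurable_fun [set: plane] (id : plane -> plane) by exact: measurable_id.
have m1 (A : set IT) : measurable A -> pmeas (fun x => \1_A x.1 : R).
  by move=> mA; apply: (measurableT_comp _ mfst); exact: measurable_indic.
have m2 (A : set IT) : measurable A -> pmeas (fun x => \1_A x.2 : R).
  by move=> mA; apply: (measurableT_comp _ msnd); exact: measurable_indic.
have le1 (A : set IT) y : `|\1_A y : R| <= 1.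
  by rewrite indicE; case: (_ \in _); rewrite ?normr1 ?normr0.
have i2 (A : set IT) : measurable A -> pintegrable (fun x => \1_A x.2 * f x).
  by move=> mA; apply: pintegrable_mul1 => //; exact: m2.
have i1 (A : set IT) : measurable A -> pintegrable (fun x => \1_A x.1 * f x).
  by move=> mA; apply: pintegrable_mul1 => //; exact: m1.
have moc (A : set IT) : G A -> measurable A by move=> oA; rewrite mG; exact: sub_sigma_algebra.
have step0 (A B : set IT) : G A -> G B -> pint (fun x => \1_A x.1 * (\1_B x.2 * f x)) = 0.
  move=> oA oB; have mA := moc _ oA; have mB := moc _ oB.
  move: oA oB => [[a b] _ eA] [[c d] _ eB].
  (* The generating intervals are half-open while the rectangles are open; the difference lies on
     two lines. *)
  have lines : pae (fun x => x.1 - b != 0 /\ x.2 - d != 0).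
    have a1 : affine (fun x : R * R => x.1 - b) 1 0 by move=> x v /=; ring.
    have a2 : affine (fun x : R * R => x.2 - d) 0 1 by move=> x v /=; ring.
    apply: paeI; [apply: affine_ker_null a1 _|apply: affine_ker_null a2 _];
      by apply/eqP => -[]; lra.
  rewrite -[RHS](f0 a b c d); apply: ae_eq_pint.
  - by apply: pintegrable_meas; apply: pintegrable_mul1 (m1 _ mA) _ (i2 _ mB).
  - apply: pmeasM (pintegrable_meas fi); apply: pmeas_bool; exact: pmeas_box.
  apply: paeS lines => x [n1 n2]; rewrite mulrA; congr (_ * _).
  rewrite subr_eq0 in n1; rewrite subr_eq0 in n2.
  rewrite -eA -eB !indicE /in_rect -natrM mulnb; congr (_%:R).
  congr nat_of_bool; apply/andP/and4P.
    rewrite !inE /= !in_itv /= => -[/andP[h1 h2] /andP[h3 h4]].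
    by split=> //; rewrite lt_neqAle ?n1 ?n2.
  by move=> [h1 h2 h3 h4]; rewrite !inE /= !in_itv /= h1 h3 !ltW.
have step1 (A B : set IT) : measurable A -> G B -> pint (fun x => \1_A x.1 * (\1_B x.2 * f x)) = 0.
  move=> mA oB; apply: (pi_lambda_pint mfst GI mG gG gnd gT) => //.
    by apply: i2; exact: moc oB.
  by move=> C oC; exact: step0.
have step2 (A B : set IT) : measurable A -> measurable B -> pint (fun x => \1_B x.2 * (\1_A x.1 * f x)) = 0.
  move=> mA mB; apply: (pi_lambda_pint msnd GI mG gG gnd gT) => //.
    exact: i1.
  move=> C oC; rewrite -[RHS](step1 _ _ mA oC); apply: eq_pint => x.
  by rewrite mulrCA.
pose GG : set (set plane) := [set A `*` B | A in measurable & B in measurable].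
have step3 (E : set plane) : measurable E -> pint (fun x => \1_E x * f x) = 0.
  apply: (@pi_lambda_pint _ _ id GG (fun=> setT)) => //.
  - move=> _ _ [A1 mA1 [B1 mB1 <-]] [A2 mA2 [B2 mB2 <-]].
    exists (A1 `&` A2); first exact: measurableI.
    exists (B1 `&` B2); first exact: measurableI.
    by rewrite setXI.
  - exact: measurable_prod_measurableType.
  - by move=> n; exists setT => //; exists setT => //; rewrite setXTT.
  - by apply/seteqP; split=> // x _; exists 0%N.
  - move=> _ [A mA [B mB <-]]; rewrite -[RHS](step2 _ _ mA mB); apply: eq_pint => x.
    rewrite mulrA; congr (_ * _); rewrite !indicE in_setX -natrM mulnb andbC//.
have H := @integral_ae_eq _ plane R mu setT measurableT (cst 0%E) (EFin \o f) fi (measurable_cst _) _.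
have {}H : ae_eq mu setT (EFin \o f) (cst 0%E).
  apply: H => E _ mE; rewrite integral0.
  have iE := pintegrable_mul1 (pmeas_indic mE) (fun x => _ : `|\1_E x| <= 1) fi.
  have := step3 E mE; rewrite /pint /Rintegral => e0.
  rewrite integral_mkcond.
  have {}iE : pintegrable (fun x => \1_E x * f x).
    by apply: iE => x; rewrite indicE; case: (_ \in _); rewrite ?normr1 ?normr0.
  rewrite (_ : _ \_ E = (fun x => (\1_E x * f x)%:E)); last first.
    by apply/funext => x; rewrite patchE indicE; case: ifP => _ /=; rewrite ?mul1r ?mul0r.
  by rewrite -[LHS]fineK ?e0//; exact: integrable_fin_num.
by apply: paeS H => x /(_ I) /= [].
Qed.

Lemma pae_nat (A : nat -> R * R -> Prop) : (forall n, pae (A n)) -> pae (fun x => forall n, A n x).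
Proof.
move=> h; rewrite paeE (_ : ~` _ = \bigcup_n ~` A n).
  by apply: negligible_bigcup => n; exact: h.
apply/seteqP; split => x /=; first by move/existsNP => [n nA]; exists n.
by move=> [n _ nA] h'; apply: nA.
Qed.

(** Bumps give zero integral over every rectangle contained in [U], hence [f = 0] almost everywhere
    on each of them. Countably many rational rectangles cover [U], so the exceptional sets form a
    null set. *)
Lemma du_bois_reymond (U : set (R * R)) f : open U -> pintegrable f ->
  (forall phi, test_function U phi -> pint (fun x => f x * phi x) = 0) ->
  pae (fun x => U x -> f x = 0).
Proof.
move=> oU fi f0.
have rect a b c d : closed_rect a b c d `<=` U -> pint (fun x => (in_rect a b c d x)%:R * f x) = 0.
  move=> RU; have [phi [tphi phi01 phic]] := rect_bump RU.
  have mphi n : pmeas (phi n) by have [] := C1_meas (test_function_C1 (tphi n)).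
  have : pint (fun x => f x * phi n x) @[n --> \oo] --> pint (fun x => (in_rect a b c d x)%:R * f x).
    apply: (pint_dominated (g := fun x => `|f x|)).
    - by move=> n; apply: pmeasM => //; exact: pintegrable_meas.
    - by apply: pmeasM (pintegrable_meas fi); apply: pmeas_bool; exact: pmeas_box.
    - exact: pintegrable_norm.
    - move=> n x; have /andP[h1 h2] := phi01 n x.
      by rewrite normrM ler_piMr// ger0_norm.
    - by move=> x; rewrite mulrC; apply: cvgMr; exact: phic.
  rewrite (_ : (fun n => pint _) = cst 0); last by apply/funext => n; exact: f0.
  by move=> h; rewrite -(cvg_lim _ h)// lim_cst.
have locr a b c d : closed_rect a b c d `<=` U -> pae (fun x => (in_rect a b c d x)%:R * f x = 0).
  move=> RU.
  have mI : pmeas (fun x => (in_rect a b c d x)%:R : R) by apply: pmeas_bool; exact: pmeas_box.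
  apply: pint_rect_ae0.
    apply: pintegrable_mul1 => // x.
    by case: (in_rect _ _ _ _ _); rewrite ?normr1 ?normr0.
  move=> a' b' c' d'.
  have sub : closed_rect (Num.max a a') (Num.min b b') (Num.max c c') (Num.min d d') `<=` U.
    move=> x [/=]; rewrite !in_itv /= !ge_max !le_min => /andP[/andP[h1 _] /andP[h2 _]] /andP[/andP[h3 _] /andP[h4 _]].
    by apply: RU; split; rewrite /= in_itv /= ?h1 ?h2 ?h3 ?h4.
  rewrite -[RHS](rect _ _ _ _ sub); apply: eq_pint => x; rewrite mulrA; congr (_ * _).
  rewrite -natrM mulnb; congr (_%:R); congr nat_of_bool.
  rewrite /in_rect !gt_max !lt_min.
  by case: (a < x.1); case: (a' < x.1); case: (x.1 < b); case: (x.1 < b');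
     case: (c < x.2); case: (c' < x.2); case: (x.2 < d); case: (x.2 < d').
(* The rational rectangles are enumerated by [unpickle], so that the countable union of exceptional
   sets is indexed by the naturals. *)
pose Q := (rat * rat * rat * rat)%type.
pose rq (q : Q) : R * R * R * R := (ratr q.1.1.1, ratr q.1.1.2, ratr q.1.2, ratr q.2).
pose okq (q : Q) := closed_rect (rq q).1.1.1 (rq q).1.1.2 (rq q).1.2 (rq q).2 `<=` U.
have loc q : okq q -> pae (fun x => (in_rect (rq q).1.1.1 (rq q).1.1.2 (rq q).1.2 (rq q).2 x)%:R * f x = 0).
  exact: locr.
have all : pae (fun x => forall n, match @unpickle Q n with
    | Some q => okq q -> (in_rect (rq q).1.1.1 (rq q).1.1.2 (rq q).1.2 (rq q).2 x)%:R * f x = 0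
    | None => True end).
  apply: pae_nat => n; case: (unpickle n) => [q|]; last exact: paeW.
  have [ok|nok] := pselect (okq q); last by apply: paeW => x /nok.
  by apply: paeS (loc q ok) => x h _.
apply: paeS all => x H Ux.
have /nbhs_ballP[e /= e0 eU] := oU x Ux.
have /rat_in_itvoo[a] : x.1 - e < x.1 by lra.
have /rat_in_itvoo[b] : x.1 < x.1 + e by lra.
have /rat_in_itvoo[c] : x.2 - e < x.2 by lra.
have /rat_in_itvoo[d] : x.2 < x.2 + e by lra.
rewrite !in_itv /= => /andP[d1 d2] /andP[c1 c2] /andP[b1 b2] /andP[a1 a2].
have := H (pickle (a, b, c, d)); rewrite pickleK /rq /=.
rewrite /in_rect a2 b1 c2 d1 /= mul1r; apply.
rewrite /okq /rq /= => y [/=]; rewrite !in_itv /= => /andP[h1 h2] /andP[h3 h4].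
by apply: eU; split; rewrite -ball_normE /= ltr_norml; apply/andP; split; lra.
Qed.

End TestFunctions.

(** * Bisection trees *)

Section Trees.
Context {R : realType}.
Implicit Types (T K : triangle R) (L M : seq (triangle R)) (x : R * R).

Lemma le_pint_ae (f g : R * R -> R) : nice f -> nice g ->
  pae (fun x => f x <= g x) -> pint f <= pint g.
Proof.
(* [h] is the minimum of [f] and [g]: it equals [f] almost everywhere and lies below [g] at every
   point. *)
move=> nf ng fg; pose h x := f x + (g x < f x)%R%:R * (g x - f x).
have mb := pmeas_ltb (nice_meas ng) (nice_meas nf).
have nh : nice h.
  apply: niceD => //.
  have bb : locbounded (fun x => (g x < f x)%R%:R : R).
    by move=> B; exists 1 => x _; case: (_ < _); rewrite ?normr0 ?normr1.
  by have := niceM (niceB ng nf) mb bb; congr nice; apply/funext => x; rewrite mulrC.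
rewrite (_ : pint f = pint h).
  apply: le_pint; [exact: nice_pintegrable|exact: nice_pintegrable|].
  by move=> x; rewrite /h; case: (ltP (g x) (f x)) => H; rewrite ?mul1r ?mul0r; lra.
apply: ae_eq_pint; [exact: nice_meas|exact: nice_meas|].
by apply: paeS fg => x H; rewrite /h ltNge H /= mul0r addr0.
Qed.

(** Convexity of the square, with the missing weight [1 - a - b] placed at the zero vector. *)
Lemma sqn_convex (a b : R) (u v : R * R) : 0 <= a -> 0 <= b -> a + b <= 1 ->
  sqn (a *: u + b *: v) <= a * sqn u + b * sqn v.
Proof.
move=> a0 b0 ab.
have H (s t : R) : (a * s + b * t) ^+ 2 <= a * s ^+ 2 + b * t ^+ 2.
  have h1 : 0 <= a * b * (s - t) ^+ 2 by rewrite mulr_ge0 ?sqr_ge0// mulr_ge0.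
  have h2 : 0 <= a * (1 - a - b) * s ^+ 2 by rewrite mulr_ge0 ?sqr_ge0// mulr_ge0//; lra.
  have h3 : 0 <= b * (1 - a - b) * t ^+ 2 by rewrite mulr_ge0 ?sqr_ge0// mulr_ge0//; lra.
  rewrite -subr_ge0 (_ : _ - _ = a * b * (s - t) ^+ 2 + a * (1 - a - b) * s ^+ 2 +
    b * (1 - a - b) * t ^+ 2); [by rewrite !addr_ge0|by ring].
have := H u.1 v.1; have := H u.2 v.2; rewrite /sqn /= /GRing.scale /=; lra.
Qed.

Lemma simplex_abs (w u v : R) : w + u + v = 1 -> (`|u - v| + w < 1) = (0 < u) && (0 < v).
Proof.
move=> s; rewrite -ltrBrDr ltr_norml; apply/andP/andP => -[h1 h2]; split; lra.
Qed.

Lemma simplex_half (w u v : R) : w + u + v = 1 -> v < u -> w + 2 * v <= 1.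
Proof. by move=> s lt; lra. Qed.

Lemma weighted_sides_le (w v X Y Z : R) : 0 <= w -> 0 <= v -> w + v <= 1 ->
  0 <= X -> 0 <= Y -> 0 <= Z -> w * X + v * (1 / 4 * Y) <= 2^-1 * Y + X + Z.
Proof.
move=> w0 v0 wv X0 Y0 Z0.
have : w * X <= X by rewrite ler_piMl//; lra.
have : v * (1 / 4 * Y) <= 1 / 4 * Y by rewrite ler_piMl//; lra.
lra.
Qed.

(** The roof coordinates are [y = lam1 - lam2] and [z = lam0]. On each child the field is a
    combination, with weights of sum at most 1, of a side at [v0] and half of the refinement edge,
    so its square is at most [tsize T]; the squared divergence is 4, whence the factor 1/4. *)
Lemma triangle_haar T : Defs.nondegenerate T -> exists t d,
  [/\ weakdiv t d, forall x, ~~ open_tri T x -> t x = 0 /\ d x = 0,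
      forall x, open_tri (child1 T) x -> t x = x - T.1.2 /\ d x = 2,
      forall x, open_tri (child2 T) x -> t x = T.2 - x /\ d x = - 2 &
      pint (fun x => sqn (t x)) <= tsize T / 4 * pint (fun x => d x ^+ 2)].
Proof.
move=> nd.
pose m : R * R := 2^-1 *: (T.1.2 + T.2).
pose a := T.1.2 - m; pose b := T.1.1 - m.
pose y x := lam1 T x - lam2 T x; pose z := lam0 T.
have ay : affine y ((T.2.2 - T.1.1.2) / tdet T - - (T.1.2.2 - T.1.1.2) / tdet T)
    (- (T.2.1 - T.1.1.1) / tdet T - (T.1.2.1 - T.1.1.1) / tdet T).
  by move=> x v; rewrite /y affine_lam1 affine_lam2; ring.
have az := affine_lam0 T; rewrite -/z in az.
have [v00 v01 v02] : [/\ lam0 T T.1.1 = 1, lam1 T T.1.1 = 0 & lam2 T T.1.1 = 0].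
  have := @lam_bary R T nd 1 0 0 (etrans (addr0 _) (addr0 _)).
  by rewrite /= !mul0r !mul1r !addr0 -!surjective_pairing.
have [v10 v11 v12] : [/\ lam0 T T.1.2 = 0, lam1 T T.1.2 = 1 & lam2 T T.1.2 = 0].
  have := @lam_bary R T nd 0 1 0 (etrans (addr0 _) (add0r _)).
  by rewrite /= !mul0r !mul1r !add0r !addr0 -!surjective_pairing.
have [m0 m1 m2] : [/\ lam0 T m = 0, lam1 T m = 2^-1 & lam2 T m = 2^-1].
  have h : 0 + 2^-1 + 2^-1 = 1 :> R by field.
  have := lam_bary nd h; rewrite /= !mul0r !add0r -!mulrDr.
  by rewrite (_ : (_, _) = m)// [RHS]surjective_pairing.
have dir (l : R * R -> R) c1 c2 p q : affine l c1 c2 ->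
    c1 * (q - p).1 + c2 * (q - p).2 = l q - l p.
  by move=> al; rewrite -[in RHS](subrK p q) [q - p + p]addrC al addrAC subrr add0r.
have ya := dir _ _ _ m T.1.2 ay; have yb := dir _ _ _ m T.1.1 ay.
have za := dir _ _ _ m T.1.2 az; have zb := dir _ _ _ m T.1.1 az.
rewrite /y /z v00 v01 v02 v10 v11 v12 m0 m1 m2 in ya yb za zb.
rewrite ?subr0 ?subrr ?subr0 in ya yb za zb.
have coords x : x = m + y x *: a + z x *: b.
  rewrite [LHS](bary_coords nd) /a /b /m /y /z /lam0.
  rewrite [LHS]surjective_pairing [RHS]surjective_pairing /= /GRing.scale /=.
  by congr (_, _); field.
have SE x : (0 < z x) && (`|y x| + z x < 1) = open_tri T x.
  rewrite /open_tri -/(z x); case: (ltP 0 (z x)) => //= z0.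
  exact: simplex_abs (lam_sum T x).
have bd x : (0 < z x) && (`|y x| + z x < 1) -> box (tri_bound T) x.
  by rewrite SE => /(open_tri_box nd).
have ym : y m = 0 by rewrite /y m1 m2 subrr.
have W := haar_weakdiv ay az ya yb za zb coords ym m0 bd.
set t := (fun x : R * R => _ *: _) in W; set d := (fun x => _ * (2 * _)) in W.
have t0 x : ~~ open_tri T x -> t x = 0 /\ d x = 0.
  by rewrite /t /d SE => /negbTE ->; rewrite scale0r mul0r.
have t1 x : open_tri (child1 T) x -> t x = x - T.1.2 /\ d x = 2.
  rewrite open_tri_child1// => /andP[Tx lt]; rewrite /t /d SE Tx scale1r mul1r.
  have y0 : 0 < y x by rewrite subr_gt0.
  rewrite y0 (lt_gtF y0) subr0 !mulr1 (gtr0_norm y0); split=> //.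
  rewrite {3}(coords x) [LHS]surjective_pairing [RHS]surjective_pairing /= /GRing.scale /=.
  by rewrite /a /=; congr (_, _); ring.
have t2 x : open_tri (child2 T) x -> t x = T.2 - x /\ d x = - 2.
  rewrite open_tri_child2// => /andP[Tx lt]; rewrite /t /d SE Tx scale1r mul1r.
  have y0 : y x < 0 by rewrite subr_lt0.
  rewrite y0 (lt_gtF y0) sub0r !mulrN1 (ltr0_norm y0); split=> //.
  have -> : T.2 = m - a by rewrite /a /m [LHS]surjective_pairing [RHS]surjective_pairing /=
    /GRing.scale /=; congr (_, _); field.
  rewrite {3}(coords x) [LHS]surjective_pairing [RHS]surjective_pairing /= /GRing.scale /=.
  by congr (_, _); ring.
exists t, d; split=> //.
have [n1 n2 n3 _] := W.
have nsq : nice (fun x => sqn (t x)) by apply: niceD; [exact: (niceMM n1 n1)|exact: (niceMM n2 n2)].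
have nd2 : nice (fun x => d x ^+ 2) by exact: niceMM.
rewrite -pintZ; last exact: nice_pintegrable.
apply: le_pint_ae => //; first exact: niceZ.
apply: paeS (lam1_neq_lam2_ae nd) => x ne.
have [Tx|/t0[-> ->]] := boolP (open_tri T x); last first.
  by rewrite /sqn /= expr0n addr0 mulr0.
have /and3P[h0 h1 h2] := Tx; have s := lam_sum T x.
have q1 := sqn_ge0 (T.1.2 - T.2); have q2 := sqn_ge0 (T.1.2 - T.1.1).
have q3 := sqn_ge0 (T.2 - T.1.1).
have E4 : tsize T / 4 * 2 ^+ 2 = tsize T by field.
have [lt|ge] := ltP (lam2 T x) (lam1 T x).
  have [-> ->] : t x = x - T.1.2 /\ d x = 2 by apply: t1; rewrite open_tri_child1// Tx.
  rewrite E4.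
  have -> : x - T.1.2 = lam0 T x *: (T.1.1 - T.1.2) + (2 * lam2 T x) *: (2^-1 *: (T.2 - T.1.2)).
    rewrite {1}(bary_coords nd x) /lam0 [LHS]surjective_pairing [RHS]surjective_pairing /= /GRing.scale /=.
    by rewrite /GRing.scale /=; congr (_, _); field.
  have w0 := ltW h0; have v0 : 0 <= 2 * lam2 T x by rewrite mulr_ge0// ltW.
  have wv := simplex_half s lt.
  apply: le_trans (sqn_convex _ _ w0 v0 wv) _.
  have -> : sqn (2^-1 *: (T.2 - T.1.2)) = 1 / 4 * sqn (T.1.2 - T.2).
    by rewrite /sqn /= /GRing.scale /=; field.
  have -> : sqn (T.1.1 - T.1.2) = sqn (T.1.2 - T.1.1) by rewrite /sqn /=; ring.
  exact: weighted_sides_le.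
have {ge}lt : lam1 T x < lam2 T x by rewrite lt_neqAle ne ge.
have [-> ->] : t x = T.2 - x /\ d x = - 2 by apply: t2; rewrite open_tri_child2// Tx.
rewrite sqrrN E4.
have -> : T.2 - x = lam0 T x *: (T.2 - T.1.1) + (2 * lam1 T x) *: (2^-1 *: (T.2 - T.1.2)).
  rewrite {1}(bary_coords nd x) /lam0 [LHS]surjective_pairing [RHS]surjective_pairing /= /GRing.scale /=.
  by rewrite /GRing.scale /=; congr (_, _); field.
have w0 := ltW h0; have v0 : 0 <= 2 * lam1 T x by rewrite mulr_ge0// ltW.
have wv := simplex_half (etrans (addrAC _ _ _) s) lt.
apply: le_trans (sqn_convex _ _ w0 v0 wv) _.
have -> : sqn (2^-1 *: (T.2 - T.1.2)) = 1 / 4 * sqn (T.1.2 - T.2).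
  by rewrite /sqn /= /GRing.scale /=; field.
by rewrite /tsize addrAC; exact: weighted_sides_le.
Qed.

(** A refinement records bisections in the order in which they are performed. Regrouped as a tree
    below each coarse triangle, the same data admit structural induction from the leaves to the
    root. *)
Inductive bisection_tree : triangle R -> seq (triangle R) -> Prop :=
| bisection_leaf T : bisection_tree T [:: T]
| bisection_node T L1 L2 : bisection_tree (child1 T) L1 -> bisection_tree (child2 T) L2 ->
    bisection_tree T (L1 ++ L2).

Lemma cat_eq_split (X : Type) (L1 L2 M1 M2 : seq X) (K : X) : L1 ++ L2 = M1 ++ K :: M2 ->
  (exists2 M, L1 = M1 ++ K :: M & M2 = M ++ L2) \/
  (exists2 M, M1 = L1 ++ M & L2 = M ++ K :: M2).
Proof.
elim: L1 M1 => [|a L1 IH] [|c M1] /=.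
- by move=> ->; right; exists [::].
- by move=> ->; right; exists (c :: M1).
- by move=> [-> <-]; left; exists L1.
- by move=> [-> /IH[[M -> ->]|[M -> ->]]]; [left|right]; exists M.
Qed.

Lemma bisection_tree_split T L : bisection_tree T L -> forall M1 K M2, L = M1 ++ K :: M2 ->
  bisection_tree T (M1 ++ child1 K :: child2 K :: M2).
Proof.
elim=> {T L} [T [|c [|c' M1]] K M2 //= [-> <-]|T L1 L2 b1 IH1 b2 IH2 M1 K M2].
  by apply: (@bisection_node _ [:: _] [:: _]); exact: bisection_leaf.
move=> /(@cat_eq_split _ _ _ _ _ _) [[M e1 ->]|[M -> e2]].
  by have := bisection_node (IH1 _ _ _ e1) b2; rewrite -catA.
by have := bisection_node b1 (IH2 _ _ _ e2); rewrite catA.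
Qed.

Inductive bisection_forest : seq (triangle R) -> seq (triangle R) -> Prop :=
| forest_nil : bisection_forest [::] [::]
| forest_cons T L M M' : bisection_tree T L -> bisection_forest M M' ->
    bisection_forest (T :: M) (L ++ M').

Lemma nvb_forest M M' : nvb_refinement M M' -> bisection_forest M M'.
Proof.
elim=> [|M1 T M2 _].
  elim: M => [|T M IH]; first exact: forest_nil.
  by apply: (@forest_cons T [:: T]) => //; exact: bisection_leaf.
move E: (M1 ++ T :: M2) => N F; elim: F M1 T M2 E => {M N} [[]//|K L M N b F IH M1 T M2].
move=> /esym /(@cat_eq_split _ _ _ _ _ _) [[N' e1 ->]|[N' -> e2]].
  have := forest_cons (bisection_tree_split b e1) F.
  by rewrite -catA.
by have := forest_cons b (IH _ _ _ (esym e2)); rewrite catA.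
Qed.

(** As the coarse mesh has no repetition, the list of leaves can be given as a function of the
    coarse triangle. *)
Lemma forest_leaves M M' : bisection_forest M M' -> uniq M -> exists Lf,
  (forall T, T \in M -> bisection_tree T (Lf T) /\ {subset Lf T <= M'}) /\
  (forall K, K \in M' -> exists2 T, T \in M & K \in Lf T).
Proof.
elim=> {M M'} [_|T L M M' b _ IH /= /andP[TM /IH[Lf [h1 h2]]]]; first by exists (fun=> [::]).
exists (fun K => if K == T then L else Lf K); split.
  move=> K; rewrite inE; case: eqVneq => [-> _|_ /= /h1[bK sK]]; split=> // J JK.
    by rewrite mem_cat JK.
  by rewrite mem_cat (sK J JK) orbT.
move=> K; rewrite mem_cat => /orP[KL|/h2[S SM KS]].
  by exists T; rewrite ?mem_head// eqxx.
exists S; first by rewrite inE SM orbT.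
by case: eqVneq => // e; rewrite -e SM in TM.
Qed.

Lemma bisection_tree_sub T L : bisection_tree T L -> Defs.nondegenerate T ->
  forall K, K \in L -> Defs.nondegenerate K /\ forall x, open_tri K x -> open_tri T x.
Proof.
elim=> {T L} [T nd K|T L1 L2 _ IH1 _ IH2 nd K].
  by rewrite inE => /eqP ->.
have [nd1 nd2] := nondegenerate_children nd.
rewrite mem_cat => /orP[/(IH1 nd1)[ndK h]|/(IH2 nd2)[ndK h]]; split=> // x /h.
  by rewrite open_tri_child1// => /andP[].
by rewrite open_tri_child2// => /andP[].
Qed.

(** * Local shape functions and induction along the bisection tree *)

Section LocalFields.
Variables (F : mixed_family) (p : nat).
Hypothesis Fp : valid_order F p.

Lemma local_fieldD s t : @local_field R F p s -> local_field F p t ->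
  local_field F p (fun x => s x + t x).
Proof.
case: F => /= [[q1 [q2 [r [P1 P2 P3 e]]]] [q1' [q2' [r' [P1' P2' P3' e']]]]|
  [q1 [q2 [P1 P2 e]]] [q1' [q2' [P1' P2' e']]]].
  exists (fun x => q1 x + q1' x), (fun x => q2 x + q2' x), (fun x => r x + r' x).
  split; try exact: Poly2D.
  by move=> x; rewrite e e' [LHS]surjective_pairing /=; congr (_, _); ring.
exists (fun x => q1 x + q1' x), (fun x => q2 x + q2' x).
by split; try exact: Poly2D; move=> x; rewrite e e'.
Qed.

Lemma local_fieldZ (a : R) s : local_field F p s -> local_field F p (fun x => a *: s x).
Proof.
case: F => /= [[q1 [q2 [r [P1 P2 P3 e]]]]|[q1 [q2 [P1 P2 e]]]].
  exists (fun x => a * q1 x), (fun x => a * q2 x), (fun x => a * r x).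
  split; try exact: Poly2Z.
  by move=> x; rewrite e [LHS]surjective_pairing /= /GRing.scale /=; congr (_, _); ring.
exists (fun x => a * q1 x), (fun x => a * q2 x).
by split; try exact: Poly2Z; move=> x; rewrite e.
Qed.

(** The Haar fields are radial, so they already belong to the lowest order space of either family; a
    common correction therefore serves every order. *)
Lemma local_field_radial (v : R * R) : local_field F p (fun x => x - v).
Proof.
case: F Fp => /= [_|p1].
  exists (fun=> - v.1), (fun=> - v.2), (fun=> 1); split; try exact: Poly2_cst.
  by move=> x; rewrite !mulr1 [LHS]surjective_pairing /=; congr (_, _); ring.
exists (fun x => x.1 - v.1), (fun x => x.2 - v.2); split.
- exact: Poly2W p1 (Poly2B Poly2_fst (Poly2_cst 1 _)).
- exact: Poly2W p1 (Poly2B Poly2_snd (Poly2_cst 1 _)).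
- by move=> x; rewrite [LHS]surjective_pairing.
Qed.

(* Haar decomposition along the bisection tree.  The factor [5/6] gained by
   [tsize] at each bisection lets the error constant [3/2] survive the induction:
   [|u + v|^2 <= 6/5 |u|^2 + 6 |v|^2], [6/5 * 3/2 * 5/6 = 3/2], [6 * 1/4 = 3/2]. *)
Lemma tree_right_inverse T L : bisection_tree T L -> Defs.nondegenerate T ->
  forall g : R * R -> R,
  (forall K, K \in L -> exists2 q, Poly2 (scalar_degree F p) q &
     pae (fun x => open_tri K x -> g x = q x)) ->
  exists t d c, [/\ weakdiv t d, forall x, ~~ open_tri T x -> t x = 0 /\ d x = 0,
    pae (fun x => open_tri T x -> d x = g x - c),
    forall K, K \in L -> exists2 q, local_field F p q &
       pae (fun x => open_tri K x -> t x = q x) &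
    pint (fun x => sqn (t x)) <= 3 / 2 * tsize T * pint (fun x => d x ^+ 2)].
Proof.
elim=> {T L} [T nd g gq|T L1 L2 b1 IH1 b2 IH2 nd g gq].
  have [q Pq qE] := gq T (mem_head _ _).
  have [t [d [c [W t0 dq [tau lt tt] le]]]] := leaf_right_inverse nd Fp Pq.
  exists t, d, c; split=> //.
    by apply: paeS qE => x h Tx; rewrite dq// h.
  move=> K; rewrite inE => /eqP ->; exists tau => //.
  by apply: paeW => x Tx; exact: tt.
have [nd1 nd2] := nondegenerate_children nd.
have [|t1 [d1 [c1 [W1 z1 e1 l1 le1]]]] := IH1 nd1 g.
  by move=> K KL; apply: gq; rewrite mem_cat KL.
have [|t2 [d2 [c2 [W2 z2 e2 l2 le2]]]] := IH2 nd2 g.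
  by move=> K KL; apply: gq; rewrite mem_cat KL orbT.
have [tS [dS [WS zS hS1 hS2 leS]]] := triangle_haar nd.
(* The Haar divergence is [2] and [- 2] on the children. This multiple makes [c1 - 2 al] and
   [c2 + 2 al] equal, so that both children share one constant. *)
pose al : R := (c1 - c2) / 4.
have W := weakdivD (weakdivD W1 W2) (weakdivZ al WS).
have dis x : open_tri (child1 T) x -> ~~ open_tri (child2 T) x.
  by rewrite open_tri_child1// open_tri_child2// => /andP[-> h]; rewrite (lt_gtF h).
have dis' x : open_tri (child2 T) x -> ~~ open_tri (child1 T) x.
  by apply: contraL => /dis.
have cov : pae (fun x => open_tri T x -> open_tri (child1 T) x \/ open_tri (child2 T) x).
  apply: paeS (lam1_neq_lam2_ae nd) => x ne Tx.
  rewrite open_tri_child1// open_tri_child2// Tx /=.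
  by case: (ltgtP (lam1 T x) (lam2 T x)) ne => //; [right|left].
have sub1 x : ~~ open_tri T x -> ~~ open_tri (child1 T) x.
  by apply: contra; rewrite open_tri_child1// => /andP[].
have sub2 x : ~~ open_tri T x -> ~~ open_tri (child2 T) x.
  by apply: contra; rewrite open_tri_child2// => /andP[].
do 2 eexists; exists (c1 - 2 * al); split; first exact: W.
- move=> x Tx; have [-> ->] := z1 x (sub1 x Tx); have [-> ->] := z2 x (sub2 x Tx).
  by have [-> ->] := zS x Tx; rewrite scaler0 mulr0 !addr0.
- apply: paeS (paeI cov (paeI e1 e2)) => x [cx [h1 h2]] /cx[Tx|Tx].
    have [_ ->] := z2 x (dis _ Tx); have [_ ->] := hS1 x Tx.
    by rewrite h1// /al; field.
  have [_ ->] := z1 x (dis' _ Tx); have [_ ->] := hS2 x Tx.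
  by rewrite h2// /al; field.
- move=> K; rewrite mem_cat => /orP[KL|KL].
    have [q lq qE] := l1 K KL; have [_ sK] := bisection_tree_sub b1 nd1 KL.
    exists (fun x => q x + al *: (x - T.1.2)).
      exact: local_fieldD lq (local_fieldZ al (local_field_radial _)).
    apply: paeS qE => x qx Kx; have Tx := sK x Kx.
    by rewrite qx//; have [-> _] := z2 x (dis _ Tx); have [-> _] := hS1 x Tx; rewrite addr0.
  have [q lq qE] := l2 K KL; have [_ sK] := bisection_tree_sub b2 nd2 KL.
  exists (fun x => q x + - al *: (x - T.2)).
    exact: local_fieldD lq (local_fieldZ _ (local_field_radial _)).
  apply: paeS qE => x qx Kx; have Tx := sK x Kx.
  rewrite qx//; have [-> _] := z1 x (dis' _ Tx); have [-> _] := hS2 x Tx.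
  by rewrite add0r scaleNr -scalerN opprB.
have [n11 n12 n13 _] := W1; have [n21 n22 n23 _] := W2; have [nS1 nS2 nS3 _] := WS.
have [n1 n2 n3 _] := W.
have sq (t : R * R -> R * R) : nice (fun x => (t x).1) -> nice (fun x => (t x).2) ->
    nice (fun x => sqn (t x)).
  by move=> h1 h2; apply: niceD; [exact: (niceMM h1 h1)|exact: (niceMM h2 h2)].
have sqd (d : R * R -> R) : nice d -> nice (fun x => d x ^+ 2) by move=> h; exact: niceMM.
have ip (f : R * R -> R) (nf : nice f) : pintegrable f := nice_pintegrable nf.
(* Orthogonality of the levels: [dS] is constant on each child and [d1], [d2] have mean zero, so the
   cross term [4 al (d1 - d2)] has integral zero. *)
have dE : pint (fun x => (d1 x + d2 x + al * dS x) ^+ 2) =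
    pint (fun x => d1 x ^+ 2) + pint (fun x => d2 x ^+ 2) + al ^+ 2 * pint (fun x => dS x ^+ 2).
  have Z1 := pint_weakdiv W1; have Z2 := pint_weakdiv W2.
  have A1 := pintD (ip _ (sqd _ n13)) (ip _ (sqd _ n23)).
  have A2 := pintZ (al ^+ 2) (ip _ (sqd _ nS3)).
  have A3 := pintD (ip _ (niceD (sqd _ n13) (sqd _ n23))) (ip _ (niceZ (al ^+ 2) (sqd _ nS3))).
  have A4 := pintB (ip _ (niceZ (4 * al) n13)) (ip _ (niceZ (4 * al) n23)).
  rewrite !pintZ ?Z1 ?Z2 ?mulr0 ?subr0 in A4; [|exact: ip|exact: ip].
  have A5 := pintD (ip _ (niceD (niceD (sqd _ n13) (sqd _ n23)) (niceZ (al ^+ 2) (sqd _ nS3))))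
    (ip _ (niceB (niceZ (4 * al) n13) (niceZ (4 * al) n23))).
  rewrite A4 A3 A2 A1 addr0 in A5; rewrite -A5; apply: eq_pint => x.
  have [T1|T1] := boolP (open_tri (child1 T) x).
    have [_ ->] := z2 x (dis _ T1); have [_ ->] := hS1 x T1; ring.
  have [_ ->] := z1 x T1.
  have [T2|T2] := boolP (open_tri (child2 T) x).
    have [_ ->] := hS2 x T2; ring.
  have [_ ->] := z2 x T2; ring.
rewrite dE.
have B1 := pintD (ip _ (sq _ n11 n12)) (ip _ (sq _ n21 n22)).
have B2 := pintZ (6 / 5) (ip _ (niceD (sq _ n11 n12) (sq _ n21 n22))).
have B3 := pintZ (6 * al ^+ 2) (ip _ (sq _ nS1 nS2)).
have B4 := pintD (ip _ (niceZ (6 / 5) (niceD (sq _ n11 n12) (sq _ n21 n22))))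
  (ip _ (niceZ (6 * al ^+ 2) (sq _ nS1 nS2))).
rewrite B2 B3 B1 in B4.
apply: (@le_trans _ _ (6 / 5 * (pint (fun x => sqn (t1 x)) + pint (fun x => sqn (t2 x))) +
   6 * al ^+ 2 * pint (fun x => sqn (tS x)))).
  rewrite -B4; apply: le_pint; [exact/ip/sq| |].
    by apply: ip; apply: niceD; apply: niceZ; [apply: niceD|]; exact: sq.
  move=> x.
  (* Young's inequality: the difference of the two sides is a fifth of [sqn (u - (5 * al) *: v)]. *)
  have H (u v : R * R) : sqn (u + al *: v) <= 6 / 5 * sqn u + 6 * al ^+ 2 * sqn v.
    have := sqn_ge0 (u - (5 * al) *: v); rewrite /sqn /= /GRing.scale /=; nra.
  have [T1|T1] := boolP (open_tri (child1 T) x).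
    have [-> _] := z2 x (dis _ T1); rewrite addr0 (le_trans (H _ _))//.
    by rewrite lerD2r ler_wpM2l ?lerDl ?sqn_ge0//; lra.
  have [-> _] := z1 x T1; rewrite add0r (le_trans (H _ _))//.
  by rewrite lerD2r ler_wpM2l ?lerDr ?sqn_ge0//; lra.
have Q0 := tsize_ge0 T; have q1 := tsize_child1 T; have q2 := tsize_child2 T.
have p1 : 0 <= pint (fun x => d1 x ^+ 2) by apply: pint_ge0 => x; rewrite sqr_ge0.
have p2 : 0 <= pint (fun x => d2 x ^+ 2) by apply: pint_ge0 => x; rewrite sqr_ge0.
have k1 : pint (fun x => sqn (t1 x)) <= 5 / 4 * (tsize T * pint (fun x => d1 x ^+ 2)).
  apply: le_trans le1 _; rewrite !mulrA ler_wpM2r//; lra.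
have k2 : pint (fun x => sqn (t2 x)) <= 5 / 4 * (tsize T * pint (fun x => d2 x ^+ 2)).
  apply: le_trans le2 _; rewrite !mulrA ler_wpM2r//; lra.
have k3 : al ^+ 2 * pint (fun x => sqn (tS x)) <= al ^+ 2 * (tsize T / 4 * pint (fun x => dS x ^+ 2)).
  by rewrite ler_wpM2l// sqr_ge0.
move: k1 k2 k3; move: (pint _) (pint _) (pint _) (pint _) (pint _) (pint _) (tsize T) => IS JS J2 I2 J1 I1 Q.
move: (al ^+ 2) => a2 k1 k2 k3.
rewrite (_ : 6 * a2 * JS = 6 * (a2 * JS)); last by ring.
rewrite (_ : 3 / 2 * Q * _ = 3 / 2 * (Q * J1) + 3 / 2 * (Q * J2) + 6 * (a2 * (Q / 4 * IS))); last by field.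
lra.
Qed.

End LocalFields.
End Trees.

(** * Square integrable fields and finite element spaces *)

Section SquareIntegrable.
Context {R : realType}.
Implicit Types (f g : R * R -> R) (s t : R * R -> R * R) (D : set (R * R)) (x : R * R).

Lemma patch_in D f x : D x -> (f \_ D) x = f x.
Proof. by move=> Dx; rewrite patchE mem_set. Qed.

Lemma patch_notin D f x : ~ D x -> (f \_ D) x = 0.
Proof. by move=> Dx; rewrite patchE memNset. Qed.

Lemma patchM D f g x : ((fun y => f y * g y) \_ D) x = (f \_ D) x * (g \_ D) x.
Proof. by rewrite !patchE; case: ifP => // _; rewrite /point /= mulr0. Qed.

Lemma patchD D f g x : ((fun y => f y + g y) \_ D) x = (f \_ D) x + (g \_ D) x.
Proof. by rewrite !patchE; case: ifP => // _; rewrite /point /= addr0. Qed.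

Lemma patchB D f g x : ((fun y => f y - g y) \_ D) x = (f \_ D) x - (g \_ D) x.
Proof. by rewrite !patchE; case: ifP => // _; rewrite /point /= subr0. Qed.

Lemma L2E D f : L2 D f <-> pmeas (f \_ D) /\ pintegrable (fun x => (f \_ D) x ^+ 2).
Proof.
split=> [h|[mf h]].
  by split; [move: h; rewrite /L2 inE => /andP[]; rewrite inE|exact: Lfun2_integrable_sqr].
rewrite /L2 inE; apply/andP; split; rewrite inE//= /finite_norm unlock /=.
apply: poweR_lty; move/integrableP : h => [_]; apply: le_lt_trans.
rewrite le_eqVlt; apply/orP; left; apply/eqP; apply: eq_integral => x _ /=.
by rewrite normrX powR_mulrn.
Qed.

Lemma L2_meas D f : L2 D f -> pmeas (f \_ D).
Proof. by move=> /L2E[]. Qed.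

Lemma L2M D f g : L2 D f -> L2 D g -> pintegrable (fun x => (f \_ D) x * (g \_ D) x).
Proof. by move=> h k; apply/Lfun1_integrable; exact: Lfun2_mul_Lfun1 h k. Qed.

Lemma L2D D f g : L2 D f -> L2 D g -> L2 D (fun x => f x + g x).
Proof.
move=> h k; have [mf f2] := L2E D f; have [mf1 if1] := mf h; have [mg1 ig1] := (L2E D g).1 k.
apply/L2E; rewrite (_ : (fun x => f x + g x) \_ D = (fun x => (f \_ D) x + (g \_ D) x)); last first.
  by apply/funext => x; rewrite patchD.
split; first exact: pmeasD.
have := pintegrableD (pintegrableD if1 ig1) (pintegrableZ 2 (L2M h k)).
by congr pintegrable; apply/funext => x; ring.
Qed.

Lemma L2Z D a f : L2 D f -> L2 D (fun x => a * f x).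
Proof.
move=> /L2E[m1 i1]; apply/L2E.
rewrite (_ : _ \_ D = (fun x => a * (f \_ D) x)); last first.
  by apply/funext => x; rewrite !patchE; case: ifP => // _; rewrite /point /= mulr0.
split; first by apply: pmeasM => //; exact: pmeas_cst.
have := pintegrableZ (a ^+ 2) i1.
by congr pintegrable; apply/funext => x; ring.
Qed.

Lemma L2B D f g : L2 D f -> L2 D g -> L2 D (fun x => f x - g x).
Proof.
move=> h k; have := L2D h (L2Z (-1) k); congr L2.
by apply/funext => x; rewrite mulN1r.
Qed.

Lemma nice_L2 D f : nice (f \_ D) -> L2 D f.
Proof.
move=> nf; apply/L2E; split; first exact: nice_meas.
have := nice_pintegrable (niceMM nf nf).
by congr pintegrable; apply/funext => x; rewrite expr2.
Qed.

Lemma patch_id D f : (forall x, f x != 0 -> D x) -> f \_ D = f.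
Proof.
move=> h; apply/funext => x; rewrite patchE; case: ifPn => // nD.
by apply/esym/eqP/contraT => /h Dx; rewrite notin_setE in nD.
Qed.

Lemma innerE D f g : inner D f g = pint (fun x => (f \_ D) x * (g \_ D) x).
Proof.
rewrite /inner Rintegral_mkcond; apply: eq_pint => x; exact: patchM.
Qed.

Lemma innerBl D f g h : L2 D f -> L2 D g -> L2 D h ->
  inner D (f \- g) h = inner D f h - inner D g h.
Proof.
move=> lf lg lh; rewrite !innerE -pintB; try exact: L2M.
by apply: eq_pint => x; rewrite patchB mulrBl.
Qed.

Lemma inner_ae D f f' g : L2 D f -> L2 D f' -> L2 D g ->
  pae (fun x => D x -> f x = f' x) -> inner D f g = inner D f' g.
Proof.
move=> lf lf' lg e; rewrite !innerE; apply: ae_eq_pint.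
- by apply: pmeasM; exact: L2_meas.
- by apply: pmeasM; exact: L2_meas.
apply: paeS e => x h.
by have [Dx|Dx] := pselect (D x); [rewrite !(patch_in _ Dx) h|rewrite !(patch_notin _ Dx)].
Qed.

Lemma inner_eq0_ae D f : L2 D f -> inner D f f = 0 -> pae (fun x => D x -> f x = 0).
Proof.
move=> lf; rewrite innerE => f0.
have := pint_eq0_ae (L2M lf lf) (fun x => sqr_ge0 _ : 0 <= (f \_ D) x * (f \_ D) x) f0.
apply: paeS => x /eqP; rewrite mulf_eq0 orbb => /eqP + Dx.
by rewrite patch_in.
Qed.

Lemma vinnerE D s t : vL2 D s -> vL2 D t -> vinner D s t =
  inner D (fun x => (s x).1) (fun x => (t x).1) + inner D (fun x => (s x).2) (fun x => (t x).2).
Proof.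
move=> [s1 s2] [t1 t2]; rewrite !innerE -pintD; try exact: L2M.
by rewrite /vinner Rintegral_mkcond; apply: eq_pint => x; rewrite patchD !patchM.
Qed.

Lemma vL2B D s t : vL2 D s -> vL2 D t -> vL2 D (s \- t).
Proof. by move=> [s1 s2] [t1 t2]; split; exact: L2B. Qed.

Lemma vinnerC D s t : vinner D s t = vinner D t s.
Proof.
by rewrite /vinner; congr (Rintegral _ _ _); apply/funext => x; rewrite mulrC [X in _ + X]mulrC.
Qed.

Lemma vinnerBl D s t r : vL2 D s -> vL2 D t -> vL2 D r ->
  vinner D (s \- t) r = vinner D s r - vinner D t r.
Proof.
move=> ls lt lr; have lst := vL2B ls lt; rewrite !vinnerE//.
have [s1 s2] := ls; have [t1 t2] := lt; have [r1 r2] := lr.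
rewrite (_ : (fun x => ((s \- t) x).1) = (fun x => (s x).1) \- (fun x => (t x).1))//.
rewrite (_ : (fun x => ((s \- t) x).2) = (fun x => (s x).2) \- (fun x => (t x).2))//.
by rewrite !innerBl//; ring.
Qed.

Lemma vinnerBr D s t r : vL2 D s -> vL2 D t -> vL2 D r ->
  vinner D r (s \- t) = vinner D r s - vinner D r t.
Proof. by move=> ls lt lr; rewrite vinnerC vinnerBl// !(vinnerC _ r). Qed.

Lemma vinner_ge0 D s : 0 <= vinner D s s.
Proof.
rewrite /vinner Rintegral_mkcond; apply: pint_ge0 => x; rewrite patchE.
by case: ifP => //= _; rewrite addr_ge0// -expr2 sqr_ge0.
Qed.

Lemma vinnerZr D a s t : vL2 D s -> vL2 D t ->
  vinner D s (fun x => a *: t x) = a * vinner D s t.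
Proof.
move=> ls lt; have lat : vL2 D (fun x => a *: t x).
  by case: lt => t1 t2; split; exact: L2Z.
have [s1 s2] := ls; have [t1 t2] := lt.
rewrite !vinnerE// mulrDr !innerE -!pintZ; try exact: L2M.
congr (_ + _); apply: eq_pint => x; rewrite !patchE; case: ifP => _ /=; rewrite ?mulr0//.
- by rewrite mulrCA.
- by rewrite mulrCA.
Qed.

Lemma vinner_cauchy_schwarz D s t : vL2 D s -> vL2 D t ->
  vinner D s t ^+ 2 <= vinner D s s * vinner D t t.
Proof.
move=> ls lt.
have quad (a : R) : 0 <= vinner D s s - 2 * a * vinner D s t + a ^+ 2 * vinner D t t.
  have lat : vL2 D (fun x => a *: t x) by case: lt => t1 t2; split; exact: L2Z.
  have := vinner_ge0 D (s \- (fun x => a *: t x)).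
  rewrite vinnerBl ?vinnerBr//; try exact: vL2B.
  rewrite vinnerZr// (vinnerC D (fun x => a *: t x) s) vinnerZr// vinnerZr//.
  rewrite (vinnerC D (fun x => a *: t x) t) vinnerZr//.
  by congr (0 <= _); ring.
move: (vinner_ge0 D t) (vinner_ge0 D s) quad.
move: (vinner D s t) (vinner D s s) (vinner D t t) => b a c c0 a0 quad.
move: c0; rewrite le_eqVlt => /predU1P[c0|c0].
  rewrite -c0 mulr0 le_eqVlt sqrf_eq0; apply/orP; left.
  (* With [c = 0] the quadratic is affine in its parameter; at this value it equals [-1], which
     contradicts its sign. *)
  apply/contraT => b0; have := quad ((a + 1) / (2 * b)).
  rewrite -c0 mulr0 addr0 (_ : 2 * _ * b = a + 1); last by field.
  by rewrite opprD addrA subrr add0r oppr_ge0 ler10.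
have := quad (b / c); rewrite (_ : _ + _ = (a * c - b ^+ 2) / c); last first.
  by field; rewrite gt_eqF.
by rewrite pmulr_lge0 ?invr_gt0// subr_ge0.
Qed.

Lemma vnorm2_sqr D s : vnorm2 D s ^+ 2 = vinner D s s.
Proof. by rewrite /vnorm2 sqr_sqrtr// vinner_ge0. Qed.

Lemma is_divB D s ds t dt : is_div D s ds -> is_div D t dt ->
  (forall phi, test_function D phi -> L2 D phi /\ vL2 D (fun x => (partial1 phi x, partial2 phi x))) ->
  is_div D (s \- t) (ds \- dt).
Proof.
move=> [ls lds hs] [lt ldt ht] tphi; split; [exact: vL2B|exact: L2B|].
move=> phi /[dup] /tphi[lphi lgrad] tp.
by rewrite vinnerBl// innerBl// hs// ht//; ring.
Qed.

End SquareIntegrable.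

(** * Derivatives of polynomials and divergences of the local fields *)

Section PolynomialCalculus.
Context {R : realType}.
Implicit Types (f g : R * R -> R) (x : R * R).

Lemma mono_C1 i j : C1 (@mono R i j) (fun x => i%:R * mono i.-1 j x) (fun x => j%:R * mono i j.-1 x).
Proof.
apply: C1_ext (C1M (C1_exp i C1_fst) (C1_exp j C1_snd)) => x; rewrite /mono //=; ring.
Qed.

Lemma Poly2_C1 k f : Poly2 k f -> exists p1 p2, C1 f p1 p2 /\
  [/\ Poly2 k.-1 p1, Poly2 k.-1 p2, Poly2 k (fun x => x.1 * p1 x) & Poly2 k (fun x => x.2 * p2 x)].
Proof.
move: f; apply: Poly2_span.
- move=> i j ij; exists (fun x => i%:R * mono i.-1 j x), (fun x => j%:R * mono i j.-1 x).
  split; first exact: mono_C1.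
  split.
  + case: i ij => [|i] ij; first by apply: Poly2_ext (Poly2_cst _ 0) => x; rewrite mul0r.
    by apply/Poly2Z/Poly2_mono; case: k ij.
  + case: j ij => [|j] ij; first by apply: Poly2_ext (Poly2_cst _ 0) => x; rewrite mul0r.
    by apply/Poly2Z/Poly2_mono; rewrite addnS in ij; case: k ij.
  + apply: Poly2_ext (Poly2Z i%:R (Poly2_mono ij)) => x.
    by case: i {ij} => [|i]; rewrite /mono /= ?exprS; ring.
  + apply: Poly2_ext (Poly2Z j%:R (Poly2_mono ij)) => x.
    by case: j {ij} => [|j]; rewrite /mono /= ?exprS; ring.
- move=> f g [p1 [p2 [c [h1 h2 h3 h4]]]] [q1 [q2 [e [k1 k2 k3 k4]]]].
  exists (fun x => p1 x + q1 x), (fun x => p2 x + q2 x).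
  split; first exact: C1D.
  split; try exact: Poly2D.
  + by apply: Poly2_ext (Poly2D h3 k3) => x; ring.
  + by apply: Poly2_ext (Poly2D h4 k4) => x; ring.
- move=> a f [p1 [p2 [c [h1 h2 h3 h4]]]].
  exists (fun x => a * p1 x), (fun x => a * p2 x).
  split; first exact: C1Z.
  split; try exact: Poly2Z.
  + by apply: Poly2_ext (Poly2Z a h3) => x; ring.
  + by apply: Poly2_ext (Poly2Z a h4) => x; ring.
Qed.

(** In the Raviart-Thomas case [div (x r) = 2 r + x . grad r] keeps the degree [p] of [r]; in the
    BDM case one degree is lost. Both agree with the scalar space of the pair. *)
Lemma local_field_div F p (q : R * R -> R * R) : local_field F p q ->
  exists d1 e1 d2 e2, [/\ C1 (fun x => (q x).1) d1 e1, C1 (fun x => (q x).2) d2 e2 &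
    Poly2 (scalar_degree F p) (fun x => d1 x + e2 x)].
Proof.
case: F => /=.
  move=> [q1 [q2 [r [h1 h2 h3 qE]]]].
  have [a1 [b1 [c1 [k1 _ _ _]]]] := Poly2_C1 h1.
  have [a2 [b2 [c2 [_ l2 _ _]]]] := Poly2_C1 h2.
  have [a3 [b3 [c3 [_ _ m1 m2]]]] := Poly2_C1 h3.
  have D1 := C1D c1 (C1M C1_fst c3); have D2 := C1D c2 (C1M C1_snd c3).
  do 4 eexists; split.
  - by apply: C1_ext D1 => x; rewrite ?qE.
  - by apply: C1_ext D2 => x; rewrite ?qE.
  have := Poly2D (Poly2D (Poly2W (leq_pred p) k1) (Poly2W (leq_pred p) l2))
    (Poly2D (Poly2Z 2 h3) (Poly2D m1 m2)).
  by apply: Poly2_ext => x; ring.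
move=> [q1 [q2 [h1 h2 qE]]].
have [a1 [b1 [c1 [k1 _ _ _]]]] := Poly2_C1 h1.
have [a2 [b2 [c2 [_ l2 _ _]]]] := Poly2_C1 h2.
exists a1, b1, a2, b2; split.
- by apply: C1_ext c1 => x; rewrite ?qE.
- by apply: C1_ext c2 => x; rewrite ?qE.
exact: Poly2D.
Qed.

(* Translations preserve the measure, so [flow_pint] applies to them. *)
Lemma pint_by_parts g g1 g2 B phi p1 p2 (e : R * R) : C1 g g1 g2 ->
  (forall x, g x != 0 -> box B x) -> C1 phi p1 p2 ->
  pint (fun x => (e.1 * g1 x + e.2 * g2 x) * phi x + g x * (e.1 * p1 x + e.2 * p2 x)) = 0.
Proof.
move=> cg sg cphi.
pose N := `|e.1| + `|e.2|; have N0 : 0 <= N by rewrite addr_ge0.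
pose B' := `|B| + N.
have [L L0 lip] := C1_lipschitz B' cg.
have [mg mg1 mg2] := C1_meas cg.
have shiftE n x : ((x.1 + (n.+1%:R^-1 *: e).1, x.2 + (n.+1%:R^-1 *: e).2) : R * R) = x + n.+1%:R^-1 *: e.
  by rewrite [RHS]surjective_pairing.
have h0 n : 0 <= n.+1%:R^-1 :> R by rewrite invr_ge0.
have near_box n x : box B x \/ box B (x + n.+1%:R^-1 *: e) ->
    box B' x /\ box B' (x + n.+1%:R^-1 *: e).
  have hn := h0 n; have hn1 := @harmonic_le1 R n.
  have s1 : `|n.+1%:R^-1 * e.1| <= `|e.1| by rewrite normrM ger0_norm// ler_piMl.
  have s2 : `|n.+1%:R^-1 * e.2| <= `|e.2| by rewrite normrM ger0_norm// ler_piMl.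
  have leB := ler_norm B.
  have n1 := normr_ge0 e.1; have n2 := normr_ge0 e.2.
  rewrite !boxP /B' /N /= /GRing.scale /=.
  move: s1 s2; move: (n.+1%:R^-1 * e.1) (n.+1%:R^-1 * e.2) => u v s1 s2.
  have t1 := ler_normD x.1 u; have t2 := ler_normD x.2 v.
  have t3 := ler_normB (x.1 + u) u; have t4 := ler_normB (x.2 + v) v.
  rewrite !addrK in t3 t4.
  by move=> [[a b]|[a b]]; split; split; lra.
have gout x : ~ box B x -> g x = 0.
  by move=> nb; apply/eqP/contraT => /sg.
have key := @flow_pint R (fun n x => (x.1 + (n.+1%:R^-1 *: e).1, x.2 + (n.+1%:R^-1 *: e).2))
  g (fun x => e.1 * g1 x + e.2 * g2 x) (fun=> e.1) (fun=> e.2) (N + L * N) phi p1 p2.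
rewrite -[RHS]key => //.
- by move=> n; exact: scales_translate.
- move=> n x /=; rewrite ![_ + _ - _]addrAC !subrr !add0r /GRing.scale /= !normrM (ger0_norm (h0 n)).
  rewrite ![_^-1 * _]mulrC; split; apply: ler_wpM2r => //; rewrite /N; have := mulr_ge0 L0 N0;
    rewrite /N; have := normr_ge0 e.1; have := normr_ge0 e.2; lra.
- have [lg _ _] := C1_locb cg; have [C hC] := lg `|B|.
  exists (Num.max C `|B|); split=> // x; split.
    have [bx|nbx] := pselect (box B x); last by rewrite (gout _ nbx) normr0 le_max normr_ge0 orbT.
    rewrite le_max hC//; move: bx; rewrite !boxP => -[a b].
    by split; [apply: le_trans a (ler_norm _)|apply: le_trans b (ler_norm _)].
  by move=> /sg /boxP[a b]; rewrite !le_max; split; apply/orP; right;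
    [apply: le_trans a (ler_norm _)|apply: le_trans b (ler_norm _)].
- by apply: pmeasD; apply: pmeasM => //; exact: pmeas_cst.
- exact: pmeas_cst.
- exact: pmeas_cst.
- move=> n x; rewrite shiftE.
  have bnd : 0 <= (N + L * N) / n.+1%:R by rewrite mulr_ge0// addr_ge0// mulr_ge0.
  have [nb|nb] := pselect (box B x \/ box B (x + n.+1%:R^-1 *: e)); last first.
    by rewrite !gout ?subrr ?normr0// => h; apply: nb; [left|right].
  have [b1 b2] := near_box _ _ nb; rewrite (le_trans (lip _ _ b1 b2))//.
  rewrite /= ![_ + _ - _]addrAC !subrr !add0r /GRing.scale /= !normrM (ger0_norm (h0 n)).
  rewrite -mulrDr mulrCA mulrC ler_wpM2r// -/N lerDr//.
- apply: paeW => x; rewrite (_ : (fun n => _) = (fun n => n.+1%:R * (g (x + n.+1%:R^-1 *: e) - g x))).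
    exact: (@C1_quotient R g g1 g2 x e cg).
  by apply/funext => n; rewrite shiftE.
- by apply: paeW => x; apply: nearW => n; rewrite shiftE -surjective_pairing.
Qed.

End PolynomialCalculus.

(** * Finite element spaces on a mesh and their divergences *)

Section MeshSpaces.
Context {R : realType} (F : mixed_family) (p : nat).
Implicit Types (f g phi : R * R -> R) (s t : R * R -> R * R) (x : R * R)
  (T K : triangle R) (M : seq (triangle R)).

Lemma test_function_nice (Om : set (R * R)) phi : test_function Om phi ->
  [/\ nice phi, nice (partial1 phi) & nice (partial2 phi)].
Proof.
move=> tp; have [l0 l1 l2] := C1_locb (test_function_C1 tp).
have [m0 m1 m2] := C1_meas (test_function_C1 tp).
(* Viewed as a test function on a box, [phi] has its partial derivatives supported in that box as
   well. *)
have [B tB] : exists B, test_function (box B) phi.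
  have [sm [K [cK _ K0]]] := tp.
  have [B [_ hB]] := compact_bounded cK.
  exists (B + 1); split=> //; exists K; split=> // x Kx.
  have : `|x| <= B + 1 by apply: hB => //; rewrite ltrDl.
  by rewrite [`|x|]prod_normE ge_max => /andP[h1 h2]; rewrite boxP.
have out x : ~ box B x -> [/\ phi x = 0, partial1 phi x = 0 & partial2 phi x = 0].
  exact: test_function_partial0 tB.
have key f : pmeas f -> locbounded f -> (forall x, ~ box B x -> f x = 0) -> nice f.
  move=> mf lf f0; have [C hC] := lf B.
  exists (Num.max `|C| B); split=> // x; split.
    have [bx|nbx] := pselect (box B x); last by rewrite f0// normr0 le_max normr_ge0.
    by rewrite le_max (le_trans (hC x bx)) ?ler_norm.
  move=> fx; have bx : box B x by apply: contrapT => /f0/eqP; apply/negP.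
  by move: bx; rewrite boxP => -[h1 h2]; rewrite !le_max h1 h2 !orbT.
by split; apply: key => // x /out[].
Qed.

Lemma test_function_L2 (Om : set (R * R)) phi : test_function Om phi ->
  L2 Om phi /\ vL2 Om (fun x => (partial1 phi x, partial2 phi x)).
Proof.
move=> tp; have [n0 n1 n2] := test_function_nice tp.
have out x : ~ Om x -> [/\ phi x = 0, partial1 phi x = 0 & partial2 phi x = 0].
  exact: test_function_partial0 tp.
have key f : nice f -> (forall x, ~ Om x -> f x = 0) -> L2 Om f.
  move=> nf f0; apply: nice_L2; rewrite patch_id// => x fx.
  by apply: contrapT => /f0/eqP; apply/negP.
by split; [apply: (key _ n0)|split; [apply: (key _ n1)|apply: (key _ n2)]] => x nx; have [] := out x nx.
Qed.

Lemma weakdiv_is_div (Om : set (R * R)) t d : weakdiv t d ->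
  (forall x, ~ Om x -> t x = 0 /\ d x = 0) -> is_div Om t d.
Proof.
move=> [n1 n2 nd H] out.
have supp f : (forall x, ~ Om x -> f x = 0) -> f \_ Om = f.
  move=> f0; apply: patch_id => x fx.
  by apply: contrapT => /f0/eqP; apply/negP.
have p1 : (fun x => (t x).1) \_ Om = (fun x => (t x).1) by apply: supp => x /out[->].
have p2 : (fun x => (t x).2) \_ Om = (fun x => (t x).2) by apply: supp => x /out[->].
have pd : d \_ Om = d by apply: supp => x /out[].
have lt : vL2 Om t by split; apply: nice_L2; rewrite ?p1 ?p2.
have ld : L2 Om d by apply: nice_L2; rewrite pd.
split=> // phi tp; have [lphi lgrad] := test_function_L2 tp.
have out' x : ~ Om x -> [/\ phi x = 0, partial1 phi x = 0 & partial2 phi x = 0].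
  exact: test_function_partial0 tp.
have q0 : phi \_ Om = phi by apply: supp => x /out'[].
have q1 : partial1 phi \_ Om = partial1 phi by apply: supp => x /out'[].
have q2 : partial2 phi \_ Om = partial2 phi by apply: supp => x /out'[].
have [b1 b2] := lgrad; have [a1 a2] := lt.
have i1 := L2M a1 b1; have i2 := L2M a2 b2; have i3 := L2M ld lphi.
apply/eqP; rewrite -addr_eq0; apply/eqP.
rewrite vinnerE// !innerE -!pintD//; last exact: pintegrableD.
by rewrite p1 p2 pd q0 q1 q2; exact: H (test_function_C1 tp).
Qed.

Lemma is_divB_test (Om : set (R * R)) s ds t dt : is_div Om s ds -> is_div Om t dt ->
  is_div Om (s \- t) (ds \- dt).
Proof. by move=> hs ht; apply: is_divB => // phi; exact: test_function_L2. Qed.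

Lemma open_tri_open T : Defs.nondegenerate T -> open [set x | open_tri T x].
Proof. by move=> nT; rewrite -(interior_region nT); exact: open_interior. Qed.

Lemma tri_indicator_L2 (Om : set (R * R)) T : Defs.nondegenerate T ->
  (forall x, open_tri T x -> Om x) -> L2 Om (fun x => (open_tri T x)%:R).
Proof.
move=> nT sub; apply: nice_L2; rewrite patch_id; first exact: nice_open_tri.
by move=> x; case: (boolP (open_tri T x)) => [/sub//|_]; rewrite eqxx.
Qed.

(** Test functions supported in the open triangle are also test functions on [Om]. Against them [s]
    can be replaced by the polynomial field [q] and integrated by parts, so [ds - div q] is
    orthogonal to all of them and du Bois-Reymond applies. *)
Lemma div_local (Om : set (R * R)) s ds T q : Defs.nondegenerate T ->
  (forall x, open_tri T x -> Om x) -> is_div Om s ds -> local_field F p q ->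
  pae (fun x => open_tri T x -> s x = q x) ->
  exists2 r, Poly2 (scalar_degree F p) r & pae (fun x => open_tri T x -> ds x = r x).
Proof.
move=> nT sub [ls lds H] /local_field_div[d1 [e1 [d2 [e2 [c1 c2 pr]]]]] sq.
exists (fun x => d1 x + e2 x) => //.
have [mq1 md1 _] := C1_meas c1; have [lq1 ld1 _] := C1_locb c1.
have [mq2 _ me2] := C1_meas c2; have [lq2 _ le2] := C1_locb c2.
have [s1 s2] := ls.
pose r x := d1 x + e2 x.
have mr : pmeas r by exact: pmeasD.
have lr : locbounded r.
  by move=> B; have [C1 h1] := ld1 B; have [C2 h2] := le2 B; exists (C1 + C2) => x bx;
    rewrite (le_trans (ler_normD _ _))// lerD// ?h1 ?h2.
have nI := nice_open_tri nT; have lI := tri_indicator_L2 nT sub.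
have pI : (fun x => (open_tri T x)%:R : R) \_ Om = fun x => (open_tri T x)%:R.
  by rewrite patch_id// => x; case: (boolP (open_tri T x)) => [/sub//|_]; rewrite eqxx.
pose f x := (open_tri T x)%:R * (ds \_ Om) x - (open_tri T x)%:R * r x.
have fi : pintegrable f.
  apply: pintegrableB; first by have := L2M lI lds; rewrite pI.
  by apply/nice_pintegrable/niceM.
have test0 phi : test_function [set x | open_tri T x] phi -> pint (fun x => f x * phi x) = 0.
  move=> tp; have tpO : test_function Om phi.
    by case: tp => sm [K [cK KT K0]]; split=> //; exists K; split=> // x /KT /= /sub.
  have [n0 n1 n2] := test_function_nice tp.
  have [lphi [lp1 lp2]] := test_function_L2 tpO.
  have out x : ~~ open_tri T x -> [/\ phi x = 0, partial1 phi x = 0 & partial2 phi x = 0].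
    by move=> /negP; exact: test_function_partial0 tp.
  have supp g : (forall x, ~~ open_tri T x -> g x = 0) -> g \_ Om = g.
    move=> g0; apply: patch_id => x gx; apply: sub.
    by apply: contraNT gx => /g0 ->.
  have q0 : phi \_ Om = phi by apply: supp => x /out[].
  have q1 : partial1 phi \_ Om = partial1 phi by apply: supp => x /out[].
  have q2 : partial2 phi \_ Om = partial2 phi by apply: supp => x /out[].
  have nq1 := niceM n1 mq1 lq1; have nq2 := niceM n2 mq2 lq2; have nr := niceM n0 mr lr.
  have nd1 := niceM n0 md1 ld1; have ne2 := niceM n0 me2 le2.
  have [B hB] : exists B, forall x, phi x != 0 -> box B x.
    by case: n0 => B [_ nB]; exists B => x /((nB x).2); rewrite boxP.
  have cphi := test_function_C1 tp.
  have P1 := @pint_by_parts R _ _ _ B _ _ _ (1, 0) cphi hB c1.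
  have P2 := @pint_by_parts R _ _ _ B _ _ _ (0, 1) cphi hB c2.
  have parts : pint (fun x => partial1 phi x * (q x).1 + partial2 phi x * (q x).2) =
      - pint (fun x => phi x * r x).
    apply/eqP; rewrite -addr_eq0 -pintD; last exact: nice_pintegrable.
      apply/eqP; transitivity (0 + 0 : R); last exact: addr0.
      rewrite -[X in X + _]P1 -[X in _ + X]P2 -pintD.
      - by apply: eq_pint => x; rewrite /r /=; ring.
      - by apply: nice_pintegrable; have := niceD nq1 nd1; congr nice; apply/funext => x /=; ring.
      - by apply: nice_pintegrable; have := niceD nq2 ne2; congr nice; apply/funext => x /=; ring.
    by apply: nice_pintegrable; exact: niceD.
  have L : vinner Om s (fun x => (partial1 phi x, partial2 phi x)) =
      pint (fun x => partial1 phi x * (q x).1 + partial2 phi x * (q x).2).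
    rewrite vinnerE// !innerE -pintD; try exact: L2M.
    apply: ae_eq_pint.
    - by apply: pmeasD; apply: pmeasM; exact: L2_meas.
    - by apply: nice_meas; exact: niceD.
    rewrite q1 q2; apply: paeS sq => x sqx.
    case: (boolP (open_tri T x)) => [Tx|/out[_ -> ->]]; last by rewrite !mulr0 !mul0r.
    by rewrite !(patch_in _ (sub x Tx)) (sqx Tx) mulrC [X in _ + X]mulrC.
  have := H phi tpO; rewrite L parts => /oppr_inj Eq.
  have iphi := L2M lds lphi.
  transitivity (inner Om ds phi - pint (fun x => phi x * r x)); last by rewrite Eq subrr.
  rewrite innerE -pintB//; last exact: nice_pintegrable.
  apply: eq_pint => x; rewrite q0 /f.
  by case: (boolP (open_tri T x)) => [Tx|/out[-> _ _]]; rewrite ?mul1r; ring.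
have := du_bois_reymond (open_tri_open nT) fi test0; apply: paeS => x /= h Tx.
have := h Tx; rewrite /f Tx !mul1r patch_in; last exact: sub.
by move=> /eqP; rewrite subr_eq0 => /eqP.
Qed.

Lemma region_pae (P : R * R -> Prop) T : Defs.nondegenerate T ->
  pae (fun x => region T x -> P x) <-> pae (fun x => open_tri T x -> P x).
Proof.
move=> nT; split; first by apply: paeS => x h /(open_tri_region nT).
by move=> h; apply: paeS (paeI h (region_open_tri_ae nT)) => x [h1 h2] /h2.
Qed.

Lemma mesh_in (Om : set (R * R)) M T x : conforming_triangulation Om M -> T \in M ->
  open_tri T x -> Om x.
Proof.
by move=> [_ h _ _] TM Tx; have [nT sub] := h T TM; apply: sub; rewrite interior_region.
Qed.

Lemma mesh_nondegenerate (Om : set (R * R)) M T : conforming_triangulation Om M -> T \in M ->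
  Defs.nondegenerate T.
Proof. by move=> [_ h _ _] /h[]. Qed.

Lemma mesh_cover (Om : set (R * R)) M : conforming_triangulation Om M ->
  pae (fun x => Om x -> exists2 T, T \in M & open_tri T x).
Proof.
move=> cM; have [_ _ cl _] := cM.
have : pae (fun x => forall T, T \in M -> region T x -> open_tri T x).
  by apply: pae_seq => T TM; apply: region_open_tri_ae (mesh_nondegenerate cM TM).
apply: paeS => x h Ox; have : closure Om x by exact: subset_closure.
by rewrite cl => -[T TM Tx]; exists T => //; exact: h.
Qed.

Lemma segment_null (v w : R * R) : v != w -> pae (fun x => ~ segment v w x).
Proof.
move=> vw; pose l x := (w.1 - v.1) * (x.2 - v.2) - (w.2 - v.2) * (x.1 - v.1).
have al : affine l (- (w.2 - v.2)) (w.1 - v.1) by move=> x u; rewrite /l /=; ring.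
have := affine_ker_null al; have nz : (- (w.2 - v.2), w.1 - v.1) != (0, 0).
  apply: contra vw => /eqP[/eqP + /eqP]; rewrite oppr_eq0 !subr_eq0 => /eqP h2 /eqP h1.
  by rewrite [v]surjective_pairing [w]surjective_pairing h1 h2.
move=> /(_ nz); apply: paeS => x /eqP lx [a [_ xE]]; apply: lx.
by rewrite xE /l /=; ring.
Qed.

(** Conformity makes the intersection of two different triangles empty, a point or a segment, and
    each of these is a null set. *)
Lemma mesh_disjoint (Om : set (R * R)) M : conforming_triangulation Om M ->
  pae (fun x => forall T, T \in M -> forall T', T' \in M ->
    open_tri T x -> open_tri T' x -> T = T').
Proof.
move=> cM; have [_ _ _ pw] := cM.
apply: pae_seq => T TM; apply: pae_seq => T' TM'.
have [->|TT'] := eqVneq T T'; first exact: paeW.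
have inter x : open_tri T x -> open_tri T' x -> (region T `&` region T') x.
  by move=> h1 h2; split; apply: open_tri_region => //; exact: mesh_nondegenerate cM _.
case: (pw T T' TM TM' TT') => [E|[v [_ _ E]]|[v [w [vw _ _ E]]]].
- by apply: paeW => x h1 h2; have := inter x h1 h2; rewrite E.
- have al : affine (fun x : R * R => x.1 - v.1) 1 0 by move=> x u /=; ring.
  have nz : (1, 0) != (0, 0) :> R * R by apply/eqP => -[/eqP]; rewrite oner_eq0.
  apply: paeS (affine_ker_null al nz) => x /eqP vx h1 h2; exfalso; apply: vx.
  by have := inter x h1 h2; rewrite E => ->; rewrite subrr.
- apply: paeS (segment_null vw) => x nx h1 h2; exfalso; apply: nx.
  by have := inter x h1 h2; rewrite E.
Qed.

Definition refines M M' : Prop :=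
  forall K, K \in M' -> exists2 T, T \in M & forall x, open_tri K x -> open_tri T x.

Lemma U_h_refines (Om : set (R * R)) M M' v : conforming_triangulation Om M ->
  conforming_triangulation Om M' -> refines M M' -> U_h F p Om M v -> U_h F p Om M' v.
Proof.
move=> cM cM' ref [lv h]; split=> // K KM; have [T TM KT] := ref K KM.
have [q pq /(region_pae _ (mesh_nondegenerate cM TM)) hq] := h T TM; exists q => //.
apply/(region_pae _ (mesh_nondegenerate cM' KM)).
by apply: paeS hq => x hx /KT.
Qed.

Lemma Sigma_h_refines (Om : set (R * R)) M M' s : conforming_triangulation Om M ->
  conforming_triangulation Om M' -> refines M M' ->
  Sigma_h F p Om M s -> Sigma_h F p Om M' s.
Proof.
move=> cM cM' ref [lv h]; split=> // K KM; have [T TM KT] := ref K KM.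
have [q pq /(region_pae _ (mesh_nondegenerate cM TM)) hq] := h T TM; exists q => //.
apply/(region_pae _ (mesh_nondegenerate cM' KM)).
by apply: paeS hq => x hx /KT.
Qed.

Lemma U_hB (Om : set (R * R)) M v w : U_h F p Om M v -> U_h F p Om M w ->
  U_h F p Om M (v \- w).
Proof.
move=> [lv hv] [lw hw]; split; first exact: L2B.
move=> T TM; have [q pq qv] := hv T TM; have [r pr rw] := hw T TM.
exists (fun x => q x - r x); first exact: Poly2B.
by apply: paeS (paeI qv rw) => x [h1 h2] Tx; rewrite /= h1// h2.
Qed.

Lemma Sigma_hB (Om : set (R * R)) M s t : Sigma_h F p Om M s -> Sigma_h F p Om M t ->
  Sigma_h F p Om M (s \- t).
Proof.
move=> [[ds Hs] hv] [[dt Ht] hw]; split; first by exists (ds \- dt); exact: is_divB_test.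
move=> T TM; have [q pq qv] := hv T TM; have [r pr rw] := hw T TM.
exists (fun x => q x + (-1) *: r x); first by apply: local_fieldD => //; exact: local_fieldZ.
by apply: paeS (paeI qv rw) => x [h1 h2] Tx; rewrite /= h1// h2// scaleN1r.
Qed.

Lemma U_h_indicator (Om : set (R * R)) M T : conforming_triangulation Om M -> T \in M ->
  U_h F p Om M (fun x => (open_tri T x)%:R).
Proof.
move=> cM TM; split.
  apply: tri_indicator_L2; first exact: mesh_nondegenerate cM TM.
  by move=> x; exact: mesh_in cM TM.
move=> K KM; exists (fun=> (K == T)%:R); first exact: Poly2_cst.
apply/(region_pae _ (mesh_nondegenerate cM KM)).
apply: paeS (mesh_disjoint cM) => x h Kx.
have [<-|nKT] := eqVneq K T; first by rewrite Kx.
by case: (boolP (open_tri T x)) => // Tx; rewrite (h K KM T TM Kx Tx) eqxx in nKT.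
Qed.

(** The equation tests [ds - g] against the discrete space only; since [ds] is piecewise polynomial
    by [div_local], the difference belongs to that space and can be tested with itself. *)
Lemma discrete_div (Om : set (R * R)) M g s u ds : conforming_triangulation Om M ->
  U_h F p Om M g -> mixed_solution Om (Sigma_h F p Om M) (U_h F p Om M) g s u ->
  is_div Om s ds -> pae (fun x => Om x -> ds x = g x).
Proof.
move=> cM Ug [Ss Uu _ H] Hds; have [_ lds _] := Hds; have [lg _] := Ug.
have Uds : U_h F p Om M ds.
  split=> // T TM; have nT := mesh_nondegenerate cM TM; have [_ hq] := Ss.
  have [q lq /(region_pae _ nT) sq] := hq T TM.
  have [r pr dr] := div_local nT (fun x => @mesh_in Om M T x cM TM) Hds lq sq.
  by exists r => //; apply/region_pae.
have Uv := U_hB Uds Ug; have [lv _] := Uv.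
have : inner Om (ds \- g) (ds \- g) = 0 by rewrite innerBl// (H ds _ Hds Uv) subrr.
move=> /(inner_eq0_ae lv); apply: paeS => x h Ox.
by have /eqP := h Ox; rewrite subr_eq0 => /eqP.
Qed.

Lemma pint_sum (I : Type) (r : seq I) (f : I -> R * R -> R) :
  (forall i, nice (f i)) -> pint (fun x => \sum_(i <- r) f i x) = \sum_(i <- r) pint (f i).
Proof.
move=> nf; elim: r => [|i r IH].
  by rewrite big_nil -[RHS]pint0; apply: eq_pint => x; rewrite big_nil.
rewrite big_cons -IH -pintD; last exact/nice_pintegrable/nice_sum.
  by apply: eq_pint => x; rewrite big_cons.
exact: nice_pintegrable.
Qed.

Lemma big_only (V : zmodType) (I : eqType) (r : seq I) (i : I) (f : I -> V) :
  uniq r -> i \in r -> (forall j, j \in r -> j != i -> f j = 0) ->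
  \sum_(j <- r) f j = f i.
Proof.
move=> ur ir f0; rewrite (bigD1_seq i)//= big_seq_cond big1 ?addr0// => j /andP[].
exact: f0.
Qed.

End MeshSpaces.

(** * Quasi-orthogonality *)

Section DiscreteRightInverse.
Context {R : realType} (F : mixed_family) (p : nat).
Implicit Types (g : R * R -> R) (x : R * R) (T K : triangle R) (M : seq (triangle R)).

Lemma nvb_refines (Om : set (R * R)) M M' : conforming_triangulation Om M ->
  nvb_refinement M M' -> refines M M'.
Proof.
move=> cM nvb; have [uM nd _ _] := cM.
have [Lf [H1 H2]] := forest_leaves (nvb_forest nvb) uM.
move=> K /H2[T TM KL]; exists T => //.
by have [_] := bisection_tree_sub (H1 T TM).1 (nd T TM).1 KL.
Qed.

Lemma norm2_region_sqr T g (Om : set (R * R)) d : Defs.nondegenerate T ->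
  (forall x, open_tri T x -> Om x) -> L2 Om g -> nice d ->
  (forall x, ~~ open_tri T x -> d x = 0) -> pae (fun x => open_tri T x -> d x = g x) ->
  norm2 (region T)° g ^+ 2 = pint (fun x => d x ^+ 2).
Proof.
move=> nT sub lg nd d0 dg; have ge0 : 0 <= inner (region T)° g g.
  by rewrite innerE; apply: pint_ge0 => x; rewrite -expr2 sqr_ge0.
rewrite /norm2 sqr_sqrtr// innerE interior_region//.
have mg : pmeas (g \_ [set x | open_tri T x]).
  rewrite (_ : g \_ _ = fun x => (open_tri T x)%:R * (g \_ Om) x).
    by apply: pmeasM; [exact: pmeas_open_tri|exact: L2_meas].
  apply/funext => x; case: (boolP (open_tri T x)) => Tx.
    by rewrite mul1r !patch_in//; exact: sub.
  by rewrite mul0r patch_notin//=; exact/negP.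
apply: ae_eq_pint.
- exact: pmeasM.
- by apply: nice_meas; have := niceMM nd nd; congr nice; apply/funext => x; rewrite expr2.
apply: paeS dg => x h; case: (boolP (open_tri T x)) => Tx.
  by rewrite !patch_in// -h// expr2.
by rewrite patch_notin ?d0//= ?mul0r ?expr0n//; exact/negP.
Qed.

Lemma discrete_right_inverse (Om : set (R * R)) M M' g : valid_order F p ->
  conforming_triangulation Om M -> conforming_triangulation Om M' ->
  nvb_refinement M M' -> U_h F p Om M' g ->
  (forall T, T \in M -> inner Om g (fun x => (open_tri T x)%:R) = 0) ->
  exists t d, [/\ is_div Om t d, Sigma_h F p Om M' t, pae (fun x => Om x -> d x = g x) &
    vinner Om t t <= 4 * \sum_(T <- M) diam T ^+ 2 * norm2 (region T)° g ^+ 2].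
Proof.
move=> Fp cM cM' nvb [lg pg] mean.
have [uM ndM _ _] := cM.
have [Lf [H1 H2]] := forest_leaves (nvb_forest nvb) uM.
(* Stated for every triangle, with the zero field off the mesh, so that [choice] gives a total
   function and the lemmas on finite sums apply without a membership condition. *)
have piece T : exists td : (R * R -> R * R) * (R * R -> R), weakdiv td.1 td.2 /\
    (forall x, ~~ open_tri T x -> td.1 x = 0 /\ td.2 x = 0) /\
    (T \in M -> [/\ pae (fun x => open_tri T x -> td.2 x = g x),
      forall K, K \in Lf T -> K \in M' -> exists2 q, local_field F p q &
        pae (fun x => open_tri K x -> td.1 x = q x) &
      pint (fun x => sqn (td.1 x)) <= 4 * (diam T ^+ 2 * norm2 (region T)° g ^+ 2)]).
  have [TM|nTM] := boolP (T \in M); last first.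
    by exists (fun=> 0, fun=> 0); split; [exact: weakdiv0|split].
  have nT := (ndM T TM).1; have sub x := @mesh_in R Om M T x cM TM.
  have [bT sT] := H1 T TM; have leafsub := bisection_tree_sub bT nT.
  have gpoly K : K \in Lf T -> exists2 q, Poly2 (scalar_degree F p) q &
      pae (fun x => open_tri K x -> g x = q x).
    move=> KL; have [q pq gq] := pg K (sT K KL); exists q => //.
    by apply/(region_pae _ (leafsub K KL).1).
  have [t [d [c [wd out dg tq tb]]]] := tree_right_inverse Fp bT nT gpoly.
  have [n1 n2 nd _] := wd.
  have d0 x : ~~ open_tri T x -> d x = 0 by move=> /out[].
  have nI := nice_open_tri nT; have lI := tri_indicator_L2 nT sub.
  (* On [T] one has [d = g - c] and [g] has mean zero, so the integral of [d] is [- c |T|]. It is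
     zero because [d] is a weak divergence. Hence [c = 0], or [T] is null and the claim holds
     trivially almost everywhere. *)
  have dint : pint d = - (c * pint (fun x => (open_tri T x)%:R)).
    have iI := nice_pintegrable nI; have igI := L2M lg lI.
    transitivity (inner Om g (fun x => (open_tri T x)%:R) - c * pint (fun x => (open_tri T x)%:R)).
      rewrite innerE -pintZ// -pintB//; last exact: pintegrableZ.
      apply: ae_eq_pint; first exact: nice_meas.
        apply: pmeasB; first exact: pintegrable_meas.
        by apply: pmeasM; [exact: pmeas_cst|exact: nice_meas].
      apply: paeS dg => x h; case: (boolP (open_tri T x)) => Tx.
        by rewrite !patch_in ?Tx ?h ?mulr1//; exact: sub.
      rewrite d0// mulr0 subr0 patchE; case: ifP => _; rewrite patchE; case: ifP => _;
        by rewrite ?(negbTE Tx) /point /= ?mulr0 ?mul0r.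
    by rewrite mean// sub0r.
  have dgT : pae (fun x => open_tri T x -> d x = g x).
    have /eqP := pint_weakdiv wd; rewrite dint oppr_eq0 mulf_eq0 => /orP[/eqP c0|/eqP I0].
      by apply: paeS dg => x h /h; rewrite c0 subr0.
    have := pint_eq0_ae (nice_pintegrable nI) (fun x => ler0n _ _) I0.
    by apply: paeS => x + Tx; rewrite Tx => /eqP; rewrite oner_eq0.
  exists (t, d); split=> //; split=> // _; split=> //; first by move=> K /tq.
  rewrite (norm2_region_sqr nT sub lg nd d0 dgT) /=; apply: le_trans tb _.
  rewrite mulrA; apply: ler_wpM2r; first by apply: pint_ge0 => x; exact: sqr_ge0.
  (* The tree constant 3/2 times the 5/2 of [tsize_diam] is 15/4, rounded up to 4. *)
  have := tsize_diam T; have := sqr_ge0 (diam T); lra.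
have [td H] := choice piece.
pose t x := \sum_(T <- M) (td T).1 x; pose d x := \sum_(T <- M) (td T).2 x.
have wtd : weakdiv t d by apply: weakdiv_sum => T; case: (H T).
have tout x : ~ Om x -> t x = 0 /\ d x = 0.
  move=> nO; have z T : T \in M -> (td T).1 x = 0 /\ (td T).2 x = 0.
    by move=> TM; have [_ [out _]] := H T; apply: out; apply/negP => /(mesh_in cM TM).
  by rewrite /t /d !big_seq; split; apply: big1 => T /z[].
have dt : is_div Om t d by exact: weakdiv_is_div.
have only x T : (forall T, T \in M -> forall T', T' \in M ->
    open_tri T x -> open_tri T' x -> T = T') -> T \in M -> open_tri T x ->
    t x = (td T).1 x /\ d x = (td T).2 x.
  move=> disj TM Tx; have z T' : T' \in M -> T' != T -> ~~ open_tri T' x.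
    by move=> TM'; apply: contraNN => Tx'; apply/eqP; exact: disj.
  rewrite /t /d; split; apply: big_only => // T' TM' TT';
    by have [_ [out _]] := H T'; have [] := out x (z T' TM' TT').
exists t, d; split=> //.
- split; first by exists d.
  move=> K KM; have [T TM KL] := H2 K KM; have [_ [_ /(_ TM)[_ tq _]]] := H T.
  have [q lq hq] := tq K KL KM; exists q => //.
  apply/(region_pae _ (mesh_nondegenerate cM' KM)).
  have [_ KT] := bisection_tree_sub (H1 T TM).1 (ndM T TM).1 KL.
  apply: paeS (paeI hq (mesh_disjoint cM)) => x [hx disj] Kx.
  by have [-> _] := only x T disj TM (KT x Kx); exact: hx.
- have dT : pae (fun x => forall T, T \in M -> open_tri T x -> (td T).2 x = g x).
    by apply: pae_seq => T TM; have [_ [_ /(_ TM)[]]] := H T.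
  apply: paeS (paeI (mesh_cover cM) (paeI (mesh_disjoint cM) dT)) => x [cov [disj dTx]] Ox.
  have [T TM Tx] := cov Ox; have [_ ->] := only x T disj TM Tx.
  exact: dTx.
- have nsq T : nice (fun x => sqn ((td T).1 x)).
    by have [[n1 n2 _ _] _] := H T; have := niceD (niceMM n1 n1) (niceMM n2 n2);
      congr nice; apply/funext => x; rewrite /sqn !expr2.
  have [n1 n2 _ _] := wtd.
  have -> : vinner Om t t = pint (fun x => sqn (t x)).
    rewrite /vinner Rintegral_mkcond; apply: eq_pint => x.
    have [Ox|nOx] := pselect (Om x); first by rewrite patch_in// /sqn !expr2.
    by rewrite patch_notin// (tout x nOx).1 /sqn /= !expr0n addr0.
  apply: (@le_trans _ _ (\sum_(T <- M) pint (fun x => sqn ((td T).1 x)))); last first.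
    rewrite mulr_sumr !big_seq; apply: ler_sum => T TM.
    by have [_ [_ /(_ TM)[]]] := H T.
  rewrite -pint_sum//; apply: le_pint_ae.
  + by have := niceD (niceMM n1 n1) (niceMM n2 n2);
      congr nice; apply/funext => x; rewrite /sqn !expr2.
  + exact: nice_sum.
  (* Almost everywhere at most one summand of [t x] is nonzero, so the square of the sum has no
     cross terms. *)
  apply: paeS (mesh_disjoint cM) => x disj.
  have [[T TM Tx]|nT] := pselect (exists2 T, T \in M & open_tri T x).
    have [-> _] := only x T disj TM Tx.
    rewrite (bigD1_seq T)//= lerDl; apply: sumr_ge0 => T' _; exact: sqn_ge0.
  rewrite (_ : t x = 0); first by rewrite /sqn /= !expr0n addr0 sumr_ge0// => T _; exact: sqn_ge0.
  rewrite /t big_seq; apply: big1 => T TM; have [_ [out _]] := H T.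
  have nTx : ~~ open_tri T x by apply/negP => Tx; apply: nT; exists T.
  by have [] := out x nTx.
Qed.

Lemma Hdiv_div (Om : set (R * R)) s : Hdiv Om s -> exists2 ds, is_div Om s ds & vL2 Om s.
Proof. by move=> [ds h]; exists ds => //; case: h. Qed.

Lemma L2_cst0 (Om : set (R * R)) : L2 Om (fun=> (0 : R)).
Proof.
apply: nice_L2; rewrite patch_id; first exact: nice0.
by move=> x; rewrite eqxx.
Qed.

Lemma inner0l (Om : set (R * R)) g : inner Om (fun=> 0) g = 0.
Proof.
rewrite innerE -[RHS]pint0; apply: eq_pint => x.
by rewrite !patchE; case: ifP => _; rewrite /point /= mul0r.
Qed.

(** The squared form bounds the inner product from both sides: the first claim of the theorem needs
    the upper bound, the estimate with [delta] the lower one. *)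
Lemma quasi_orthogonality (Om : set (R * R)) M M' f fM fM' o s sM sM' u uM uM' :
  valid_order F p -> L2 Om f ->
  conforming_triangulation Om M -> conforming_triangulation Om M' ->
  nvb_refinement M M' ->
  is_L2proj Om (U_h F p Om M) f fM -> is_L2proj Om (U_h F p Om M') f fM' ->
  is_osc F p Om M fM' o ->
  mixed_solution Om (Hdiv Om) (L2 Om) f s u ->
  mixed_solution Om (Sigma_h F p Om M) (U_h F p Om M) fM sM uM ->
  mixed_solution Om (Sigma_h F p Om M') (U_h F p Om M') fM' sM' uM' ->
  vinner Om (s \- sM') (sM' \- sM) ^+ 2 <= vinner Om (s \- sM') (s \- sM') * (4 * o ^+ 2).
Proof.
move=> Fp lf cM cM' nvb [UfM pM] [UfM' pM'] [Qg [UQ pQ] ->] sol solM solM'.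
have ref := nvb_refines cM nvb.
have UfM2 := U_h_refines cM cM' ref UfM; have UQ2 := U_h_refines cM cM' ref UQ.
have [lfM _] := UfM; have [lfM' _] := UfM'; have [lQ _] := UQ.
(* The oscillation is defined with a projection of [fM'], the coarse problem with a projection of
   [f]. They agree because the coarse space is contained in the fine one. *)
have QfM : pae (fun x => Om x -> Qg x = fM x).
  have Uv := U_hB UQ UfM; have [lv _] := Uv.
  have : inner Om (Qg \- fM) (Qg \- fM) = 0.
    have := pM _ Uv; have := pM' _ (U_h_refines cM cM' ref Uv); have := pQ _ Uv.
    by rewrite !innerBl//; lra.
  move=> /(inner_eq0_ae lv); apply: paeS => x h Ox.
  by have /eqP := h Ox; rewrite subr_eq0 => /eqP.
have Ug := U_hB UfM' UQ2; have [lg _] := Ug.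
have mean T : T \in M -> inner Om (fM' \- Qg) (fun x => (open_tri T x)%:R) = 0.
  by move=> TM; apply: pQ; exact: U_h_indicator.
have [t [d [dt St dg tb]]] := discrete_right_inverse Fp cM cM' nvb Ug mean.
have S_ge0 : 0 <= \sum_(T <- M) diam T ^+ 2 * norm2 (region T)° (fM' \- Qg) ^+ 2.
  by apply: sumr_ge0 => T _; rewrite mulr_ge0// sqr_ge0.
rewrite sqr_sqrtr//.
have [Hs lu Eq _] := sol; have [SM _ _ _] := solM; have [SM' UuM' EqM' _] := solM'.
have luM' := UuM'.1.
have [ds Ds ls] := Hdiv_div Hs.
have [dM DM lM] := Hdiv_div SM.1.
have [dM' DM' lM'] := Hdiv_div SM'.1.
have eM := discrete_div cM UfM solM DM; have eM' := discrete_div cM' UfM' solM' DM'.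
have [lt _ _] := dt.
have Dtau := is_divB_test DM' DM; have Dr := is_divB_test Dtau dt.
have Stau := Sigma_hB SM' (Sigma_h_refines cM cM' ref SM); have Sr := Sigma_hB Stau St.
have [ltau _ _] := Dtau; have [lr ldr _] := Dr.
have dr0 v : L2 Om v -> inner Om ((dM' \- dM) \- d) v = 0.
  move=> lv; rewrite -[RHS](inner0l Om v); apply: inner_ae => //; first exact: L2_cst0.
  apply: paeS (paeI (paeI eM eM') (paeI QfM dg)) => x [[h1 h2] [h3 h4]] Ox.
  by rewrite /= h1// h2// h4//= h3// subrr.
have le : vL2 Om (s \- sM') by exact: vL2B.
(* The field [tau - t] is divergence free and lies in the fine space, hence in H(div). The
   continuous and the fine equation give that both [s] and [sM'] are orthogonal to it. *)
have orth : vinner Om (s \- sM') ((sM' \- sM) \- t) = 0.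
  rewrite vinnerBl//.
  have := Eq _ _ Sr.1 Dr; rewrite dr0// subr0 => ->.
  by have := EqM' _ _ Sr Dr; rewrite dr0// subr0 => ->; rewrite subrr.
move: orth; rewrite vinnerBr// => /eqP; rewrite subr_eq0 => /eqP ->.
apply: le_trans (vinner_cauchy_schwarz le lt) _.
by apply: ler_wpM2l tb; exact: vinner_ge0.
Qed.

End DiscreteRightInverse.

Theorem theorem3p2 (R : realType) (F : mixed_family) (p : nat)
    (Fp : valid_order F p) (gamma : R) :
  exists C0 : R, 0 < C0 /\
  forall (Om : set (R * R)) (TH : seq (triangle R)),
    polygonal_domain Om -> simply_connected Om ->
    conforming_triangulation Om TH -> shape_regular gamma TH ->
  forall (f : R * R -> R) (Th : seq (triangle R)),
    L2 Om f ->
    nvb_refinement TH Th -> conforming_triangulation Om Th ->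
  forall (fH fh : R * R -> R) (osch : R)
    (sigma sigmaH sigmah : R * R -> R * R) (u uH uh : R * R -> R),
    is_L2proj Om (U_h F p Om TH) f fH ->
    is_L2proj Om (U_h F p Om Th) f fh ->
    is_osc F p Om TH fh osch ->
    mixed_solution Om (Hdiv Om) (L2 Om) f sigma u ->
    mixed_solution Om (Sigma_h F p Om TH) (U_h F p Om TH) fH sigmaH uH ->
    mixed_solution Om (Sigma_h F p Om Th) (U_h F p Om Th) fh sigmah uh ->
  [/\ vinner Om (sigma \- sigmah) (sigmah \- sigmaH)
        <= Num.sqrt C0 * vnorm2 Om (sigma \- sigmah) * osch,
      forall delta : R, 0 < delta ->
        (1 - delta) * vnorm2 Om (sigma \- sigmah) ^+ 2
        <= vnorm2 Om (sigma \- sigmaH) ^+ 2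
           - vnorm2 Om (sigmah \- sigmaH) ^+ 2
           + C0 / delta * osch ^+ 2 &
      osch = 0 ->
        vnorm2 Om (sigma \- sigmah) ^+ 2
        = vnorm2 Om (sigma \- sigmaH) ^+ 2
          - vnorm2 Om (sigmah \- sigmaH) ^+ 2].
Proof.
exists 4; split=> // Om TH _ _ cH _ f Th lf nvb ch fH fh osch s sH sh u uH uh.
move=> pH ph po sol solH solh.
have key := quasi_orthogonality Fp lf cH ch nvb pH ph po sol solH solh.
have o0 : 0 <= osch by case: po => Q _ ->; exact: sqrtr_ge0.
have [Hs _ _ _] := sol; have [SH _ _ _] := solH; have [Sh _ _ _] := solh.
have [_ _ ls] := Hdiv_div Hs; have [_ _ lH] := Hdiv_div SH.1; have [_ _ lh] := Hdiv_div Sh.1.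
have expand : vinner Om (s \- sH) (s \- sH) = vinner Om (s \- sh) (s \- sh)
    + 2 * vinner Om (s \- sh) (sh \- sH) + vinner Om (sh \- sH) (sh \- sH).
  rewrite !vinnerBl ?vinnerBr//; try exact: vL2B.
  by rewrite (vinnerC _ sH s) (vinnerC _ sh s) (vinnerC _ sH sh); ring.
rewrite !vnorm2_sqr expand.
have A0 := vinner_ge0 Om (s \- sh).
move: key; rewrite -(vnorm2_sqr Om (s \- sh)).
have N0 : 0 <= vnorm2 Om (s \- sh) by exact: sqrtr_ge0.
move: (vinner _ _ _) (vinner _ (sh \- sH) _) (vnorm2 _ _) N0 => X B N N0 key; split.
- rewrite (_ : 4 = 2 ^+ 2); last by ring.
  rewrite sqrtr_sqr ger0_norm//.
  have h : 0 <= 2 * N * osch by rewrite !mulr_ge0.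
  have [X0|X0] := leP X 0; first exact: le_trans X0 h.
  rewrite -(@ler_pXn2r _ 2%N)// ?nnegrE// ?(ltW X0)//.
  by apply: le_trans key _; rewrite le_eqVlt; apply/orP; left; apply/eqP; ring.
- move=> delta d0.
  have Y0 : 0 <= delta * N ^+ 2 by rewrite mulr_ge0// ?sqr_ge0// ltW.
  have Z0 : 0 <= 4 / delta * osch ^+ 2 by rewrite mulr_ge0 ?sqr_ge0// divr_ge0// ltW.
  (* The two terms on the right have a product in which [delta] cancels and which is at least
     [X ^+ 2]. The claim is then the inequality [4 Y Z <= (Y + Z) ^ 2]. *)
  have YZ : delta * N ^+ 2 * (4 / delta * osch ^+ 2) = N ^+ 2 * (4 * osch ^+ 2).
    by field; rewrite gt_eqF.
  suff : - (2 * X) <= delta * N ^+ 2 + 4 / delta * osch ^+ 2.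
    by rewrite mulrBl mul1r; move: (delta * _) (4 / delta * _) => Y Z; lra.
  rewrite -YZ in key; move: (delta * _) (4 / delta * _) Y0 Z0 key => Y Z Y0 Z0 key.
  have [X0|X0] := leP 0 X; first by rewrite (@le_trans _ _ 0) ?addr_ge0// oppr_le0 mulr_ge0.
  rewrite -(@ler_pXn2r _ 2%N)// ?nnegrE ?addr_ge0//; last by rewrite oppr_ge0; lra.
  by have := sqr_ge0 (Y - Z); move: key; rewrite sqrrB sqrrD sqrrN exprMn; lra.
- move=> oE; move: key; rewrite oE expr0n !mulr0 => key.
  have /eqP : X ^+ 2 = 0 by apply/eqP; rewrite eq_le key sqr_ge0.
  by rewrite sqrf_eq0 => /eqP ->; ring.
Qed.
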